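(* Let $X=\{X(t),t\in\mathbb{R}_+\}$ be a symmetric Lévy process in $\mathbb{R}^d$ with characteristic exponent $\psi$, and let $\alpha\in(0,2]$. Assume either (i) $\alpha<d$ and Condition (B3) holds with this $\alpha$; or (ii) $\alpha=d$ and Condition (B4) holds with this $\alpha$ (Conditions (B3) and (B4) are stated in the context). Then with probability one, $$\dim_{\mathrm H}X(E)=\alpha\dim_{\mathrm H}E\quad\text{and}\quad\dim_{\mathrm P}X(E)=\alpha\dim_{\mathrm P}E$$ for all Borel sets $E\subseteq\mathbb{R}_+$ (simultaneously).
   Context: A Lévy process $X$ in $\mathbb{R}^d$ is a process with stationary and independent increments, continuous in probability, with $X(0)=0$ a.s.; its sample paths are assumed to be almost surely right continuous with left limits. Its characteristic exponent $\psi$ is defined by $\mathbb{E}[e^{i\langle\xi,X(t)\rangle}]=e^{-t\psi(\xi)}$ for $\xi\in\mathbb{R}^d$, $t\ge0$. $X$ is symmetric if $X$ and $-X$ have the same law; then $\psi$ is a nonnegative real-valued function. $\mathbb{R}_+=[0,\infty)$ and $X(E)=\{X(t):t\in E\}$. $\dim_{\mathrm H}$ and $\dim_{\mathrm P}$ denote Hausdorff and packing dimension. Condition (B3), for a constant $\alpha\in(0,2]$: - If $0<\alpha<2$: for every $\zeta'\in(0,2-\alpha)$ there are finite constants $K_5\ge1$ and $\tau>0$ such that $$K_5^{-1}|\xi|^{\alpha-\zeta'}\le\psi(\xi)\le K_5|\xi|^{\alpha+\zeta'}\quad\text{for all }\xi\in\mathbb{R}^d\text{ with }|\xi|\ge\tau.$$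 - If $\alpha=2$: for every $\zeta'\in(0,2)$ there are finite constants $K_5\ge1$ and $\tau>0$ such that $$K_5^{-1}|\xi|^{2-\zeta'}\le\psi(\xi)\le K_5|\xi|^{2}\quad\text{for all }\xi\in\mathbb{R}^d\text{ with }|\xi|\ge\tau.$$ Condition (B4): Condition (B3) holds and, in addition, the left inequalities in the displays of (B3) hold for all $\xi\in\mathbb{R}^d$. *)

(* Defs.v *)
From mathcomp Require Import all_boot all_order all_algebra.
From mathcomp Require Import all_classical all_reals all_analysis.
From mathcomp Require Import complex.
Set Implicit Arguments.
Unset Strict Implicit.
Unset Printing Implicit Defensive.
Import Order.TTheory GRing.Theory Num.Theory.
Import numFieldNormedType.Exports.
Local Open Scope classical_set_scope.
Local Open Scope ring_scope.

(* The library norm on 'rV[R]_d is the sup norm; the Euclidean structure of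
   R^d is therefore introduced explicitly. *)
Definition dotv (R : realType) (d : nat) (x y : 'rV[R]_d) : R :=
  \sum_(i < d) x 0 i * y 0 i.

Definition euclid_norm (R : realType) (d : nat) (x : 'rV[R]_d) : R :=
  Num.sqrt (dotv x x).

Definition euclid_dist (R : realType) (d : nat) (x y : 'rV[R]_d) : R := euclid_norm (x - y).

Definition real_dist (R : realType) (s t : R) : R := `|s - t|.

Definition borel (R : realType) (d : nat) : set (set 'rV[R]_d) :=
  <<s [set U : set 'rV[R]_d | open U] >>.

Section Dimensions.
Variables (R : realType) (V : Type) (dist : V -> V -> R).
Local Open Scope ereal_scope.

(* The element 0 makes the diameter of the empty set 0 rather than -oo. *)
Definition diam (U : set V) : \bar R :=
  ereal_sup (0 |` [set (dist p.1 p.2)%:E | p in U `*` U]).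

(* Countable (finite or infinite) covers are families indexed by a set
   I of naturals. *)
Definition hausdorff_premeasure (s delta : R) (A : set V) : \bar R :=
  ereal_inf [set v : \bar R | exists (I : set nat) (U : nat -> set V),
    [/\ A `<=` \bigcup_(i in I) U i,
        forall i, I i -> diam (U i) <= delta%:E &
        v = \esum_(i in I) (diam (U i) `^ s)]].

Definition hausdorff_measure (s : R) (A : set V) : \bar R :=
  ereal_sup [set hausdorff_premeasure s delta A
            | delta in [set delta : R | (0 < delta)%R]].

Definition hausdorff_dim (A : set V) : \bar R :=
  ereal_inf [set s%:E | s in
    [set s : R | (0 <= s)%R /\ hausdorff_measure s A = 0]].

(* Countable packings of A by disjoint closed balls centred in A. *)
Definition packing_sup (s delta : R) (A : set V) : \bar R :=
  ereal_sup [set v : \bar R | exists (I : set nat) (c : nat -> V) (r : nat -> R),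
    [/\ forall i, I i -> A (c i) /\ (0 < r i <= delta)%R,
        trivIset I (fun i => [set y | (dist (c i) y <= r i)%R]) &
        v = \esum_(i in I) ((2 * r i) `^ s)%R%:E]].

Definition packing_premeasure (s : R) (A : set V) : \bar R :=
  ereal_inf [set packing_sup s delta A
            | delta in [set delta : R | (0 < delta)%R]].

Definition packing_measure (s : R) (A : set V) : \bar R :=
  ereal_inf [set v : \bar R | exists F : nat -> set V,
    A `<=` \bigcup_n F n /\ v = \sum_(0 <= n <oo) packing_premeasure s (F n)].

Definition packing_dim (A : set V) : \bar R :=
  ereal_inf [set s%:E | s in
    [set s : R | (0 <= s)%R /\ packing_measure s A = 0]].

End Dimensions.

Section Levy.
Variables (disp : measure_display) (T : measurableType disp) (R : realType).
Variables (P : probability T R) (d : nat).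

(* Time is the half-line [0, +oo[: the values X t for t < 0 are junk and never
   constrained. *)
Implicit Type X : R -> T -> 'rV[R]_d.

Definition random_vector (Y : T -> 'rV[R]_d) : Prop :=
  forall B, borel B -> measurable (Y @^-1` B).

Definition independent_increments X : Prop :=
  forall (n : nat) (t : nat -> R) (B : nat -> set 'rV[R]_d),
    0 <= t 0%N -> (forall k, t k <= t k.+1) -> (forall k, borel (B k)) ->
    P (\bigcap_(k in `I_n) [set w | B k (X (t k.+1) w - X (t k) w)])
    = (\prod_(k < n) P [set w | B k (X (t k.+1) w - X (t k) w)%R])%E.

Definition stationary_increments X : Prop :=
  forall (s t : R) (B : set 'rV[R]_d), 0 <= s -> 0 <= t -> borel B ->
    P [set w | B (X (s + t) w - X s w)] = P [set w | B (X t w - X 0 w)].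

Definition continuous_in_probability X : Prop :=
  forall s eps : R, 0 <= s -> 0 < eps ->
    P [set w | eps < euclid_dist (X t w) (X s w)]
      @[t --> within [set t | 0 <= t] (nbhs s)] --> (0 : \bar R).

Definition cadlag (f : R -> 'rV[R]_d) : Prop :=
  (forall t, 0 <= t -> f u @[u --> t^'+] --> f t) /\
  (forall t, 0 < t -> cvg (f u @[u --> t^'-])).

Record levy_process X : Prop := LevyProcess {
  levy_random_vector : forall t, 0 <= t -> random_vector (X t);
  levy_start : {ae P, forall w, X 0 w = 0};
  levy_independent : independent_increments X;
  levy_stationary : stationary_increments X;
  levy_continuous : continuous_in_probability X;
  levy_cadlag : {ae P, forall w, cadlag (X ^~ w)}
}.

(* The product sigma-algebra on paths, generated by the coordinates t >= 0. *)
Definition path_measurable : set (set (R -> 'rV[R]_d)) :=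
  <<s [set C | exists (t : R) (B : set 'rV[R]_d),
        [/\ 0 <= t, borel B & C = [set f | B (f t)]]] >>.

Definition same_law X Y : Prop :=
  forall C, path_measurable C ->
    P [set w | C (X ^~ w)] = P [set w | C (Y ^~ w)].

Definition symmetric_process X : Prop := same_law X (fun t w => - X t w).

Definition cexp (z : R[i]) : R[i] :=
  (expR (complex.Re z) * cos (complex.Im z)
     +i* (expR (complex.Re z) * sin (complex.Im z)))%C.

Definition char_fun (Y : T -> 'rV[R]_d) (xi : 'rV[R]_d) : R[i] :=
  ((\int[P]_w cos (dotv xi (Y w))) +i* (\int[P]_w sin (dotv xi (Y w))))%C.

Definition char_exponent X (psi : 'rV[R]_d -> R[i]) : Prop :=
  forall (xi : 'rV[R]_d) (t : R), 0 <= t ->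
    char_fun (X t) xi = cexp (- (t%:C%C * psi xi)).

End Levy.

Section Conditions.
Variables (R : realType) (d : nat) (psi : 'rV[R]_d -> R) (alpha : R).

Definition lower_growth (K a : R) (xi : 'rV[R]_d) : Prop :=
  K^-1 * euclid_norm xi `^ a <= psi xi.

Definition upper_growth (K b : R) (xi : 'rV[R]_d) : Prop :=
  psi xi <= K * euclid_norm xi `^ b.

Definition growth_outside (K tau a b : R) : Prop :=
  forall xi, tau <= euclid_norm xi -> lower_growth K a xi /\ upper_growth K b xi.

Definition condition_B3 : Prop :=
  (0 < alpha < 2 -> forall zeta, 0 < zeta < 2 - alpha ->
    exists K tau : R, [/\ 1 <= K, 0 < tau &
      growth_outside K tau (alpha - zeta) (alpha + zeta)]) /\
  (alpha = 2 -> forall zeta, 0 < zeta < 2 ->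
    exists K tau : R, [/\ 1 <= K, 0 < tau &
      growth_outside K tau (2 - zeta) 2]).

(* Same constants K, tau, with the lower bound on all of R^d.  The value
   [0 `^ a] is 0 for a != 0, so the bound at xi = 0 has its usual meaning as
   soon as the exponent is positive, in particular if 1 <= alpha. *)
Definition condition_B4 : Prop :=
  (0 < alpha < 2 -> forall zeta, 0 < zeta < 2 - alpha ->
    exists K tau : R, [/\ 1 <= K, 0 < tau,
      growth_outside K tau (alpha - zeta) (alpha + zeta) &
      forall xi, lower_growth K (alpha - zeta) xi]) /\
  (alpha = 2 -> forall zeta, 0 < zeta < 2 ->
    exists K tau : R, [/\ 1 <= K, 0 < tau,
      growth_outside K tau (2 - zeta) 2 &
      forall xi, lower_growth K (2 - zeta) xi]).

End Conditions.

(* Main.v *)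
Require Import Defs.
From mathcomp Require Import all_boot all_order all_algebra.
From mathcomp Require Import all_classical all_reals all_analysis.
From mathcomp Require Import complex.
From mathcomp Require Import measurable_realfun.
From mathcomp Require Import zify ring lra.
Set Implicit Arguments.
Unset Strict Implicit.
Unset Printing Implicit Defensive.
Import Order.TTheory GRing.Theory Num.Theory.
Import numFieldNormedType.Exports.
Local Open Scope classical_set_scope.
Local Open Scope ring_scope.

(* At time scale 2^-n the natural space scale is s = 2^(-n / alpha).  The theorem
   follows from two uniform covering statements for almost every path on [0, N]:
   for every eta > 0 and all large n, (U) the image of every dyadic interval of
   length 2^-n is covered by 2^(eta n) balls of radius 2^(eta n) s, and (L) every
   ball of radius s is visited during at most 2^(eta n) dyadic intervals of
   length 2^-n.  Both transfer covers, hence Hausdorff and packing dimensions,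
   between E and X(E), for all E at once.

   To get (U) and (L) without stopping times, a time t is first replaced by a
   dyadic time of level 3n (below that level no dyadic interval contains two
   large increments), and then rounded up through the levels 3n, ..., n.  Either
   all the increments met are at most s, and X(t) is within O(n s) of the value
   of X at an endpoint of the level n interval, or X(t) is that close to X(t')
   for a dyadic time t' immediately followed by an increment larger than s.  So
   it is enough to count grid times that are followed by a large increment
   and/or lie at mutual distance O(n s).  Increments over disjoint intervals are
   independent, so the generating function of the number of increasing chains of
   such times is bounded as soon as the expected number of successors of a point
   is 2^(o(n)); this expectation is controlled by the characteristic exponent,
   using 1 - cos averages for large increments and a Fejer kernel for the
   occupation of small balls, where alpha <= d is used. *)

(** The level 3n comes from the independence of adjacent increments. An increment over time 2^-m
    exceeds 2^(-c m) with probability about 2^(-(1 - c alpha) m), two adjacent ones with the square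
    of this; over 2^m intervals this is summable in m once c < 1 / (2 alpha). With c = 1 / (3 alpha)
    the threshold at level 3n is exactly s, so all that happens below that level costs O(s). A bound
    on the mean number of visits is too weak: (U) and (L) must hold for about 2^(4n) starting points
    and levels at once, so failures need exponentially small probability. If W bounds the expected
    number of successors, chains of length k weighted by (2W)^-k have total mean at most 2, whereas
    m hits force a weight (1 + 1/(2W))^m; Markov's inequality with m of order W n then beats the
    union bound. Since psi is known only up to powers |xi|^zeta, every estimate loses a factor
    2^(O(zeta) n), which eta absorbs. As alpha - zeta < d, this also covers the critical case alpha
    = d. *)

Section PowersOfTwo.
Variable R : realType.
Implicit Types (x y c e : R) (n : nat).

Lemma pow2_gt0 x : 0 < (2 : R) `^ x.
Proof. exact: powR_gt0. Qed.

Lemma pow2D x y : (2 : R) `^ (x + y) = 2 `^ x * 2 `^ y.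
Proof. by rewrite powRD// pnatr_eq0 implybT. Qed.

Lemma ler_pow2 x y : x <= y -> (2 : R) `^ x <= 2 `^ y.
Proof. by apply: ler_powR; rewrite ler1n. Qed.

Lemma ltr_pow2 x y : x < y -> (2 : R) `^ x < 2 `^ y.
Proof.
by move=> xy; rewrite /powR pnatr_eq0/= ltr_expR ltr_pM2r// ln_gt0// ltr1n.
Qed.

Lemma pow2_nat n : (2 : R) `^ n%:R = (2 ^ n)%:R.
Proof. by rewrite powR_mulrn// natrX. Qed.

Lemma pow2_small c e : 0 < c -> 0 < e ->
  exists n0, forall n, (n0 <= n)%N -> (2 : R) `^ (- (c * n%:R)) <= e.
Proof.
move=> c0 e0; have l2 : 0 < ln (2 : R) by rewrite ln_gt0// ltr1n.
exists (Num.trunc (`|ln e| / (ln 2 * c))).+1 => n hn.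
have cl : 0 < ln 2 * c by rewrite mulr_gt0.
have : `|ln e| / (ln 2 * c) < n%:R.
  apply: lt_le_trans (_ : (Num.trunc (`|ln e| / (ln 2 * c))).+1%:R <= _).
    exact: truncnS_gt.
  by rewrite ler_nat.
rewrite ltr_pdivrMr// => h.
rewrite /powR pnatr_eq0/= -[leRHS](lnK e0) ler_expR.
have := ler_norm (- ln e); rewrite normrN; nra.
Qed.

(** The inequality 1 + x <= exp x at half the exponent gives b n <= 2^(c n / 2); its square is
    quadratic in n and beats C n once n > |C| / b^2. *)
Lemma pow2_linear c (C : R) : 0 < c ->
  exists n0, forall n, (n0 <= n)%N -> C * n%:R <= (2 : R) `^ (c * n%:R).
Proof.
move=> c0; have l2 : 0 < ln (2 : R) by rewrite ln_gt0// ltr1n.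
pose b := c * ln 2 / 2; have b0 : 0 < b by rewrite /b !mulr_gt0.
have b20 : 0 < b ^+ 2 by rewrite exprn_gt0.
exists (Num.trunc (`|C| / b ^+ 2)).+1 => n hn.
have : `|C| / b ^+ 2 < n%:R.
  apply: lt_le_trans (_ : (Num.trunc (`|C| / b ^+ 2)).+1%:R <= _).
    exact: truncnS_gt.
  by rewrite ler_nat.
rewrite ltr_pdivrMr// => h.
have -> : c * n%:R = c * n%:R / 2 + c * n%:R / 2 by field.
rewrite pow2D -expr2.
have n0 : 0 <= n%:R :> R by [].
have hb : b * n%:R <= 2 `^ (c * n%:R / 2).
  rewrite /powR pnatr_eq0/=; apply: le_trans (expR_ge1Dx _).
  by rewrite /b; lra.
have : (b * n%:R) ^+ 2 <= (2 `^ (c * n%:R / 2)) ^+ 2.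
  by rewrite ler_sqr// nnegrE ?powR_ge0// mulr_ge0// ltW.
apply: le_trans; rewrite exprMn.
apply: le_trans (_ : `|C| * n%:R <= _).
  by rewrite ler_wpM2r// ler_norm.
by rewrite (expr2 n%:R) mulrA ler_wpM2r// ltW// mulrC.
Qed.

Lemma pow2_geometric c : 0 < c -> exists2 K : R, 0 < K &
  forall n, \sum_(i < n) 2 `^ (- (c * i%:R)) <= K.
Proof.
move=> c0; pose x : R := 2 `^ (- c).
have x0 : 0 < x by exact: pow2_gt0.
have x1 : x < 1 by rewrite -(powRr0 2) ltr_pow2// oppr_lt0.
exists (1 / (1 - x)); first by rewrite divr_gt0// subr_gt0.
move=> n; apply: le_trans (geometric_le_lim n ler01 x0 _); last by rewrite ger0_norm// ltW.
rewrite /series/= big_mkord ler_sum// => i _; rewrite mul1r -mulNr powRrM powR_mulrn//.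
Qed.

Lemma pow2_summable c : 0 < c -> exists2 K : R, 0 < K &
  (\sum_(0 <= n <oo) (2 `^ (- (c * n%:R)))%:E <= K%:E)%E.
Proof.
move=> /pow2_geometric[K K0 hK]; exists K => //.
apply: lime_le; first by apply: is_cvg_nneseries => n _ _; rewrite lee_fin powR_ge0.
by apply: nearW => n; rewrite /= sumEFin lee_fin big_mkord.
Qed.

End PowersOfTwo.

(** * Transfer of covers and packings *)

(** A bare function [dist] lets time and space exchange roles between the two directions of the
    transfer. *)
Definition metric_axioms (R : realType) (V : Type) (dist : V -> V -> R) :=
  [/\ forall x, dist x x = 0, forall x y, dist x y = dist y x &
      forall x y z, dist x z <= dist x y + dist y z].

Section Covers.
Variables (R : realType) (V : Type) (dist : V -> V -> R).
Implicit Types (s delta k D : R) (A U : set V).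

Lemma diam_ge0 U : (0 <= diam dist U)%E.
Proof. by apply: ereal_sup_ubound; left. Qed.

Lemma diam_le U D : 0 <= D ->
  (diam dist U <= D%:E)%E <-> forall x y, U x -> U y -> dist x y <= D.
Proof.
move=> D0; split=> [h x y Ux Uy|h].
  rewrite -lee_fin; apply: le_trans h; apply: ereal_sup_ubound; right.
  by exists (x, y).
by apply: ge_ereal_sup => _ [->|[[x y] [/= Ux Uy] <-]]; rewrite lee_fin// h.
Qed.

Definition small_cover s delta k A := exists (I : set nat) (U : nat -> set V),
  [/\ A `<=` \bigcup_(i in I) U i,
      forall i, I i -> (diam dist (U i) <= delta%:E)%E &
      (\esum_(i in I) (diam dist (U i) `^ s) <= k%:E)%E].

Lemma hausdorff_measure0P s A : hausdorff_measure dist s A = 0%E <->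
  forall delta k, 0 < delta -> 0 < k -> small_cover s delta k A.
Proof.
split=> [h delta k d0 k0|h].
  have : (hausdorff_premeasure dist s delta A < k%:E)%E.
    apply: le_lt_trans (_ : 0 < _)%E; last by rewrite lte_fin.
    by rewrite -h; apply: ereal_sup_ubound; exists delta.
  move=> /ereal_inf_lt[_ [I [U [AU dU ->]]] /ltW ?]; by exists I, U.
have pre delta : 0 < delta -> (hausdorff_premeasure dist s delta A <= 0)%E.
  move=> d0; apply/lee_addgt0Pr => e e0; rewrite add0e.
  have [I [U [AU dU hU]]] := h _ _ d0 e0.
  by apply: le_trans hU; apply: ereal_inf_lbound; exists I, U.
apply/eqP; rewrite eq_le; apply/andP; split.
  by apply: ge_ereal_sup => _ [delta d0 <-]; exact: pre.
apply: le_trans (_ : hausdorff_premeasure dist s 1 A <= _)%E.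
  apply: le_ereal_inf_tmp => _ [I [U [_ _ ->]]].
  by apply: esum_ge0 => i _; exact: poweR_ge0.
by apply: ereal_sup_ubound; exists 1 => //=.
Qed.

(** Refining each set of a cover yields a family indexed by pairs; [pickle] brings it back to
    indices in [nat]. *)
Lemma small_cover_count (K : countType) (J : set K) (U : K -> set V)
    s delta k A :
  A `<=` \bigcup_(i in J) U i ->
  (forall i, J i -> (diam dist (U i) <= delta%:E)%E) ->
  (\esum_(i in J) (diam dist (U i) `^ s) <= k%:E)%E ->
  small_cover s delta k A.
Proof.
move=> AU dU hU.
exists [set pickle x | x in J], (fun n => oapp U set0 (unpickle n)); split.
- move=> x /AU[i Ji Uix]; exists (pickle i); first by exists i.
  by rewrite pickleK.
- by move=> _ [i Ji <-]; rewrite pickleK; exact: dU.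
- rewrite esum_image; last first.
    by move=> x y _ _ /(congr1 (@unpickle K)); rewrite !pickleK => -[].
  by under eq_esum do rewrite pickleK.
Qed.

Lemma hausdorff_measure_bigcup s (A : nat -> set V) :
  (forall n, hausdorff_measure dist s (A n) = 0%E) ->
  hausdorff_measure dist s (\bigcup_n A n) = 0%E.
Proof.
move=> h; apply/hausdorff_measure0P => delta k d0 k0.
have /choice[I hI] : forall n, exists I : set nat * (nat -> set V),
    [/\ A n `<=` \bigcup_(i in I.1) I.2 i,
      forall i, I.1 i -> (diam dist (I.2 i) <= delta%:E)%E &
      (\esum_(i in I.1) (diam dist (I.2 i) `^ s) <= (k / (2 ^ n.+1)%:R)%:E)%E].
  move=> n; have kn : 0 < k / (2 ^ n.+1)%:R.
    by rewrite divr_gt0// ltr0n expn_gt0.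
  have /hausdorff_measure0P/(_ _ _ d0 kn)[I [U ?]] := h n.
  by exists (I, U).
apply: (@small_cover_count (nat * nat)%type
    ([set: nat] `*`` fun n => (I n).1) (fun p => (I p.1).2 p.2)).
- move=> x [n _ /(let: And3 H _ _ := hI n in H)[i Ii Uix]].
  by exists (n, i).
- by move=> [n i] [/= _ Ii]; have [_ H _] := hI n; exact: H.
- rewrite -(@esum_esum _ _ _ _ (fun n => (I n).1)
    (fun n i => (diam dist ((I n).2 i) `^ s)%E)); last first.
    by move=> *; exact: poweR_ge0.
  apply: le_trans (epsilon_trick0 xpredT (ltW k0)).
  rewrite nneseries_esumT; last first.
    by move=> n; rewrite lee_fin divr_ge0// ltW.
  by apply: le_esum => n _; have [] := hI n.
Qed.

(** Covers by sets of diameter at most 1 are enough, and for them a larger exponent gives smaller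
    terms. *)
Lemma hausdorff_measure0_le s t A : 0 <= s -> s < t ->
  hausdorff_measure dist s A = 0%E -> hausdorff_measure dist t A = 0%E.
Proof.
move=> s0 st /hausdorff_measure0P h; apply/hausdorff_measure0P => delta k d0 k0.
have m0 : 0 < Num.min delta 1 by rewrite lt_min d0 ltr01.
have [I [U [AU dU hU]]] := h _ _ m0 k0.
exists I, U; split => //.
  by move=> i /dU /le_trans; apply; rewrite lee_fin ge_min lexx.
apply: le_trans hU; apply: le_esum => i /dU.
have := diam_ge0 (U i); case: (diam dist (U i)) => [r|//|//].
rewrite !lee_fin le_min => r0 /andP[_ r1].
have [->|rn0] := eqVneq r 0.
  rewrite powR0; first exact: powR_ge0.
  by rewrite gt_eqF// (le_lt_trans s0).
apply: ger_powR; last exact: ltW.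
by rewrite r1 andbT lt_neqAle eq_sym rn0.
Qed.

End Covers.

(* A set of diameter D is replaced by a dyadic scale; the error term takes care
   of singletons. *)
Lemma dyadic_scale (R : realType) (u s D e : R) (n0 : nat) : 0 < u -> 0 < s ->
  0 <= D <= 2 `^ (- (u * n0%:R)) -> 0 < e ->
  exists n, [/\ (n0 <= n)%N, D <= 2 `^ (- (u * n%:R)) &
    2 `^ (- (u * s * n%:R)) <= 2 `^ (u * s) * D `^ s + e].
Proof.
move=> u0 s0 /andP[D0 Dn0] e0; have us : 0 < u * s by rewrite mulr_gt0.
have [D00|Dn] := eqVneq D 0.
  have [n1 h1] := pow2_small us e0.
  exists (maxn n0 n1); rewrite leq_maxl D00 ltW ?pow2_gt0//; split => //.
  apply: le_trans (h1 _ (leq_maxr _ _)) _.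
  by rewrite lerDr mulr_ge0 ?powR_ge0.
have Dp : 0 < D by rewrite lt_neqAle eq_sym Dn.
have ex : exists n, (n0 <= n)%N && (2 `^ (- (u * n.+1%:R)) < D).
  have D20 : 0 < D / 2 by rewrite divr_gt0.
  have [n1 h1] := pow2_small u0 D20.
  exists (maxn n0 n1); rewrite leq_maxl/=.
  apply: le_lt_trans (h1 _ _) _; first by rewrite leqW// leq_maxr.
  by rewrite ltr_pdivrMr// ltr_pMr// ltr1n.
have := ex_minnP ex; case=> n /andP[n0n nD] nmin.
exists n; split => //.
  have [nn0|nn0] := leqP n n0.
    by rewrite (_ : n = n0)//; apply/eqP; rewrite eqn_leq nn0.
  rewrite leNgt; apply/negP => Dlt.
  have := nmin n.-1; rewrite (prednK (leq_ltn_trans (leq0n _) nn0)) Dlt andbT.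
  rewrite -ltnS (prednK (leq_ltn_trans (leq0n _) nn0)) => /(_ nn0).
  by rewrite leqNgt prednK ?leqnn// (leq_ltn_trans (leq0n _) nn0).
have -> : - (u * s * n%:R) = u * s + (- (u * n.+1%:R)) * s.
  by rewrite -addn1 natrD; ring.
rewrite pow2D (powRrM _ (- _) s); apply: ler_wpDr; first exact: ltW.
rewrite ler_wpM2l ?powR_ge0//.
by apply: (ge0_ler_powR (ltW s0)); rewrite ?nnegrE ?powR_ge0 ?(ltW nD).
Qed.

Lemma esum_subset (R : realType) (T : choiceType) (I J : set T)
    (a : T -> \bar R) : I `<=` J -> (\esum_(i in I) a i <= \esum_(i in J) a i)%E.
Proof.
move=> IJ; apply: le_ereal_sup => _ [F [finF FI] <-].
by exists F => //; split => // x /FI /IJ.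
Qed.

Lemma esum_const (R : realType) (k : nat) (a : R) : 0 <= a ->
  (\esum_(i in `I_k) a%:E = (k%:R * a)%:E)%E.
Proof.
move=> a0; rewrite esum_fset; [|exact: finite_II|by move=> i _; rewrite lee_fin].
by rewrite -fsbig_ord sumEFin sumr_const card_ord mulr_natl.
Qed.

Definition covered (R : realType) (V : Type) (dist : V -> V -> R) (B : set V)
    (m D : R) := exists (k : nat) (W : nat -> set V),
  [/\ k%:R <= m, B `<=` \bigcup_(i in `I_k) W i &
      forall i, `I_k i -> (diam dist (W i) <= D%:E)%E].

Definition rel_image (V1 V2 : Type) (r : V1 -> V2 -> Prop) (A : set V1) : set V2 :=
  [set y | exists2 x, A x & r x y].

(** Statement (U) is the instance (u, v) = (1, 1/alpha), statement (L) the instance (1/alpha, 1). A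
    relation replaces the map because (L) runs along the inverse of a path, which is not a function
    in general. *)
Definition scale_transfer (R : realType) (V1 V2 : Type) (dist1 : V1 -> V1 -> R)
    (dist2 : V2 -> V2 -> R) (r : V1 -> V2 -> Prop) (u v : R) :=
  forall eta, 0 < eta -> exists n0, forall n, (n0 <= n)%N -> forall U,
    (diam dist1 U <= (2 `^ (- (u * n%:R)))%:E)%E ->
    covered dist2 (rel_image r U) (2 `^ (eta * n%:R)) (2 `^ ((eta - v) * n%:R)).

Section HausdorffTransfer.
Variables (R : realType) (V1 V2 : Type).
Variables (dist1 : V1 -> V1 -> R) (dist2 : V2 -> V2 -> R).
Variables (r : V1 -> V2 -> Prop) (u v : R).
Hypotheses (u0 : 0 < u) (v0 : 0 < v) (tr : scale_transfer dist1 dist2 r u v).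

Lemma hausdorff_transfer s s' A : 0 < s -> 0 < s' -> u * s < v * s' ->
  hausdorff_measure dist1 s A = 0%E ->
  hausdorff_measure dist2 s' (rel_image r A) = 0%E.
Proof.
move=> s0 s'0 ss' /hausdorff_measure0P h; apply/hausdorff_measure0P => delta k d0 k0.
(* With this choice 2^(eta n) sets of diameter 2^((eta - v) n) contribute at most 2^(- u s n), and
   their diameters still tend to 0. *)
pose eta := Num.min ((v * s' - u * s) / (1 + s')) (v / 2).
have eta0 : 0 < eta by rewrite lt_min !divr_gt0 ?subr_gt0 ?addr_gt0.
have etav : eta <= v / 2 by rewrite ge_min lexx orbT.
have etas : eta * (1 + s') <= v * s' - u * s.
  rewrite -ler_pdivlMr; last by rewrite addr_gt0.
  by rewrite ge_min lexx.
have [n1 h1] := tr eta0.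
have v20 : 0 < v / 2 by rewrite divr_gt0.
have [n2 h2] := pow2_small v20 d0.
pose n0 := maxn n1 n2.
pose c : R := 2 `^ (u * s); have c0 : 0 < c by exact: pow2_gt0.
(* Half of [k] pays for the given cover, inflated by the factor [c] of [dyadic_scale]; the other
   half pays for the error terms, which carry weights 2^-(i+1). *)
have kc : 0 < k / (2 * c) by rewrite divr_gt0// mulr_gt0.
have [I [U [AU dU hU]]] := h _ _ (pow2_gt0 (- (u * n0%:R))) kc.
have /choice[W hW] : forall i, exists W : nat * (nat -> set V2), I i ->
   [/\ rel_image r (U i) `<=` \bigcup_(j in `I_W.1) W.2 j,
       forall j, `I_W.1 j -> (diam dist2 (W.2 j) <= delta%:E)%E &
       (\esum_(j in `I_W.1) (diam dist2 (W.2 j) `^ s') <=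
        c%:E * diam dist1 (U i) `^ s + (k / 2 / (2 ^ i.+1)%:R)%:E)%E].
  move=> i; have [Ii|nI] := pselect (I i); last by exists (0%N, fun=> set0).
  have := dU _ Ii; have := diam_ge0 dist1 (U i).
  case E : (diam dist1 (U i)) => [D|//|//]; rewrite !lee_fin => D0 Dn.
  have e0 : 0 < k / 2 / (2 ^ i.+1)%:R :> R.
    by rewrite !divr_gt0// ltr0n expn_gt0.
  have D0n : 0 <= D <= 2 `^ (- (u * n0%:R)) by rewrite D0.
  have [n [n0n Dn' sn]] := dyadic_scale u0 s0 D0n e0.
  have n1n : (n1 <= n)%N by apply: leq_trans n0n; rewrite leq_maxl.
  have n2n : (n2 <= n)%N by apply: leq_trans n0n; rewrite leq_maxr.
  have [|m [W [mW UW dW]]] := h1 _ n1n (U i); first by rewrite E lee_fin.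
  exists (m, W) => _; split => //= [j jm|].
    apply: le_trans (dW _ jm) _; rewrite lee_fin; apply: le_trans (h2 _ n2n).
    by apply: ler_pow2; rewrite -mulNr ler_wpM2r//; lra.
  apply: (@le_trans _ _ (\esum_(j in `I_m) (2 `^ ((eta - v) * s' * n%:R))%:E)%E).
    apply: le_esum => j /dW; have := diam_ge0 dist2 (W j).
    case: (diam _ _) => [x|//|//]; rewrite !lee_fin => x0 hx.
    rewrite mulrAC powRrM.
    by apply: (ge0_ler_powR (ltW s'0)) => //; rewrite nnegrE ?powR_ge0.
  rewrite esum_const ?powR_ge0//= -EFinM -EFinD lee_fin.
  apply: le_trans sn; apply: le_trans (ler_wpM2r (powR_ge0 _ _) mW) _.
  rewrite -pow2D; apply: ler_pow2; rewrite -mulNr -mulrDl ler_wpM2r//.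
  by move: etas; rewrite mulrDr; lra.
apply: (@small_cover_count _ _ _ (nat * nat)%type
    (I `*`` fun n => `I_(W n).1) (fun p => (W p.1).2 p.2)).
- move=> y [x /AU[i Ii Uix] rxy]; have [H _ _] := hW i Ii.
  have [|j jm Wj] := H y; first by exists x.
  by exists (i, j).
- by move=> [i j] [/= Ii Ij]; have [_ H _] := hW i Ii; exact: H.
- rewrite -(@esum_esum _ _ _ _ (fun n => `I_(W n).1)
    (fun n j => (diam dist2 ((W n).2 j) `^ s')%E)); last first.
    by move=> *; exact: poweR_ge0.
  apply: (@le_trans _ _ (\esum_(i in I)
     (c%:E * diam dist1 (U i) `^ s + (k / 2 / (2 ^ i.+1)%:R)%:E))%E).
    by apply: le_esum => i Ii; have [] := hW i Ii.
  have k20 : 0 < k / 2 by rewrite divr_gt0.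
  rewrite esumD; first last.
  - by move=> i _; rewrite lee_fin divr_ge0// ltW.
  - by move=> i _; rewrite mule_ge0 ?poweR_ge0// lee_fin ltW.
  have kE : k = c * (k / (2 * c)) + k / 2 by field; rewrite gt_eqF.
  rewrite [leRHS](_ : _ = (c * (k / (2 * c)) + k / 2)%:E); last by rewrite -kE.
  rewrite EFinD; apply: leeD.
    rewrite (_ : (\esum_(i in I) (c%:E * diam dist1 (U i) `^ s))%E =
      (c%:E * \esum_(i in I) (diam dist1 (U i) `^ s))%E).
      by rewrite EFinM lee_wpmul2l// lee_fin ltW.
    rewrite /esum -ereal_sup_pZl// image_comp; congr ereal_sup.
    apply: eq_imagel => F [finF _] /=.
    by rewrite ge0_mule_fsumr// => i; exact: poweR_ge0.
  apply: le_trans (esum_subset _ _) _; first exact: (@subsetT _ I).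
  rewrite -nneseries_esumT; last by move=> i; rewrite lee_fin divr_ge0// ltW.
  exact: epsilon_trick0 (ltW k20).
Qed.

End HausdorffTransfer.

(** * Packing measures through covering numbers *)

Section PackingCovers.
Variables (R : realType) (V : Type) (dist : V -> V -> R).
Hypothesis dist_metric : metric_axioms dist.
Implicit Types (s delta D : R) (A F U : set V) (x : V).

(** A form of measure zero in which every piece has premeasure exactly 0, so that countable unions
    need no error terms. *)
Definition packing_null s A := exists F : nat -> set V,
  A `<=` \bigcup_n F n /\ forall n, packing_premeasure dist s (F n) = 0%E.

Lemma packing_sup_ge0 x s delta F : (0 <= packing_sup dist s delta F)%E.
Proof.
apply: ereal_sup_ubound; exists set0, (fun=> x), (fun=> 0).
by split=> //; rewrite esum_set0.
Qed.

Lemma packing_premeasure_ge0 x s F : (0 <= packing_premeasure dist s F)%E.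
Proof.
by apply: le_ereal_inf_tmp => _ [delta _ <-]; exact: packing_sup_ge0.
Qed.

Lemma packing_null_measure0 x s A :
  packing_null s A -> packing_measure dist s A = 0%E.
Proof.
move=> [F [AF F0]]; apply/eqP; rewrite eq_le; apply/andP; split.
  apply: ereal_inf_lbound; exists F; split=> //.
  by rewrite eseries0// => i _ _; exact: F0.
apply: le_ereal_inf_tmp => _ [G [_ ->]].
by apply: nneseries_ge0 => n _ _; exact: packing_premeasure_ge0.
Qed.

Lemma packing_null_bigcup s (A : nat -> set V) :
  (forall n, packing_null s (A n)) -> packing_null s (\bigcup_n A n).
Proof.
move=> /choice[F hF].
exists (fun k => let p := odflt (0, 0)%N (unpickle k) in F p.1 p.2); split.
- move=> y [n _ /(proj1 (hF n))[m _ Fy]].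
  by exists (pickle (n, m)) => //=; rewrite pickleK.
- by move=> k; exact: (proj2 (hF _)).
Qed.

(** Only finiteness on the pieces is kept: raising the exponent later turns a finite premeasure into
    zero. *)
Lemma packing_measure0_pieces x s A : packing_measure dist s A = 0%E ->
  exists F : nat -> set V,
    A `<=` \bigcup_n F n /\ forall n, (packing_premeasure dist s (F n) < +oo)%E.
Proof.
move=> h; have : (packing_measure dist s A < 1)%E by rewrite h lte_fin.
move=> /ereal_inf_lt[_ [F [AF ->]] lt1]; exists F; split=> // n.
apply: le_lt_trans (lt_trans lt1 (ltry 1)).
have := @nneseries_lim_ge R (fun n => packing_premeasure dist s (F n)) xpredT 0 n.+1.
move=> /(_ (fun n _ _ => packing_premeasure_ge0 x s (F n))).
apply: le_trans; rewrite big_mkord (bigD1 ord_max)//= leeDl// sume_ge0// => i _.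
exact: packing_premeasure_ge0.
Qed.

Lemma packing_number s F : (packing_premeasure dist s F < +oo)%E ->
  exists (M delta : R), 0 < delta /\
    forall (rho : R) (k : nat) (c : nat -> V), 0 < rho <= delta ->
      (forall i, `I_k i -> F (c i)) ->
      trivIset `I_k (fun i => [set y | dist (c i) y <= rho]) ->
      k%:R * (2 * rho) `^ s <= M.
Proof.
move=> /ereal_inf_lt[_ [delta /= d0 <-] fin].
exists (fine (packing_sup dist s delta F)), delta; split=> // rho k c rd Fc cc.
have le_sup : ((k%:R * (2 * rho) `^ s)%:E <= packing_sup dist s delta F)%E.
  apply: ereal_sup_ubound; exists `I_k, c, (fun=> rho); split=> //.
    by move=> i Ii; split=> //; exact: Fc.
  by rewrite esum_const// powR_ge0.
rewrite -lee_fin fineK// ge0_fin_numE//.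
by apply: le_trans le_sup; rewrite lee_fin mulr_ge0// powR_ge0.
Qed.

(** A maximal family of disjoint balls of radius rho = eps / 4 exists because [packing_number]
    bounds its size. The ball around any further point of F meets one of them, so the point is
    within eps / 2 of a centre. *)
Lemma packing_premeasure_covered u s F : 0 < u ->
  (packing_premeasure dist s F < +oo)%E ->
  exists (C : R) (n0 : nat), 0 < C /\ forall n, (n0 <= n)%N ->
    covered dist F (C * 2 `^ (s * u * n%:R)) (2 `^ (- (u * n%:R))).
Proof.
move=> u0 /packing_number[M [delta [d0 hM]]].
have [dxx dC dT] := dist_metric.
have [n0 h0] := pow2_small u0 d0.
(* The factor 2^s comes from (2 rho)^s = 2^(-s) eps^s; adding 1 keeps the constant positive. *)
exists (`|M| * 2 `^ s + 1), n0; split.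
  by rewrite ltr_wpDl// mulr_ge0// powR_ge0.
move=> n /h0 nd; set eps : R := 2 `^ (- (u * n%:R)).
have e0 : 0 < eps by exact: pow2_gt0.
pose rho := eps / 4; have rho0 : 0 < rho by rewrite divr_gt0.
have rd : 0 < rho <= delta.
  by rewrite rho0/= /rho; move: nd; rewrite -/eps; lra.
have p0 : 0 < (2 * rho) `^ s by rewrite powR_gt0// mulr_gt0.
pose Q k := `[< exists c : nat -> V, (forall i, `I_k i -> F (c i)) /\
      trivIset `I_k (fun i => [set y | dist (c i) y <= rho]) >].
have kM k : Q k -> k%:R <= M / (2 * rho) `^ s.
  by move=> /asboolP[c [Fc cc]]; rewrite ler_pdivlMr//; exact: hM rd Fc cc.
have [[x0 Fx0]|nF] := pselect (exists x, F x); last first.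
  exists 0%N, (fun=> set0); split=> //.
    by rewrite mulr_ge0 ?powR_ge0// addr_ge0// mulr_ge0// powR_ge0.
  by move=> x Fx; case: nF; exists x.
have Q0 : exists k, Q k by exists 0%N; apply/asboolP; exists (fun=> x0); split.
have ub k : Q k -> (k <= Num.trunc (M / (2 * rho) `^ s))%N.
  move=> /kM kM'; rewrite truncn_ge_nat// (le_trans _ kM')//.
case: (ex_maxnP Q0 ub) => k Qk kmax.
have /asboolP[c [Fc cc]] := Qk.
(* Phrased as an intersection of balls, so that its failure is exactly the disjointness that would
   enlarge the packing. *)
pose near x y := exists z, dist x z <= rho /\ dist y z <= rho.
have near_dist x y : near x y -> dist x y <= eps / 2.
  by move=> [z [xz]]; rewrite dC => zy; have := dT x z y; rewrite /rho in xz zy *; lra.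
exists k, (fun i => [set y | near (c i) y]); split.
- apply: le_trans (kM _ Qk) _.
  have -> : (2 * rho) `^ s = (2 `^ s)^-1 * (2 `^ (s * u * n%:R))^-1.
    rewrite -!powRN -pow2D (_ : 2 * rho = 2 `^ (-1 - u * n%:R)).
      by rewrite -powRrM; congr (_ `^ _); ring.
    rewrite pow2D powR_inv1// /rho; change (2 `^ (- (u * n%:R))) with eps.
    by field.
  rewrite invfM !invrK mulrA ler_wpM2r ?powR_ge0//.
  by apply: ler_wpDr => //; rewrite ler_wpM2r ?powR_ge0// ler_norm.
- move=> y Fy; apply: contrapT => ny.
  suff : Q k.+1 by move=> /kmax; rewrite ltnn.
  pose c' i := if (i < k)%N then c i else y.
  apply/asboolP; exists c'; split=> [i _|].
    by rewrite /c'; case: ifP => // ik; exact: Fc.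
  have far i z : (i < k)%N -> dist (c i) z <= rho -> dist y z <= rho -> False.
    by move=> ik iz yz; apply: ny; exists i => //; exists z.
  move=> i j; rewrite /mkset !ltnS /c' => ik jk [z /=[]].
  case: ltnP => ik'; case: ltnP => jk' zi zj.
  - by apply: cc => //; exists z.
  - by case: (far i z).
  - by case: (far j z).
  - by apply/eqP; rewrite eqn_leq (leq_trans ik jk') (leq_trans jk ik').
- move=> i _; apply/diam_le; first exact: ltW.
  move=> x y /near_dist cx /near_dist cy.
  by have := dT x (c i) y; rewrite (dC x (c i)); lra.
Qed.

(** The balls of a packing are sorted by radius into the classes ]2^(-v (n+1)), 2^(-v n)]. Two
    centres of one class cannot share a set of the cover at scale n+1, since each would lie in the
    ball of the other. So a class has at most C 2^(s v (n+1)) balls, and the sum is geometric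
    because s < s'. *)
Lemma covered_packing_premeasure0 x v s s' (C : R) n0 F :
  0 < v -> 0 < C -> 0 <= s' -> s < s' ->
  (forall n, (n0 <= n)%N ->
    covered dist F (C * 2 `^ (s * v * n%:R)) (2 `^ (- (v * n%:R)))) ->
  packing_premeasure dist s' F = 0%E.
Proof.
move=> v0 C0 s'0 ss' cov; have [dxx dC dT] := dist_metric.
apply/eqP; rewrite eq_le packing_premeasure_ge0// andbT.
apply/lee_addgt0Pr => e e0; rewrite add0e.
(* [w] is the geometric rate: one half makes the series over n converge, the other half supplies the
   small factor e / (C' K). *)
pose w := v * (s' - s); have w0 : 0 < w by rewrite mulr_gt0// subr_gt0.
have w20 : 0 < w / 2 by rewrite divr_gt0.
have [K K0 hK] := pow2_summable w20.
pose C' : R := C * 2 `^ (s * v) * 2 `^ s'.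
have C'0 : 0 < C' by rewrite /C' !mulr_gt0 ?pow2_gt0.
have eC : 0 < e / (C' * K) by rewrite divr_gt0// mulr_gt0.
have [n1 h1] := pow2_small w20 eC.
pose n2 := maxn n0 n1.
apply: (@le_trans _ _ (packing_sup dist s' (2 `^ (- (v * n2%:R))) F)).
  by apply: ereal_inf_lbound; exists (2 `^ (- (v * n2%:R))) => //=; exact: pow2_gt0.
apply: ge_ereal_sup => _ [I [c [r [hI tI ->]]]].
have /choice[nn hnn] : forall i, exists n, I i ->
    [/\ (n2 <= n)%N, r i <= 2 `^ (- (v * n%:R)) & 2 `^ (- (v * n.+1%:R)) < r i].
  move=> i; have [Ii|nI] := pselect (I i); last by exists 0%N.
  have [_ /andP[r0 rn]] := hI _ Ii.
  have ex : exists n, (n2 <= n)%N && (2 `^ (- (v * n.+1%:R)) < r i).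
    have r20 : 0 < r i / 2 by rewrite divr_gt0.
    have [n3 h3] := pow2_small v0 r20.
    exists (maxn n2 n3); rewrite leq_maxl/=.
    apply: le_lt_trans (h3 _ _) _; first by rewrite leqW// leq_maxr.
    by rewrite ltr_pdivrMr// ltr_pMr// ltr1n.
  case: (ex_minnP ex) => n /andP[n2n rn'] nmin; exists n => _; split=> //.
  have [nn2|nn2] := leqP n n2.
    by rewrite (_ : n = n2)//; apply/eqP; rewrite eqn_leq nn2.
  rewrite leNgt; apply/negP => rlt.
  have nK : n.-1.+1 = n by rewrite prednK// (leq_ltn_trans (leq0n _) nn2).
  have := nmin n.-1; rewrite nK rlt andbT -ltnS nK => /(_ nn2).
  by rewrite leqNgt -{2}nK leqnn.
pose J n := [set i | I i /\ nn i = n].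
have IJ : I `<=` \bigcup_(n in setT) J n by move=> i Ii; exists (nn i).
apply: le_trans (esum_subset _ IJ) _.
rewrite esum_bigcupT; first last.
- by move=> i; rewrite lee_fin powR_ge0.
- by move=> i j _ _ [k [[_ <-] [_ <-]]].
apply: (@le_trans _ _ (\esum_(n in [set: nat])
    (e / K * 2 `^ (- (w / 2 * n%:R)))%:E)%E); last first.
  rewrite -nneseries_esumT; last first.
    by move=> n; rewrite lee_fin mulr_ge0 ?powR_ge0// ltW// divr_gt0.
  under eq_eseriesr do rewrite EFinM.
  rewrite nneseriesZl; last by move=> n _; rewrite lee_fin powR_ge0.
  apply: (@le_trans _ _ ((e / K)%:E * K%:E)%E).
    by apply: lee_wpmul2l => //; rewrite lee_fin ltW// divr_gt0.
  by rewrite -EFinM lee_fin divfK// gt_eqF.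
apply: le_esum => n _.
have [n2n|nn2] := leqP n2 n; last first.
  rewrite (_ : J n = set0) ?esum_set0.
    by rewrite lee_fin mulr_ge0 ?powR_ge0// ltW// divr_gt0.
  rewrite -subset0 => i [Ii nni]; have [+ _ _] := hnn _ Ii.
  by rewrite nni leqNgt nn2.
have n0n : (n0 <= n.+1)%N by rewrite leqW// (leq_trans _ n2n)// leq_maxl.
have n1n : (n1 <= n)%N by rewrite (leq_trans _ n2n)// leq_maxr.
have [k [W [km FW dW]]] := cov _ n0n.
have /choice[g hg] : forall i, exists j, J n i -> `I_k j /\ W j (c i).
  move=> i; have [Ji|nJ] := pselect (J n i); last by exists 0%N.
  have [Ii _] := Ji; have [Fc _] := hI _ Ii.
  by have [j jk Wj] := FW _ Fc; exists j.
have gi : set_inj (J n) g.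
  move=> i j; rewrite !inE => Ji Jj gij; have [[Ii nni] [Ij nnj]] := (Ji, Jj).
  have [gik Wi] := hg _ Ji; have [_ Wj] := hg _ Jj; rewrite -gij in Wj.
  apply: (tI i j Ii Ij); exists (c j) => /=; split; last first.
    by rewrite dxx ltW//; have [_ /andP[]] := hI _ Ij.
  have [_ _] := hnn _ Ii; rewrite nni => /ltW; apply: le_trans.
  by have /diam_le := dW _ gik; apply => //; exact: pow2_gt0.
apply: (@le_trans _ _ (\esum_(i in J n) (2 `^ s' * 2 `^ (- (v * s' * n%:R)))%:E)%E).
  apply: le_esum => i [Ii nni]; rewrite lee_fin.
  have [_ rn _] := hnn _ Ii; rewrite nni in rn.
  have [_ /andP[r0 _]] := hI _ Ii.
  rewrite powRM ?(ltW r0)// ler_wpM2l ?powR_ge0//.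
  rewrite (_ : - (v * s' * n%:R) = - (v * n%:R) * s'); last by ring.
  by rewrite powRrM; apply: (ge0_ler_powR s'0) => //; rewrite nnegrE ?powR_ge0// ltW.
rewrite -(esum_image _ _ (fun=> (2 `^ s' * 2 `^ (- (v * s' * n%:R)))%:E) gi).
apply: (@le_trans _ _ (\esum_(j in `I_k) (2 `^ s' * 2 `^ (- (v * s' * n%:R)))%:E)%E).
  by apply: esum_subset => _ [i Ji <-]; have [] := hg _ Ji.
rewrite esum_const ?mulr_ge0 ?powR_ge0// lee_fin.
apply: le_trans (ler_wpM2r _ km) _; first by rewrite mulr_ge0 ?powR_ge0.
apply: (@le_trans _ _ (C' * 2 `^ (- (w / 2 * n%:R)) * 2 `^ (- (w / 2 * n%:R)))).
  rewrite le_eqVlt; apply/orP; left; apply/eqP.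
  rewrite (_ : s * v * n.+1%:R = s * v * n%:R + s * v); last by rewrite -natr1; ring.
  have wE : s * v * n%:R - v * s' * n%:R = - (w / 2 * n%:R) - (w / 2 * n%:R).
    by rewrite /w; field.
  by rewrite -(mulrA C') -!pow2D -wE /C' !pow2D; ring.
rewrite ler_wpM2r ?powR_ge0//.
rewrite -ler_pdivlMl//; apply: le_trans (h1 _ n1n) _.
rewrite le_eqVlt; apply/orP; left; apply/eqP; field.
by rewrite !gt_eqF.
Qed.

End PackingCovers.

Section PackingTransfer.
Variables (R : realType) (V1 V2 : Type).
Variables (dist1 : V1 -> V1 -> R) (dist2 : V2 -> V2 -> R).
Variables (r : V1 -> V2 -> Prop) (u v : R).
Hypotheses (m1 : metric_axioms dist1) (m2 : metric_axioms dist2).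
Hypotheses (u0 : 0 < u) (v0 : 0 < v) (tr : scale_transfer dist1 dist2 r u v).

Lemma packing_transfer (x1 : V1) (x2 : V2) s s' A : 0 <= s -> 0 < s' ->
  u * s < v * s' ->
  packing_measure dist1 s A = 0%E -> packing_null dist2 s' (rel_image r A).
Proof.
move=> s0 s'0 ss' /(packing_measure0_pieces x1)[F [AF Ffin]].
exists (fun n => rel_image r (F n)); split=> [y [x /AF[n _ Fx] rxy]|n].
  by exists n => //; exists x.
have [C [n0 [C0 hC]]] := packing_premeasure_covered m1 u0 (Ffin n).
(* Each of the C 2^(s u m) sets splits into 2^(eta m) sets of diameter 2^(-(v - eta) m), so the
   image has box exponent (s u + eta) / (v - eta). The factor 2 puts this strictly below s'. *)
pose eta := Num.min ((v * s' - u * s) / (2 * (1 + s'))) (v / 2).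
have eta0 : 0 < eta.
  by rewrite lt_min !divr_gt0 ?subr_gt0 ?mulr_gt0 ?addr_gt0.
have etav : eta <= v / 2 by rewrite ge_min lexx orbT.
have etas : eta * (2 * (1 + s')) <= v * s' - u * s.
  rewrite -ler_pdivlMr; last by rewrite mulr_gt0 ?addr_gt0.
  by rewrite ge_min lexx.
have [n1 h1] := tr eta0.
pose w := v - eta; have w0 : 0 < w by rewrite /w; lra.
apply: (@covered_packing_premeasure0 _ _ _ m2 x2 w ((s * u + eta) / w) s' C
  (maxn n0 n1)) => //; first exact: ltW.
  rewrite ltr_pdivrMr//; apply: lt_le_trans (_ : u * s + eta * (1 + s') <= _).
    by have := mulr_gt0 eta0 s'0; rewrite mulrDr mulr1 (mulrC s); lra.
  rewrite /w; move: etas; have := mulr_gt0 eta0 s'0.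
  by rewrite !(mulrDr, mulrDl, mulr1, mulrBr, mulrBl, mulrN, mulNr); lra.
move=> m; rewrite geq_max => /andP[/hC [k [W [kC FW dW]]] n1m].
have /choice[Z hZ] : forall i, exists Z : nat * (nat -> set V2), `I_k i ->
    [/\ Z.1%:R <= 2 `^ (eta * m%:R),
        rel_image r (W i) `<=` \bigcup_(j in `I_Z.1) Z.2 j &
        forall j, `I_Z.1 j -> (diam dist2 (Z.2 j) <= (2 `^ ((eta - v) * m%:R))%:E)%E].
  move=> i; have [ik|nik] := pselect (`I_k i); last by exists (0%N, fun=> set0).
  by have [K [Z ?]] := h1 _ n1m _ (dW _ ik); exists (K, Z).
(* The pieces Z i j are enumerated by q = i * K + j. *)
pose K := Num.trunc (2 `^ (eta * m%:R) : R).
have ZK i : `I_k i -> ((Z i).1 <= K)%N.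
  by move=> /hZ[h _ _]; rewrite truncn_ge_nat// powR_ge0.
exists (k * K)%N, (fun q => if (q %% K < (Z (q %/ K)%N).1)%N
                           then (Z (q %/ K)%N).2 (q %% K)%N else set0); split.
- have KE : K%:R <= (2 : R) `^ (eta * m%:R) by rewrite truncn_le powR_ge0.
  rewrite natrM; apply: le_trans (ler_pM (ler0n _ k) (ler0n _ K) kC KE) _.
  rewrite -(mulrA C) -pow2D; apply: ler_wpM2l; first exact: ltW.
  by apply: ler_pow2; rewrite divfK ?gt_eqF// mulrDl.
- move=> y [x /FW[i ik Wx] rxy]; have [_ H _] := hZ _ ik.
  have [|j jZ Zy] := H y; first by exists x.
  have jK : (j < K)%N := leq_trans jZ (ZK _ ik).
  have K0 : (0 < K)%N := leq_ltn_trans (leq0n _) jK.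
  exists (i * K + j)%N.
    by rewrite /= (@leq_trans (i.+1 * K)%N)// ?leq_mul2r ?ik ?orbT// mulSn addnC ltn_add2r.
  by rewrite divnMDl// divn_small// addn0 modnMDl modn_small// jZ.
- move=> q /= qk.
  have K0 : (0 < K)%N by case: (K) qk => //; rewrite muln0.
  have ik : (q %/ K < k)%N by rewrite ltn_divLR.
  case: ifPn => [jZ|_].
    have [_ _ H] := hZ _ ik; apply: le_trans (H _ jZ) _.
    by rewrite lee_fin; apply: ler_pow2; rewrite /w -mulNr opprB.
  by apply/diam_le => //; exact: powR_ge0.
Qed.

End PackingTransfer.

Section DimensionTransfer.
Variables (R : realType) (V1 V2 : Type).
Variables (dist1 : V1 -> V1 -> R) (dist2 : V2 -> V2 -> R).
Variables (r : nat -> V1 -> V2 -> Prop) (u v : R).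
Hypotheses (m1 : metric_axioms dist1) (m2 : metric_axioms dist2).
Hypotheses (u0 : 0 < u) (v0 : 0 < v).
Hypothesis tr : forall N, scale_transfer dist1 dist2 (r N) u v.
Variables (A : set V1) (B : set V2).
Hypothesis BA : B = \bigcup_N rel_image (r N) A.

Lemma hausdorff_dim_transfer :
  (hausdorff_dim dist2 B <= (u / v)%:E * hausdorff_dim dist1 A)%E.
Proof.
have c0 : 0 < u / v by rewrite divr_gt0.
rewrite -lee_pdivrMl//; apply: le_ereal_inf_tmp => _ [s [s0 hs] <-].
rewrite lee_pdivrMl// -EFinM; apply/lee_addgt0Pr => e e0.
have t0 : 0 < u / v * s + e by rewrite ltr_wpDl// mulr_ge0// ltW.
apply: ereal_inf_lbound; exists (u / v * s + e) => //; split; first exact: ltW.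
(* [s] may be 0 while [hausdorff_transfer] wants a positive exponent; raising it by v e / (2 u)
   spends half of the margin [e]. *)
have d0 : 0 < v * e / (2 * u) by rewrite divr_gt0 ?mulr_gt0.
rewrite BA; apply: hausdorff_measure_bigcup => N.
apply: (hausdorff_transfer u0 v0 (tr N)
  (s := s + v * e / (2 * u))) => //.
- exact: ltr_wpDl.
- rewrite (_ : u * _ = u * s + v * e / 2); last by field; rewrite gt_eqF.
  rewrite (_ : v * (u / v * s + e) = u * s + v * e); last by field; rewrite gt_eqF.
  by have := mulr_gt0 v0 e0; lra.
- by apply: hausdorff_measure0_le hs => //; rewrite ltrDl.
Qed.

Lemma packing_dim_transfer (x1 : V1) (x2 : V2) :
  (packing_dim dist2 B <= (u / v)%:E * packing_dim dist1 A)%E.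
Proof.
have c0 : 0 < u / v by rewrite divr_gt0.
rewrite -lee_pdivrMl//; apply: le_ereal_inf_tmp => _ [s [s0 hs] <-].
rewrite lee_pdivrMl// -EFinM; apply/lee_addgt0Pr => e e0.
have t0 : 0 < u / v * s + e by rewrite ltr_wpDl// mulr_ge0// ltW.
apply: ereal_inf_lbound; exists (u / v * s + e) => //; split; first exact: ltW.
apply: (packing_null_measure0 x2); rewrite BA.
apply: packing_null_bigcup => N.
apply: (packing_transfer m1 m2 u0 v0 (tr N) x1 x2 s0 t0) hs.
rewrite (_ : v * (u / v * s + e) = u * s + v * e); last by field; rewrite gt_eqF.
by rewrite ltrDl mulr_gt0.
Qed.

End DimensionTransfer.

(** * Paths on dyadic grids *)

Section Dyadic.
Variable R : realType.
Implicit Types (m n j k : nat) (t : R).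

Definition dyadic m j : R := j%:R / (2 ^ m)%:R.

Lemma expn2_gt0 m : 0 < (2 ^ m)%:R :> R.
Proof. by rewrite ltr0n expn_gt0. Qed.

Lemma dyadicS m j : dyadic m.+1 j.*2 = dyadic m j.
Proof.
rewrite /dyadic expnS -mul2n !natrM -mulf_div divff ?mul1r//.
Qed.

Lemma dyadic_addn m l j : dyadic (m + l) (j * 2 ^ l) = dyadic m j.
Proof.
have := expn2_gt0 m; have := expn2_gt0 l => /lt0r_neq0 l0 /lt0r_neq0 m0.
by rewrite /dyadic expnD !natrM; field; rewrite l0 m0.
Qed.

Lemma ler_dyadic m j k : (dyadic m j <= dyadic m k) = (j <= k)%N.
Proof. by rewrite ler_pM2r ?invr_gt0 ?expn2_gt0// ler_nat. Qed.

Lemma ltr_dyadic m j k : (dyadic m j < dyadic m k) = (j < k)%N.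
Proof. by rewrite ltr_pM2r ?invr_gt0 ?expn2_gt0// ltr_nat. Qed.

Lemma dyadic_ge0 m j : 0 <= dyadic m j.
Proof. by rewrite divr_ge0. Qed.

Lemma dyadic_step m j : dyadic m j.+1 = dyadic m j + 2 `^ (- m%:R).
Proof. by rewrite /dyadic -natr1 mulrDl mul1r powRN pow2_nat. Qed.

Definition dyadic_floor m t := Num.trunc (t * (2 ^ m)%:R).

Lemma dyadic_floorP m t : 0 <= t ->
  dyadic m (dyadic_floor m t) <= t < dyadic m (dyadic_floor m t).+1.
Proof.
move=> t0; rewrite /dyadic ler_pdivrMr ?expn2_gt0// ltr_pdivlMr ?expn2_gt0//.
by apply: truncn_itv; rewrite mulr_ge0.
Qed.

End Dyadic.

Section Path.
Variables (R : realType) (V : Type) (dist : V -> V -> R).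
Hypothesis dist_metric : metric_axioms dist.
Variables (g : R -> V) (N : nat).
Implicit Types (m n i j k l L : nat) (t s S : R).

Let dxx x : dist x x = 0. Proof. by have [h _ _] := dist_metric; exact: h. Qed.
Let dC x y : dist x y = dist y x. Proof. by have [_ h _] := dist_metric; exact: h. Qed.
Let dT y x z : dist x z <= dist x y + dist y z.
Proof. by have [_ _ h] := dist_metric; exact: h. Qed.

Definition right_continuous_path := forall t e, 0 <= t -> 0 < e ->
  exists2 delta, 0 < delta & forall s, t < s < t + delta -> dist (g t) (g s) <= e.

Definition at_dyadic m j := g (dyadic R m j).

(* A single jump cannot be excluded uniformly in time, but two large adjacent
   increments at the same dyadic level can. *)
Definition one_jump (theta : nat -> R) m := forall k, (k < N * 2 ^ m)%N ->
  dist (at_dyadic m.+1 k.*2) (at_dyadic m.+1 k.*2.+1) <= theta m \/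
  dist (at_dyadic m.+1 k.*2.+1) (at_dyadic m.+1 k.*2.+2) <= theta m.

Lemma at_dyadicS m j : at_dyadic m.+1 j.*2 = at_dyadic m j.
Proof. by rewrite /at_dyadic dyadicS. Qed.

(** An odd point of a level lies between two points of the coarser level and is close to at least
    one of them. Which one depends on where the jump sits, hence the disjunction on the
    endpoints. *)
Lemma one_jump_chain theta M k L i : (forall m, 0 <= theta m) ->
  (forall m, (M <= m)%N -> one_jump theta m) -> (k < N * 2 ^ M)%N ->
  (k * 2 ^ L <= i <= k.+1 * 2 ^ L)%N ->
  dist (at_dyadic (M + L) i) (at_dyadic M k) <= \sum_(l < L) theta (M + l)%N \/
  dist (at_dyadic (M + L) i) (at_dyadic M k.+1) <= \sum_(l < L) theta (M + l)%N.
Proof.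
move=> th0 hj kN; elim: L i => [|L IH] i.
  rewrite !muln1 addn0 big_ord0 => /andP[ki ik].
  have [->|->] : i = k \/ i = k.+1 by lia.
    by left; rewrite dxx.
  by right; rewrite dxx.
rewrite big_ord_recr/= addnS => /andP[ki ik].
pose h := i./2; have iE := odd_double_half i; rewrite -/h in iE.
move: ki ik; rewrite expnS !(mulnCA _ 2%N) => ki ik.
have {}iE : (odd i + h * 2 = i)%N by rewrite muln2.
have kh : (k * 2 ^ L <= h)%N by lia.
have hk : (h <= k.+1 * 2 ^ L)%N by lia.
(* An odd [i] is not the right endpoint, so [h.+1] still lies in the interval. *)
have hk1 : odd i -> (h < k.+1 * 2 ^ L)%N by lia.
rewrite muln2 in iE.
case: (odd i) iE hk1 => iE hk1.
- have {}hk1 := hk1 isT.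
  have hN : (h < N * 2 ^ (M + L))%N.
    rewrite expnD mulnA; apply: (@leq_trans (k.+1 * 2 ^ L)); first exact: hk1.
    by rewrite leq_mul2r kN orbT.
  have [d|d] := hj (M + L)%N (leq_addr _ _) _ hN.
    have [||c] := IH h; first by apply/andP; split; lia.
      move=> c; left; apply: le_trans (dT (at_dyadic (M + L) h) _ _) _.
      by rewrite addrC lerD// -(at_dyadicS (M + L) h) -iE add1n dC.
    right; apply: le_trans (dT (at_dyadic (M + L) h) _ _) _.
    by rewrite addrC lerD// -(at_dyadicS (M + L) h) -iE add1n dC.
  have [||c] := IH h.+1; first by apply/andP; split; lia.
    move=> c; left; apply: le_trans (dT (at_dyadic (M + L) h.+1) _ _) _.
    by rewrite addrC lerD// -(at_dyadicS (M + L) h.+1) -iE add1n doubleS.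
  right; apply: le_trans (dT (at_dyadic (M + L) h.+1) _ _) _.
  by rewrite addrC lerD// -(at_dyadicS (M + L) h.+1) -iE add1n doubleS.
- clear hk1; rewrite -iE add0n at_dyadicS.
  have [||c] := IH h; first by apply/andP; split; lia.
    by move=> c; left; apply: le_trans c _; rewrite lerDl.
  by right; apply: le_trans c _; rewrite lerDl.
Qed.

Lemma one_jump_interval theta M k S t e : right_continuous_path ->
  (forall m, 0 <= theta m) -> 0 < e ->
  (forall m, (M <= m)%N -> one_jump theta m) -> (k < N * 2 ^ M)%N ->
  (forall L, \sum_(l < L) theta (M + l)%N <= S) ->
  dyadic R M k <= t < dyadic R M k.+1 ->
  dist (g t) (at_dyadic M k) <= S + e \/ dist (g t) (at_dyadic M k.+1) <= S + e.
Proof.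
move=> rc th0 e0 hj kN hS /andP[kt tk].
have t0 : 0 <= t := le_trans (dyadic_ge0 _ _ _) kt.
have [delta d0 hd] := rc _ _ t0 e0.
have d20 : 0 < delta / 2 by rewrite divr_gt0.
have [L hL] := pow2_small (ltr01 : 0 < 1 :> R) d20.
(* The grid point strictly to the right of [t], where right continuity applies; it may be the right
   endpoint of the interval, which [one_jump_chain] allows. *)
pose i := (dyadic_floor (M + L) t).+1.
have /andP[it ti] := dyadic_floorP (M + L) t0; rewrite -/i in ti.
have ki : (k * 2 ^ L <= i <= k.+1 * 2 ^ L)%N.
  rewrite -!(ler_dyadic R (M + L)) !dyadic_addn (ltW (le_lt_trans kt ti))/=.
  rewrite -(dyadic_addn R M L k.+1) ler_dyadic -(ltr_dyadic R (M + L)) dyadic_addn.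
  exact: le_lt_trans tk.
have near : dist (g t) (at_dyadic (M + L) i) <= e.
  apply: hd; rewrite ti/= /i dyadic_step.
  have := hL (M + L)%N (leq_addl _ _); rewrite mul1r.
  by move: it d0; lra.
have [c|c] := one_jump_chain th0 hj kN ki.
- left; apply: le_trans (dT (at_dyadic (M + L) i) _ _) _.
  by rewrite addrC lerD//; exact: le_trans c (hS _).
- right; apply: le_trans (dT (at_dyadic (M + L) i) _ _) _.
  by rewrite addrC lerD//; exact: le_trans c (hS _).
Qed.

Definition jump s m j := s < dist (at_dyadic m j) (at_dyadic m j.+1).

(* Rounding a dyadic time up, one level at a time, moves the path by at most s
   per level until a jump is met. *)
Lemma ascending_chain s n l i k : 0 <= s -> (k * 2 ^ l <= i <= k.+1 * 2 ^ l)%N ->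
  [\/ dist (at_dyadic (n + l) i) (at_dyadic n k) <= l%:R * s,
      dist (at_dyadic (n + l) i) (at_dyadic n k.+1) <= l%:R * s |
      exists l' j, [/\ (0 < l' <= l)%N, (k * 2 ^ l' <= j < k.+1 * 2 ^ l')%N,
        jump s (n + l') j &
        dist (at_dyadic (n + l) i) (at_dyadic (n + l') j) <= l%:R * s]].
Proof.
move=> s0; elim: l i => [|l IH] i.
  rewrite !muln1 addn0 mul0r => /andP[ki ik].
  have [->|->] : i = k \/ i = k.+1 by lia.
    by apply: Or31; rewrite dxx.
  by apply: Or32; rewrite dxx.
(* Rounding up, not down: the increment that is tested starts at [i], so a jump is an event about
   the future of [i], as the chains of hits require. *)
move=> /andP[ki ik]; pose h := uphalf i.
have hr : (k * 2 ^ l <= h <= k.+1 * 2 ^ l)%N.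
  have := odd_double_half i; have : h = (odd i + i./2)%N by exact: uphalf_half.
  by move: ki ik; rewrite expnS !(mulnCA _ 2%N); case: (odd i) => /=; lia.
have [oi|ei] := boolP (odd i); last first.
  have -> : at_dyadic (n + l.+1) i = at_dyadic (n + l) h.
    rewrite addnS -(at_dyadicS (n + l) h); congr at_dyadic.
    by rewrite /h uphalf_half (negbTE ei) add0n -[LHS]odd_double_half (negbTE ei).
  have sl : l%:R * s <= l.+1%:R * s by rewrite ler_wpM2r// ler_nat.
  have [c|c|[l' [j [/andP[l0 l'l] kj bj c]]]] := IH h hr.
  - by apply: Or31; exact: le_trans c sl.
  - by apply: Or32; exact: le_trans c sl.
  - apply: Or33; exists l', j; split => //; first by rewrite l0 leqW.
    exact: le_trans c sl.
have [bi|nbi] := ltP s (dist (at_dyadic (n + l.+1) i) (at_dyadic (n + l.+1) i.+1)).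
  apply: Or33; exists l.+1, i; split; [by rewrite leqnn| |by []|by rewrite dxx mulr_ge0].
  rewrite ki ltn_neqAle ik andbT; apply: contraTneq oi => ->.
  by rewrite oddM oddX/= andbF.
have E : at_dyadic (n + l.+1) i.+1 = at_dyadic (n + l) h.
  rewrite addnS -(at_dyadicS (n + l) h); congr at_dyadic.
  by have := odd_double_half i; rewrite /h uphalf_half oi /= -!muln2; lia.
have sl c : dist (at_dyadic (n + l) h) c <= l%:R * s ->
    dist (at_dyadic (n + l.+1) i) c <= l.+1%:R * s.
  move=> hc; apply: le_trans (dT (at_dyadic (n + l.+1) i.+1) _ _) _.
  by rewrite -natr1 mulrDl mul1r addrC lerD// E.
have [c|c|[l' [j [/andP[l0 l'l] kj bj c]]]] := IH h hr.
- by apply: Or31; exact: sl.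
- by apply: Or32; exact: sl.
- by apply: Or33; exists l', j; split => //; [rewrite l0 leqW|exact: sl].
Qed.

End Path.

(** * From counts of grid times to covers *)

Section Counts.
Variables (R : realType) (V : Type) (dist : V -> V -> R).
Hypothesis dist_metric : metric_axioms dist.
Variables (g : R -> V) (N : nat) (alpha : R).
Hypothesis alpha0 : 0 < alpha.
Implicit Types (m n i j k l : nat) (t s S : R).

Let dxx x : dist x x = 0. Proof. by have [h _ _] := dist_metric; exact: h. Qed.
Let dC x y : dist x y = dist y x. Proof. by have [_ h _] := dist_metric; exact: h. Qed.
Let dT y x z : dist x z <= dist x y + dist y z.
Proof. by have [_ _ h] := dist_metric; exact: h. Qed.

Local Notation at_dyadic := (at_dyadic g).
Local Notation jump := (jump dist g).

Definition jumps s n l k := [seq j <- iota (k * 2 ^ l) (2 ^ l) | jump s (n + l) j].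

(** These are the three outcomes of [ascending_chain] between the levels n and 3n: an endpoint of
    the interval, or a jump at one of the 2n finer levels. *)
Definition centers s n k : seq (nat * nat) :=
  (n, k) :: (n, k.+1) ::
  [seq ((n + l)%N, j) | l <- iota 1 (2 * n), j <- jumps s n l k].

Lemma size_centers s n k (B : R) :
  (forall l, (0 < l <= 2 * n)%N -> (size (jumps s n l k))%:R <= B) ->
  (size (centers s n k))%:R <= 2 + (2 * n)%:R * B.
Proof.
move=> hB; rewrite /= -addn2 natrD addrC lerD2l size_allpairs_dep.
have : {subset iota 1 (2 * n) <= [pred l | (0 < l <= 2 * n)%N]}.
  by move=> l; rewrite mem_iota add1n ltnS.
rewrite -[X in X%:R * B](size_iota 1); elim: (iota _ _) => [|l ls IH] sub.
  by rewrite mul0r.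
rewrite /= natrD -natr1 mulrDl mul1r addrC lerD//.
  by apply: IH => j jl; apply: sub; rewrite inE jl orbT.
by apply: hB; apply: sub; rewrite inE eqxx.
Qed.

(** Moving [t] to an endpoint of its level 3n interval costs S + e, and climbing 2n levels from
    there costs at most s per level. *)
Lemma centers_near theta s S e n k t : right_continuous_path dist g ->
  (forall m, 0 <= theta m) -> 0 < e -> 0 <= s -> 0 <= S ->
  (forall m, (3 * n <= m)%N -> one_jump dist g N theta m) ->
  (forall L, \sum_(l < L) theta (3 * n + l)%N <= S) ->
  (k < N * 2 ^ n)%N -> dyadic R n k <= t <= dyadic R n k.+1 ->
  exists2 p, p \in centers s n k &
    dist (g t) (at_dyadic p.1 p.2) <= S + e + (2 * n)%:R * s.
Proof.
move=> rc th0 e0 s0 S0 hj hS kN /andP[kt tk].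
have n2s : 0 <= (2 * n)%:R * s by rewrite mulr_ge0.
have [tk'|->] : t < dyadic R n k.+1 \/ t = dyadic R n k.+1.
- by move: tk; rewrite le_eqVlt => /orP[/eqP|]; tauto.
- have t0 : 0 <= t := le_trans (dyadic_ge0 _ _ _) kt.
  pose i := dyadic_floor (3 * n) t.
  have it := dyadic_floorP (3 * n) t0; rewrite -/i in it.
  have E : (3 * n = n + 2 * n)%N by lia.
  have ki : (k * 2 ^ (2 * n) <= i < k.+1 * 2 ^ (2 * n))%N.
    have /andP[it1 it2] := it; rewrite E in it1 it2; apply/andP; split.
      rewrite -ltnS -(ltr_dyadic R (n + 2 * n)) dyadic_addn.
      exact: le_lt_trans it2.
    by rewrite -(ltr_dyadic R (n + 2 * n)) dyadic_addn; exact: le_lt_trans tk'.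
  have /andP[ki1 ki2] := ki.
  have iN : (i < N * 2 ^ (3 * n))%N.
    rewrite E expnD mulnA (leq_trans ki2)// leq_mul2r.
    by rewrite kN orbT.
  have chain i' : (k * 2 ^ (2 * n) <= i' <= k.+1 * 2 ^ (2 * n))%N ->
      dist (g t) (at_dyadic (3 * n) i') <= S + e ->
      exists2 p, p \in centers s n k &
        dist (g t) (at_dyadic p.1 p.2) <= S + e + (2 * n)%:R * s.
    rewrite E => ki' near; have [c|c|] := ascending_chain dist_metric g n s0 ki'.
    - exists (n, k); first by rewrite inE eqxx.
      by apply: le_trans (dT (at_dyadic (n + 2 * n) i') _ _) _; exact: lerD.
    - exists (n, k.+1); first by rewrite !inE eqxx orbT.
      by apply: le_trans (dT (at_dyadic (n + 2 * n) i') _ _) _; exact: lerD.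
    - move=> [l [j [/andP[l0 ln] /andP[kj jk] bj c]]]; exists ((n + l)%N, j).
        rewrite !inE; apply/orP; right; apply/orP; right; apply/allpairsPdep.
        exists l, j; split => //; first by rewrite mem_iota l0 add1n ltnS.
        by rewrite mem_filter bj mem_iota kj addnC -mulSn.
      by apply: le_trans (dT (at_dyadic (n + 2 * n) i') _ _) _; exact: lerD.
  have [c|c] := one_jump_interval dist_metric rc th0 e0 hj iN hS it.
    by apply: chain c; rewrite ki1 ltnW.
  by apply: chain c; rewrite ki2 (leq_trans ki1).
- exists (n, k.+1); first by rewrite !inE eqxx orbT.
  by rewrite dxx !addr_ge0// ltW.
Qed.

Definition scale n : R := 2 `^ (- (alpha^-1 * n%:R)).

(** All that is kept of the probability. The bound on [jumps] yields (U). The bound on [Z] yields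
    (L): it counts all grid points for l = 0 and only jump times for l > 0. The radius exceeds the
    scale by 2^(zeta n) to absorb the O(n) distance between the path and its centres. *)
Definition path_regular :=
  [/\ right_continuous_path dist g,
    exists m0, forall m, (m0 <= m)%N ->
      one_jump dist g N (fun m => 2 `^ (- ((3 * alpha)^-1 * m%:R))) m &
    forall eta : R, 0 < eta -> exists2 zeta : R, 0 < zeta &
      exists n0, forall n, (n0 <= n)%N ->
        (forall l k, (0 < l <= 2 * n)%N -> (k < N * 2 ^ n)%N ->
          (size (jumps (scale n) n l k))%:R <= 2 `^ (eta * n%:R)) /\
        (forall l (Z : seq nat), (l <= 2 * n)%N -> sorted ltn Z ->
          {in Z, forall j, (j <= N * 2 ^ (n + l))%N} ->
          ((0 < l)%N -> {in Z, forall j, jump (scale n) (n + l) j}) ->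
          {in Z &, forall i j, dist (at_dyadic (n + l) i) (at_dyadic (n + l) j)
             <= 2 `^ ((zeta - alpha^-1) * n%:R)} ->
          (size Z)%:R <= 2 `^ (eta * n%:R))].

Hypothesis reg : path_regular.

Lemma centers_near_scale : exists (C : R) n0, 0 < C /\
  forall n k t, (n0 <= n)%N -> (k < N * 2 ^ n)%N ->
    dyadic R n k <= t <= dyadic R n k.+1 ->
    exists2 p, p \in centers (scale n) n k &
      dist (g t) (at_dyadic p.1 p.2) <= (C + 2 * n%:R) * scale n.
Proof.
have [rc [m0 hm0] _] := reg.
have c0 : 0 < (3 * alpha)^-1 by rewrite invr_gt0 mulr_gt0.
have [K K0 hK] := pow2_geometric c0.
exists (K + 1), m0; split; first by rewrite addr_gt0.
move=> n k t mn kN kt; have s0 : 0 < scale n by exact: pow2_gt0.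
have th0 m : 0 <= 2 `^ (- ((3 * alpha)^-1 * m%:R)) :> R by exact: powR_ge0.
have hj m : (3 * n <= m)%N -> one_jump dist g N (fun m => 2 `^ (- ((3 * alpha)^-1 * m%:R))) m.
  by move=> nm; apply: hm0; lia.
have S0 : 0 <= K * scale n by rewrite mulr_ge0// ltW.
(* The threshold of level 3n is exactly [scale n], so the thresholds from there on form a geometric
   series of order [scale n]. *)
have hS L : \sum_(l < L) 2 `^ (- ((3 * alpha)^-1 * (3 * n + l)%:R)) <= K * scale n.
  apply: le_trans (ler_wpM2r (ltW s0) (hK L)); rewrite mulr_suml ler_sum// => l _.
  rewrite /scale -pow2D; apply: ler_pow2; rewrite le_eqVlt; apply/orP; left.
  by apply/eqP; rewrite natrD natrM; field; rewrite gt_eqF.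
have [p pc hp] := centers_near rc th0 s0 (ltW s0) S0 hj hS kN kt.
exists p => //; apply: le_trans hp _.
by rewrite natrM; lra.
Qed.

Definition visits t y := 0 <= t < N%:R /\ y = g t.

Lemma dyadic_floor_lt n t : 0 <= t < N%:R -> (dyadic_floor n t < N * 2 ^ n)%N.
Proof.
move=> /andP[t0 tN]; have /andP[h _] := dyadic_floorP n t0.
by rewrite -(ltr_dyadic R n) (le_lt_trans h)// /dyadic natrM mulfK//.
Qed.

Lemma visits_transfer : scale_transfer (@real_dist R) dist visits 1 alpha^-1.
Proof.
move=> eta eta0; have [_ _ counts] := reg.
have eta20 : 0 < eta / 2 by rewrite divr_gt0.
have [zeta _ [n1 h1]] := counts _ eta20.
have [C [n2 [C0 h2]]] := centers_near_scale.
(* Balls of radius (C + 2n) s have diameter at most 2 (C + 2) n s, and each of three lists of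
   centres has at most 4 n 2^(eta n / 2) entries. *)
have [n3 h3] := pow2_linear (2 * (C + 2)) eta0.
have [n4 h4] := pow2_linear 12 eta20.
exists (maxn (maxn n1 n2) (maxn (maxn n3 n4) 1)) => n.
rewrite !geq_max => /andP[/andP[/h1[jmp _] n2n] /andP[/andP[/h3 e3 /h4 e4] n0]] U dU.
have n1R : 1 <= n%:R :> R by rewrite ler1n.
have [[t0 [Ut0 t0N]]|nU] := pselect (exists t, U t /\ 0 <= t < N%:R); last first.
  exists 0%N, (fun=> set0); split => //; first exact: powR_ge0.
  by move=> y [t Ut [tN _]]; case: nU; exists t.
pose k0 := dyadic_floor n t0.
pose cs k := if (k < N * 2 ^ n)%N then centers (scale n) n k else [::].
(* Times in [U] are within 2^-n of [t0], hence in its interval or a neighbouring one; for k0 = 0 the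
   first list merely repeats the second. *)
pose l := cs k0.-1 ++ cs k0 ++ cs k0.+1.
have scs k : (size (cs k))%:R <= 4 * n%:R * (2 : R) `^ (eta / 2 * n%:R).
  have p1 : 1 <= (2 : R) `^ (eta / 2 * n%:R).
    by rewrite -[leLHS](powRr0 2); apply: ler_pow2; rewrite mulr_ge0// ltW.
  have p2 : 1 <= n%:R * (2 : R) `^ (eta / 2 * n%:R) by rewrite mulr_ege1.
  rewrite /cs; case: ifP => [kN|_]; last first.
    by rewrite -mulrA mulr_ge0// (le_trans _ p2).
  apply: le_trans (size_centers (fun l ln => jmp l k ln kN)) _.
  by rewrite natrM; lra.
exists (size l), (fun i => let p := nth (0, 0)%N l i in
  [set y | dist y (at_dyadic p.1 p.2) <= (C + 2 * n%:R) * scale n]); split.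
- rewrite !size_cat !natrD.
  apply: (@le_trans _ _ (12 * n%:R * (2 : R) `^ (eta / 2 * n%:R))).
    by have := scs k0.-1; have := scs k0; have := scs k0.+1; lra.
  rewrite (_ : eta * n%:R = eta / 2 * n%:R + eta / 2 * n%:R); last by field.
  by rewrite pow2D ler_wpM2r ?powR_ge0.
- move=> _ [t Ut [tN ->]]; have /andP[t_ge0 _] := tN.
  pose k := dyadic_floor n t; have kN := dyadic_floor_lt n tN; rewrite -/k in kN.
  have /andP[kt tk] := dyadic_floorP n t_ge0; rewrite -/k in kt tk.
  have kt' : dyadic R n k <= t <= dyadic R n k.+1 by rewrite kt ltW.
  have [p pc hp] := h2 _ _ _ n2n kN kt'.
  have pl : p \in l.
    have /andP[t0_ge0 _] := t0N.
    have /andP[kt0 tk0] := dyadic_floorP n t0_ge0; rewrite -/k0 in kt0 tk0.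
    have := (proj1 (diam_le _ _ (powR_ge0 _ _)) dU) _ _ Ut Ut0.
    rewrite /real_dist mul1r ler_norml => /andP[d1 d2].
    have k1 : (k <= k0.+1)%N.
      rewrite -ltnS -(ltr_dyadic R n) dyadic_step.
      by apply: le_lt_trans kt _; lra.
    have k2 : (k0 <= k.+1)%N.
      rewrite -ltnS -(ltr_dyadic R n) dyadic_step.
      by apply: le_lt_trans kt0 _; lra.
    rewrite /l !mem_cat; have : p \in cs k by rewrite /cs kN.
    have [->|[->|->]] : k = k0.-1 \/ k = k0 \/ k = k0.+1.
      by move: k1 k2; move: (k) (k0) => a b; clear; lia.
    - by move=> ->.
    - by move=> ->; rewrite orbT.
    - by move=> ->; rewrite !orbT.
  exists (index p l); first by rewrite /= index_mem.
  by rewrite /= nth_index.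
- move=> i _; apply/diam_le; first exact: powR_ge0.
  set p := nth _ _ _ => x y xp yp.
  apply: le_trans (dT (at_dyadic p.1 p.2) _ _) _.
  rewrite mulrBl pow2D -/(scale n) (dC _ y).
  apply: le_trans (lerD xp yp) _; rewrite -mulrDl.
  rewrite ler_wpM2r ?powR_ge0//; apply: le_trans e3.
  have : C <= C * n%:R by rewrite ler_peMr// ltW.
  by lra.
Qed.

(** A time at which the path is in [U] has a centre near [U], and a centre determines its level n
    interval up to two choices. So it is enough to count centres in a small ball, level by level. *)
Lemma visits_transfer_inv :
  scale_transfer dist (@real_dist R) (fun y t => visits t y) alpha^-1 1.
Proof.
move=> eta eta0; have [_ _ counts] := reg.
have eta20 : 0 < eta / 2 by rewrite divr_gt0.
have [zeta zeta0 [n1 h1]] := counts _ eta20.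
have [C [n2 [C0 h2]]] := centers_near_scale.
have [n3 h3] := pow2_linear (2 * (C + 3)) zeta0.
have [n4 h4] := pow2_linear 4 eta20.
exists (maxn (maxn n1 n2) (maxn (maxn n3 n4) 1)) => n.
rewrite !geq_max => /andP[/andP[/h1[_ cnt] n2n] /andP[/andP[/h3 e3 /h4 e4] n0]] U dU.
have n1R : 1 <= n%:R :> R by rewrite ler1n.
have s0 : 0 < scale n by exact: pow2_gt0.
have [[x Ux]|nU] := pselect (exists x, U x); last first.
  exists 0%N, (fun=> set0); split => //; first exact: powR_ge0.
  by move=> y [x Ux _]; case: nU; exists x.
(* The distance from a centre to the path, plus the diameter of [U], which is at most [scale n]. *)
pose rho := (C + 2 * n%:R + 1) * scale n.
have rho2 : 2 * rho <= 2 `^ ((zeta - alpha^-1) * n%:R).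
  rewrite mulrBl pow2D -/(scale n) /rho mulrA ler_wpM2r ?powR_ge0//.
  apply: le_trans e3; have : C <= C * n%:R by rewrite ler_peMr// ltW.
  by lra.
pose Z l := [seq j <- iota 0 (N * 2 ^ (n + l)).+1 |
  ((0 < l)%N ==> jump (scale n) (n + l) j) && (dist (at_dyadic (n + l) j) x <= rho)].
have sZ l : (l <= 2 * n)%N -> (size (Z l))%:R <= (2 : R) `^ (eta / 2 * n%:R).
  move=> ln; apply: (cnt l) => //.
  - by apply: sorted_filter; [exact: ltn_trans|exact: iota_ltn_sorted].
  - by move=> j; rewrite mem_filter mem_iota add0n ltnS => /andP[_].
  - by move=> l0 j; rewrite mem_filter l0 => /andP[/andP[]].
  - move=> i j; rewrite !mem_filter => /andP[/andP[_ ix] _] /andP[/andP[_ jx] _].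
    apply: le_trans rho2; apply: le_trans (dT x _ _) _.
    by rewrite (dC x); lra.
(* The first two lists recover k from the endpoints k and k+1, the third from a jump time of level n
   + l. *)
pose T := Z 0%N ++ [seq j.-1 | j <- Z 0%N] ++
  [seq (j %/ 2 ^ l)%N | l <- iota 1 (2 * n), j <- Z l].
have sT : (size T)%:R <= (2 : R) `^ (eta * n%:R).
  rewrite !size_cat size_map !natrD.
  have sF : (size [seq (j %/ 2 ^ l)%N | l <- iota 1 (2 * n), j <- Z l])%:R
      <= 2 * n%:R * (2 : R) `^ (eta / 2 * n%:R).
    rewrite size_allpairs_dep -natrM -[X in X%:R * _](size_iota 1).
    have : {subset iota 1 (2 * n) <= [pred l | (l <= 2 * n)%N]}.
      by move=> l; rewrite mem_iota add1n ltnS => /andP[].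
    elim: (iota _ _) => [|l ls IH] sub; first by rewrite mul0r.
    rewrite /= natrD -natr1 mulrDl mul1r addrC lerD//.
      by apply: IH => j jl; apply: sub; rewrite inE jl orbT.
    by apply: sZ; apply: sub; rewrite inE eqxx.
  have := sZ 0%N isT; set p := _ `^ (eta / 2 * _) in sF * => sZ0.
  apply: (@le_trans _ _ (4 * n%:R * p)).
    have : p <= n%:R * p by rewrite ler_peMl// powR_ge0.
    by lra.
  rewrite (_ : eta * n%:R = eta / 2 * n%:R + eta / 2 * n%:R); last by field.
  by rewrite pow2D ler_wpM2r ?powR_ge0.
pose I k := [set t | dyadic R n k <= t <= dyadic R n k.+1].
exists (size T), (fun i => I (nth 0%N T i)); split => //.
- move=> t [y Uy [tN yE]]; have /andP[t_ge0 _] := tN.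
  pose k := dyadic_floor n t; have kN := dyadic_floor_lt n tN; rewrite -/k in kN.
  have /andP[kt tk] := dyadic_floorP n t_ge0; rewrite -/k in kt tk.
  have kt' : dyadic R n k <= t <= dyadic R n k.+1 by rewrite kt ltW.
  have [p pc hp] := h2 _ _ _ n2n kN kt'.
  have px : dist (at_dyadic p.1 p.2) x <= rho.
    apply: le_trans (dT (g t) _ _) _.
    have := (proj1 (diam_le _ _ (powR_ge0 _ _)) dU) _ _ Uy Ux; rewrite yE -/(scale n).
    by rewrite (dC (at_dyadic p.1 p.2)) /rho; lra.
  suff kT : k \in T.
    by exists (index k T); [rewrite /= index_mem|rewrite /I nth_index].
  rewrite /T !mem_cat.
  have memZ0 j : (j <= N * 2 ^ n)%N -> dist (at_dyadic n j) x <= rho -> j \in Z 0%N.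
    by move=> jN jx; rewrite mem_filter addn0 jx mem_iota add0n ltnS.
  move: pc px; rewrite !inE => /orP[/eqP->|/orP[/eqP->|]] /=.
  - by move=> /memZ0 -> //; exact: ltnW.
  - move=> px; have kZ := memZ0 k.+1 kN px; apply/orP; right; apply/orP; left.
    by apply/mapP; exists k.+1.
  - move=> /allpairsPdep[l [j [hl hj ->]]] /= px.
    apply/orP; right; apply/orP; right; apply/allpairsPdep; exists l, j.
    move: hl hj; rewrite !mem_filter !mem_iota add1n ltnS => /andP[l0 ln].
    rewrite (addnC (k * _)%N) -mulSn => /andP[bj /andP[kj jk]].
    split; [by rewrite l0 ln| |]; last first.
      apply/esym/eqP; rewrite eqn_leq -ltnS ltn_divLR ?expn_gt0// jk.
      by rewrite leq_divRL ?expn_gt0.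
    rewrite l0/= bj px/= add0n ltnS (leq_trans (ltnW jk))//.
    by rewrite expnD mulnA leq_mul2r kN orbT.
- move=> i _; apply/diam_le; first exact: powR_ge0.
  move=> t t' /andP[a b] /andP[c d]; rewrite dyadic_step in b d.
  apply: (@le_trans _ _ (2 `^ (- n%:R))).
    by rewrite /real_dist ler_norml; apply/andP; split; lra.
  apply: ler_pow2; rewrite mulrBl mul1r lerDr mulr_ge0//.
  exact: ltW.
Qed.

End Counts.

(** * Bounds from the characteristic function *)

Section CoordinateSigmaAlgebra.
Variables (R : realType) (d : nat).
Implicit Types (x y c : 'rV[R]_d) (B : set 'rV[R]_d).

(** Contained in [borel], so the hypotheses on the process apply to it, while measurability of
    differences and of Euclidean balls reduces to real functions of the coordinates. *)
Definition coord_gen : set (set 'rV[R]_d) :=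
  [set B | exists (i : 'I_d) (a : R), B = [set x : 'rV[R]_d | x 0 i \in `]a, +oo[]].

Local Notation Vd := (g_sigma_algebraType coord_gen).
Local Notation coord_measurable := (coord_gen.-sigma.-measurable).

Lemma coord_measurable_borel B : coord_measurable B -> borel B.
Proof.
apply: smallest_sub; first exact: smallest_sigma_algebra.
move=> _ [i [a ->]]; apply: sub_sigma_algebra => /=.
rewrite (_ : mkset _ = (fun x : 'rV[R]_d => x 0 i) @^-1` [set y | a < y]).
  apply: open_comp; last exact: open_gt.
  by move=> x _; exact: coord_continuous.
by apply/seteqP; split => x /=; rewrite in_itv/= andbT.
Qed.

Lemma measurable_coord i : measurable_fun [set: Vd] (fun x : Vd => x 0 i).
Proof.
apply: (measurability _ (measurable_realfun.RGenOInfty.measurableE R)) => _ [_ [a ->] <-].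
rewrite setTI; apply: sub_sigma_algebra; exists i, a.
by apply/seteqP; split => x.
Qed.

Section RandomVector.
Context {disp : measure_display} {T : measurableType disp}.
Implicit Type Y : T -> 'rV[R]_d.

Definition coord_random Y := forall i, measurable_fun [set: T] (fun w => Y w 0 i).

Lemma random_vector_coord Y : random_vector Y -> coord_random Y.
Proof.
move=> mY i; apply: (measurability _ (measurable_realfun.RGenOInfty.measurableE R)) => _ [_ [a ->] <-].
rewrite setTI; pose B := [set x : 'rV[R]_d | x 0 i \in `]a, +oo[].
apply: (mY B); apply: coord_measurable_borel.
by apply: sub_sigma_algebra; exists i, a.
Qed.

Lemma coord_random_preimage Y B :
  coord_random Y -> coord_measurable B -> measurable (Y @^-1` B).
Proof.
move=> mY mB; rewrite -[X in measurable X]setTI.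
have mY' : measurable_fun [set: T] (Y : T -> Vd).
  apply: (measurability _ (erefl : coord_measurable = <<s coord_gen >>)).
  move=> _ [_ [i [a ->]] <-].
  exact: (mY i measurableT `]a, +oo[%classic (measurable_itv _)).
exact: mY'.
Qed.

Lemma coord_randomB Y Z : coord_random Y -> coord_random Z ->
  coord_random (fun w => Y w - Z w).
Proof.
move=> mY mZ i; under eq_fun do rewrite !mxE.
exact: measurable_funB.
Qed.

Lemma measurable_dotv (xi : 'rV[R]_d) Y : coord_random Y ->
  measurable_fun [set: T] (fun w => dotv xi (Y w)).
Proof.
by move=> mY; apply: measurable_sum => i; apply: measurable_funM.
Qed.

End RandomVector.

Lemma measurable_euclid_ball c (r : R) :
  coord_measurable [set x : 'rV[R]_d | euclid_norm (x + c) <= r].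
Proof.
rewrite -[X in coord_measurable X]setTI; apply: measurable_fun_le => //.
have ms : measurable_fun [set: R] (@Num.sqrt R).
  by apply: continuous_measurable_fun; exact: sqrt_continuous.
apply: (measurableT_comp ms); apply: measurable_sum => i.
apply: measurable_funM; under eq_fun do rewrite mxE;
  by apply: measurable_funD => //; exact: measurable_coord.
Qed.

Lemma measurable_euclid_gt (r : R) : coord_measurable [set x : 'rV[R]_d | r < euclid_norm x].
Proof.
rewrite (_ : mkset _ = ~` [set x : 'rV[R]_d | euclid_norm (x + 0) <= r]).
  by apply: measurableC; exact: measurable_euclid_ball.
by apply/seteqP; split => x /=; rewrite addr0 ltNge => /negP.
Qed.

End CoordinateSigmaAlgebra.

(** * Trigonometric sums and inequalities *)

Section Trigonometry.
Variable R : realType.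
Implicit Types (x y a t : R).

Lemma sin_abs_le x : `|sin x| <= `|x|.
Proof.
wlog x0 : x / 0 <= x.
  move=> h; have [/h//|x0] := leP 0 x.
  by have := h (- x); rewrite sinN !normrN; apply; rewrite oppr_ge0 ltW.
have [->|xn0] := eqVneq x 0; first by rewrite sin0.
have xp : 0 < x by rewrite lt_neqAle eq_sym xn0.
have [c _] := @MVT R sin cos 0 x xp (fun y _ => is_derive_sin y)
  (continuous_subspaceT (@continuous_sin R)).
rewrite sin0 !subr0 => ->; rewrite normrM ler_piMl//.
by rewrite ler_norml cos_geN1 cos_le1.
Qed.

(** cos x = 1 - 2 sin(x/2)^2 >= 1 - x^2 / 2. *)
Lemma cos_ge_half x : `|x| <= 1 -> 2^-1 <= cos x.
Proof.
move=> x1; have -> : x = (x / 2) *+ 2 by rewrite -mulr_natr divfK.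
rewrite cos_mulr2n.
have /(ler_pM (normr_ge0 _) (normr_ge0 _))/(_ (sin_abs_le (x / 2))) := sin_abs_le (x / 2).
rewrite -!expr2 -!normrX !ger0_norm ?sqr_ge0//.
have := cos2Dsin2 (x / 2); rewrite expr_div_n -mulr_natl.
have : x ^+ 2 <= 1 by rewrite -(real_normK (num_real x)) exprn_ile1.
by lra.
Qed.

Lemma sin_abs_ge x : `|x| <= 1 -> `|x| / 2 <= `|sin x|.
Proof.
wlog x0 : x / 0 <= x.
  move=> h; have [/h//|x0] := leP 0 x.
  by have := h (- x); rewrite sinN !normrN; apply; rewrite oppr_ge0 ltW.
rewrite ger0_norm// => x1.
have [->|xn0] := eqVneq x 0; first by rewrite mul0r.
have xp : 0 < x by rewrite lt_neqAle eq_sym xn0.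
have [c] := @MVT R sin cos 0 x xp (fun y _ => is_derive_sin y)
  (continuous_subspaceT (@continuous_sin R)).
rewrite in_itv/= => /andP[c0 cx]; rewrite sin0 !subr0 => ->.
have cc : 2^-1 <= cos c.
  apply: cos_ge_half; rewrite ger0_norm; [exact: le_trans (ltW cx) x1|exact: ltW].
rewrite normrM (ger0_norm x0) mulrC ler_wpM2r//.
exact: le_trans cc (ler_norm _).
Qed.

(** The Dirichlet kernel, multiplied out so that the sum telescopes without dividing by sin(t/2). *)
Lemma sum_cos_arith n a t :
  2 * sin (t / 2) * \sum_(k < n) cos (a + k.+1%:R * t) =
  sin (a + n%:R * t + t / 2) - sin (a + t / 2).
Proof.
elim: n => [|n IH]; first by rewrite big_ord0 mulr0 mul0r addr0 subrr.
rewrite big_ord_recr mulrDr IH.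
have -> : a + n%:R * t + t / 2 = (a + n.+1%:R * t) - t / 2.
  by rewrite -natr1; field.
by rewrite sinB (sinD (a + n.+1%:R * t) (t / 2)); ring.
Qed.

(** Both sides are the squared modulus of the sum of the exp(i w_j), written in real terms. *)
Lemma sum_cos_dist (I : finType) (w : I -> R) :
  \sum_i \sum_j cos (w i - w j) = (\sum_i cos (w i)) ^+ 2 + (\sum_i sin (w i)) ^+ 2.
Proof.
rewrite !expr2 !big_distrl -big_split; apply: eq_bigr => i _ /=.
by rewrite !big_distrr -big_split; apply: eq_bigr => j _ /=; rewrite cosB.
Qed.

End Trigonometry.

Section Integrals.
Context {disp : measure_display} {T : measurableType disp} {R : realType}.
Variable P : probability T R.

Lemma bounded_integrable (f : T -> R) (M : R) : measurable_fun [set: T] f ->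
  (forall w, `|f w| <= M) -> P.-integrable [set: T] (EFin \o f).
Proof.
move=> mf fM; apply: measurable_bounded_integrable => //.
  by apply: fin_num_fun_lty; exact: fin_num_measure.
exists M; split; first exact: num_real.
by move=> x Mx w _; exact: le_trans (fM w) (ltW Mx).
Qed.

Lemma Rintegral_sum (I : Type) (s : seq I) (f : I -> T -> R) :
  (forall i, P.-integrable [set: T] (EFin \o f i)) ->
  \int[P]_w (\sum_(i <- s) f i w) = \sum_(i <- s) \int[P]_w f i w.
Proof.
move=> fi; elim: s => [|i s IH].
  by under eq_Rintegral do rewrite big_nil; rewrite Rintegral_cst// mul0r big_nil.
under eq_Rintegral do rewrite big_cons.
rewrite big_cons RintegralD ?IH//.
rewrite (_ : _ \o _ = fun w => (\sum_(j <- s) (f j w)%:E)%E).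
  by apply: (integrable_sum measurableT s (h := fun j w => (f j w)%:E)) => j _; exact: fi.
by apply/funext => w /=; rewrite sumEFin.
Qed.

Lemma prob_le_Rintegral (f : T -> R) (c : R) (B : set T) : 0 < c ->
  measurable B -> P.-integrable [set: T] (EFin \o f) ->
  (forall w, 0 <= f w) -> (forall w, B w -> c <= f w) ->
  (P B <= (c^-1 * \int[P]_w f w)%:E)%E.
Proof.
move=> c0 mB fi f0 fc; rewrite EFinM lee_pdivlMl//.
have mf := measurable_int _ fi.
rewrite fineK; last exact: integrable_fin_num.
rewrite -integral_cst//.
apply: (@le_trans _ _ (\int[P]_(w in B) (f w)%:E)%E).
  apply: ge0_le_integral => //.
  - by move=> w _; rewrite lee_fin ltW.
  - exact: measurable_funS mf.
apply: ge0_subset_integral => //.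
by move=> w _; rewrite lee_fin.
Qed.

End Integrals.

Lemma coord_le_euclid (R : realType) (d : nat) (x : 'rV[R]_d) (i : 'I_d) :
  `|x 0 i| <= euclid_norm x.
Proof.
rewrite -sqrtr_sqr ler_wsqrtr// /dotv (bigD1 i)//= expr2 lerDl.
by apply: sumr_ge0 => j _; rewrite -expr2 sqr_ge0.
Qed.

Section CharacteristicBounds.
Context {disp : measure_display} {T : measurableType disp} {R : realType}.
Variables (P : probability T R) (d : nat) (Y : T -> 'rV[R]_d) (phi : 'rV[R]_d -> R).
Hypothesis mY : coord_random Y.
Hypothesis cosY : forall xi, \int[P]_w cos (dotv xi (Y w)) = phi xi.
Hypothesis sinY : forall xi, \int[P]_w sin (dotv xi (Y w)) = 0.

Lemma measurable_cos_dotv xi : measurable_fun [set: T] (fun w => cos (dotv xi (Y w))).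
Proof.
apply: (measurableT_comp (continuous_measurable_fun (@continuous_cos R))).
exact: measurable_dotv.
Qed.

Lemma measurable_sin_dotv xi : measurable_fun [set: T] (fun w => sin (dotv xi (Y w))).
Proof.
apply: (measurableT_comp (continuous_measurable_fun (@continuous_sin R))).
exact: measurable_dotv.
Qed.

Lemma integrable_cos xi : P.-integrable [set: T] (EFin \o (fun w => cos (dotv xi (Y w)))).
Proof.
apply: (@bounded_integrable _ _ _ _ _ 1); first exact: measurable_cos_dotv.
by move=> w; rewrite ler_norml cos_geN1 cos_le1.
Qed.

Lemma integrable_sin xi : P.-integrable [set: T] (EFin \o (fun w => sin (dotv xi (Y w)))).
Proof.
apply: (@bounded_integrable _ _ _ _ _ 1); first exact: measurable_sin_dotv.
by move=> w; rewrite ler_norml sin_geN1 sin_le1.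
Qed.

Lemma dotvD (xi x y : 'rV[R]_d) : dotv xi (x + y) = dotv xi x + dotv xi y.
Proof.
by rewrite -big_split; apply: eq_bigr => i _; rewrite mxE mulrDr.
Qed.

(** The sine integral vanishes, so a shift only multiplies [phi] by a cosine; this makes the ball
    estimate uniform in the centre. *)
Lemma Rintegral_cos_shift xi y :
  \int[P]_w cos (dotv xi (Y w + y)) = cos (dotv xi y) * phi xi.
Proof.
under eq_Rintegral do rewrite dotvD cosD.
rewrite RintegralB//; first last.
- apply: (@bounded_integrable _ _ _ _ _ 1).
    by apply: measurable_funM => //; exact: measurable_sin_dotv.
  move=> w; rewrite normrM mulr_ile1// ler_norml ?sin_geN1 ?sin_le1//.
- apply: (@bounded_integrable _ _ _ _ _ 1).
    by apply: measurable_funM => //; exact: measurable_cos_dotv.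
  move=> w; rewrite normrM mulr_ile1// ler_norml ?cos_geN1 ?cos_le1//.
rewrite !RintegralZr//; [|exact: integrable_sin|exact: integrable_cos].
by rewrite sinY cosY mul0r subr0 mulrC.
Qed.

Definition grid_point n (k : {ffun 'I_d -> 'I_n}) : 'rV[R]_d := \row_c (k c)%:R.

(* Fejer kernel: |\sum_k exp(i <k, x>)|^2 over the grid k in [0, n[^d is
   nonnegative everywhere and at least n^(2d) / 4 on the ball of radius 1/(dn);
   only finitely many values of the characteristic function are involved. *)
Lemma small_ball_bound n (y : 'rV[R]_d) : (0 < d)%N -> (0 < n)%N ->
  (P [set w | (euclid_norm (Y w + y) <= (d * n)%:R^-1)%R]
   <= (4 * (n ^ (2 * d))%:R^-1 *
      \sum_(k : {ffun 'I_d -> 'I_n}) \sum_(l : {ffun 'I_d -> 'I_n})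
        `|phi (grid_point k - grid_point l)|)%:E)%E.
Proof.
move=> d0 n0.
pose S w := \sum_(k : {ffun 'I_d -> 'I_n}) \sum_(l : {ffun 'I_d -> 'I_n})
  cos (dotv (grid_point k - grid_point l) (Y w + y)).
have SE w : S w = (\sum_(k : {ffun 'I_d -> 'I_n}) cos (dotv (grid_point k) (Y w + y))) ^+ 2 +
    (\sum_(k : {ffun 'I_d -> 'I_n}) sin (dotv (grid_point k) (Y w + y))) ^+ 2.
  rewrite -sum_cos_dist; apply: eq_bigr => k _; apply: eq_bigr => l _.
  congr cos; rewrite -sumrB; apply: eq_bigr => i _.
  by rewrite !mxE mulrBl.
have mB : measurable [set w | euclid_norm (Y w + y) <= (d * n)%:R^-1].
  exact: (coord_random_preimage mY (measurable_euclid_ball y _)).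
have mYy : coord_random (fun w => Y w + y).
  by move=> i; under eq_fun do rewrite mxE; exact: measurable_funD.
have icos (xi : 'rV[R]_d) : P.-integrable [set: T] (EFin \o (fun w => cos (dotv xi (Y w + y)))).
  apply: (@bounded_integrable _ _ _ _ _ 1).
    apply: (measurableT_comp (continuous_measurable_fun (@continuous_cos R))).
    exact: measurable_dotv.
  by move=> w; rewrite ler_norml cos_geN1 cos_le1.
have isum k : P.-integrable [set: T] (EFin \o (fun w =>
    \sum_(l : {ffun 'I_d -> 'I_n}) cos (dotv (grid_point k - grid_point l) (Y w + y)))).
  rewrite (_ : _ \o _ = fun w => (\sum_(l : {ffun 'I_d -> 'I_n})
    (cos (dotv (grid_point k - grid_point l) (Y w + y)))%:E)%E).
    apply: (integrable_sum measurableT (index_enum {ffun 'I_d -> 'I_n}) (h := fun l w =>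
     (cos (dotv (grid_point k - grid_point l) (Y w + y)))%:E)) => l _; exact: icos.
  by apply/funext => w /=; rewrite sumEFin.
have iS : P.-integrable [set: T] (EFin \o S).
  rewrite (_ : _ \o _ = fun w => (\sum_(k : {ffun 'I_d -> 'I_n}) (\sum_(l : {ffun 'I_d -> 'I_n})
    cos (dotv (grid_point k - grid_point l) (Y w + y)))%:E)%E).
    apply: (integrable_sum measurableT (index_enum {ffun 'I_d -> 'I_n}) (h := fun k w =>
     (\sum_(l : {ffun 'I_d -> 'I_n}) cos (dotv (grid_point k - grid_point l) (Y w + y)))%:E)) => k _; exact: isum.
  by apply/funext => w /=; rewrite sumEFin.
have nd0 : 0 < (n ^ (2 * d))%:R :> R by rewrite ltr0n expn_gt0 n0.
have c0 : 0 < (n ^ (2 * d))%:R / 4 :> R by rewrite divr_gt0.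
apply: le_trans (prob_le_Rintegral c0 mB iS _ _) _.
- by move=> w; rewrite SE addr_ge0 ?sqr_ge0.
- move=> w /= hw; rewrite SE; apply: ler_wpDr; first exact: sqr_ge0.
  (* On the ball, |<k, Y + y>| is at most d terms of size n / (d n), that is 1. *)
  have cosge (k : {ffun 'I_d -> 'I_n}) : 2^-1 <= cos (dotv (grid_point k) (Y w + y)).
    apply: cos_ge_half; apply: le_trans (ler_norm_sum _ _ _) _.
    apply: (@le_trans _ _ (\sum_(i < d) n%:R * (d * n)%:R^-1)).
      apply: ler_sum => i _; rewrite normrM; apply: ler_pM => //.
        by rewrite mxE ger0_norm// ler_nat ltnW.
      exact: le_trans (coord_le_euclid _ _) hw.
    rewrite sumr_const card_ord -[leLHS]mulr_natl mulrA -natrM divff//.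
    by rewrite pnatr_eq0 muln_eq0 negb_or -!lt0n d0 n0.
  rewrite (_ : _ / 4 = (\sum_(k : {ffun 'I_d -> 'I_n}) 2^-1) ^+ 2).
    rewrite ler_sqr ?nnegrE; first exact: ler_sum.
    - by apply: sumr_ge0.
    - by apply: sumr_ge0 => k _; apply: le_trans (cosge k).
  rewrite sumr_const card_ffun !card_ord -[X in _ = X ^+ 2]mulr_natl exprMn mulnC expnM natrX.
  by field.
rewrite lee_fin invfM invrK (mulrC _ 4) ler_wpM2l//.
rewrite Rintegral_sum//; apply: ler_sum => k _.
rewrite Rintegral_sum//; apply: ler_sum => l _.
rewrite Rintegral_cos_shift; apply: le_trans (ler_norm _) _.
by rewrite normrM ler_piMl// ler_norml cos_geN1 cos_le1.
Qed.

(* Average of 1 - cos(s x) over N equally spaced frequencies s in ]u, 2u]; the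
   upper bound N / u keeps x away from the other zeros of the Dirichlet kernel. *)
Lemma tail_bound_range (c : 'I_d) (u D : R) (N : nat) : 0 < u -> (0 < N)%N ->
  (forall s, u <= s <= 2 * u -> 1 - phi (s *: delta_mx 0 c) <= D) ->
  (P [set w | (8 / u <= `|Y w 0 c| <= N%:R / u)%R] <= (2 * D)%:E)%E.
Proof.
move=> u0 N0 hD.
have NR : 0 < N%:R :> R by rewrite ltr0n.
pose xi (k : 'I_N) : R := u + k.+1%:R * (u / N%:R).
have dotE s x : dotv (s *: delta_mx 0 c) x = s * x 0 c :> R.
  rewrite /dotv (bigD1 c)//= big1 ?addr0; first by rewrite !mxE !eqxx mulr1.
  by move=> i ic; rewrite !mxE eqxx (negbTE ic) mulr0 mul0r.
pose S w := \sum_(k < N) (1 - cos (dotv (xi k *: delta_mx 0 c) (Y w))).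
have i1 (k : 'I_N) : P.-integrable [set: T]
    (EFin \o (fun w => 1 - cos (dotv (xi k *: delta_mx 0 c) (Y w)))).
  apply: (@bounded_integrable _ _ _ _ _ 2).
    by apply: measurable_funB => //; exact: measurable_cos_dotv.
  move=> w; have := cos_geN1 (dotv (xi k *: delta_mx 0 c) (Y w)).
  have := cos_le1 (dotv (xi k *: delta_mx 0 c) (Y w)) => a b.
  by rewrite ger0_norm; lra.
have iS : P.-integrable [set: T] (EFin \o S).
  rewrite (_ : _ \o _ = fun w => (\sum_(k < N)
    (1 - cos (dotv (xi k *: delta_mx 0 c) (Y w)))%:E)%E).
    apply: (integrable_sum measurableT (index_enum 'I_N) (h := fun k w =>
     (1 - cos (dotv (xi k *: delta_mx 0 c) (Y w)))%:E)) => k _; exact: i1.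
  by apply/funext => w /=; rewrite sumEFin.
have mn : measurable_fun [set: T] (fun w => `|Y w 0 c|).
  exact: (measurableT_comp (@normr_measurable R setT)).
have mB : measurable [set w | 8 / u <= `|Y w 0 c| <= N%:R / u].
  rewrite (_ : mkset _ = ([set: T] `&` [set w | 8 / u <= `|Y w 0 c|]) `&`
      ([set: T] `&` [set w | `|Y w 0 c| <= N%:R / u])).
    by apply: measurableI; apply: measurable_fun_le.
  by apply/seteqP; split => w /=; [move=> /andP[] | move=> [[_ a] [_ b]]; apply/andP].
have N2 : 0 < N%:R / 2 :> R by rewrite divr_gt0.
apply: le_trans (prob_le_Rintegral N2 mB iS _ _) _.
- by move=> w; apply: sumr_ge0 => k _; rewrite subr_ge0 cos_le1.
- move=> w /= /andP[h8 hN]; set x := Y w 0 c in h8 hN.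
  pose t := u / N%:R * x.
  rewrite /S sumrB sumr_const card_ord (eq_bigr (fun k : 'I_N => cos (u * x + k.+1%:R * t))); last first.
    by move=> k _; rewrite dotE /xi /t -/x; congr cos; ring.
  rewrite -[X in _ <= X - _]/(N%:R).
  have tx : `|t| = u / N%:R * `|x| by rewrite normrM ger0_norm// divr_ge0// ltW.
  have x8 : 8 <= u * `|x| by rewrite mulrC -ler_pdivrMr.
  have t1 : `|t| <= 1.
    by rewrite tx mulrAC ler_pdivrMr// mul1r mulrC -ler_pdivlMr.
  have tN : 8 <= N%:R * `|t| by rewrite tx mulrA mulrCA divff ?mulr1// gt_eqF.
  (* |C| <= 1 / |sin(t/2)| <= 4 / |t| <= N / 2: the last inequality is the origin of the constant 8,
     and |t| <= 1 makes sin(t/2) comparable to t/2. *)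
  have := sum_cos_arith N (u * x) t; set C := \sum_(k < N) _ => hC.
  have s4 : `|t| / 4 <= `|sin (t / 2)|.
    have := @sin_abs_ge _ (t / 2); rewrite normrM (ger0_norm (_ : 0 <= 2^-1))//.
    by move=> h; apply: le_trans (h _); lra.
  have : `|2 * sin (t / 2) * C| <= 2.
    rewrite hC; apply: le_trans (ler_normB _ _) _.
    have sl z : `|sin z| <= 1 :> R by rewrite ler_norml sin_geN1 sin_le1.
    by apply: le_trans (lerD (sl _) (sl _)) _.
  rewrite !normrM (ger0_norm (_ : 0 <= 2))// => h2.
  suff : C <= N%:R / 2 by lra.
  apply: le_trans (ler_norm _) _.
  have c_ge0 := normr_ge0 C.
  have t0 : 0 < `|t| by nra.
  rewrite -(ler_pM2r t0).
  have : `|C| * (`|t| / 4) <= `|C| * `|sin (t / 2)| by rewrite ler_wpM2l.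
  by lra.
rewrite lee_fin invf_div -mulrA ler_wpM2l// mulrC ler_pdivrMr//.
rewrite Rintegral_sum//; apply: (@le_trans _ _ (\sum_(k < N) D)); last first.
  by rewrite sumr_const card_ord mulr_natr.
apply: ler_sum => k _; rewrite RintegralB//; last exact: integrable_cos.
  have -> : \int[P]_w (1 : R) = 1.
    by rewrite Rintegral_cst// mul1r; exact: (congr1 fine (probability_setT P)).
  rewrite cosY; apply: hD; rewrite /xi.
  have kN : k.+1%:R / N%:R <= 1 :> R by rewrite ler_pdivrMr// mul1r ler_nat.
  have k0 : 0 <= k.+1%:R / N%:R :> R by rewrite divr_ge0.
  by rewrite mulrCA; apply/andP; split; nra.
apply: (@bounded_integrable _ _ _ _ _ 1) => // w.
by rewrite normr1.
Qed.

(** The bound of [tail_bound_range] does not depend on N, so the truncation N / u is removed by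
    monotone convergence. *)
Lemma tail_bound (c : 'I_d) (u D : R) : 0 < u ->
  (forall s, u <= s <= 2 * u -> 1 - phi (s *: delta_mx 0 c) <= D) ->
  (P [set w | (8 / u <= `|Y w 0 c|)%R] <= (2 * D)%:E)%E.
Proof.
move=> u0 hD.
pose F N := [set w | 8 / u <= `|Y w 0 c| <= N%:R / u].
have mn : measurable_fun [set: T] (fun w => `|Y w 0 c|).
  exact: (measurableT_comp (@normr_measurable R setT)).
have mF N : measurable (F N).
  rewrite (_ : F N = ([set: T] `&` [set w | 8 / u <= `|Y w 0 c|]) `&`
      ([set: T] `&` [set w | `|Y w 0 c| <= N%:R / u])).
    by apply: measurableI; apply: measurable_fun_le.
  by apply/seteqP; split => w /=; [move=> /andP[] | move=> [[_ a] [_ b]]; apply/andP].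
have -> : [set w | 8 / u <= `|Y w 0 c|] = \bigcup_N F N.
  apply/seteqP; split => [w /= hw|w [N _ /andP[]//]].
  exists (Num.trunc (`|Y w 0 c| * u)).+1 => //; rewrite /F/= hw/= ler_pdivlMr//.
  exact/ltW/truncnS_gt.
have ndF : {homo F : n m / (n <= m)%N >-> (n <= m)%O}.
  move=> n m nm; apply/subsetPset => w /andP[a b]; rewrite /F/= a/=.
  by apply: le_trans b _; rewrite ler_pM2r ?invr_gt0// ler_nat.
have cF := nondecreasing_cvg_mu (mu := P) mF (bigcupT_measurable _ mF) ndF.
rewrite -(cvg_lim _ cF)//; apply: lime_le; first by apply/cvg_ex; eexists; exact: cF.
near=> N; apply: tail_bound_range => //.
near: N; exact: nbhs_infty_gt.
Unshelve. all: by end_near.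
Qed.

End CharacteristicBounds.

Lemma ge0_integral_scale_indic (disp : measure_display) (T : measurableType disp)
    (R : realType) (mu : measure T R) (D E : set T) (f : T -> R) (c : R) :
  measurable D -> measurable E -> measurable_fun [set: T] f ->
  (forall w, 0 <= f w) -> 0 <= c ->
  (\int[mu]_(w in D) (c * \1_E w * f w)%:E =
   c%:E * \int[mu]_(w in D `&` E) (f w)%:E)%E.
Proof.
move=> mD mE mf f0 c0; rewrite integral_mkcondr.
rewrite -ge0_integralZl_EFin//; first last.
- apply/measurable_restrict => //.
  apply: measurable_funTS; exact/measurable_EFinP.
- by move=> w _; rewrite patchE; case: ifP; rewrite ?lee_fin.
apply: eq_integral => w _; rewrite patchE indicE.
by case: ifP => _; [rewrite mulr1 EFinM|rewrite mulr0 mul0r mule0].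
Qed.

(** * Independent increments and chains of hits *)

Section IndependentIncrements.
Context {disp : measure_display} {T : measurableType disp} {R : realType}.
Variables (P : probability T R) (d : nat) (X : R -> T -> 'rV[R]_d).
Hypothesis levyX : levy_process P X.
Implicit Types (A : set T) (B C : set 'rV[R]_d) (s t u v : R).

Local Notation cmeas := ((@coord_gen R d).-sigma.-measurable).

Definition incr u v B : set T := [set w | B (X v w - X u w)].

Lemma levy_coord_random t : 0 <= t -> coord_random (X t).
Proof. by move=> t0; apply: random_vector_coord; exact: (levy_random_vector levyX). Qed.

Lemma measurable_incr u v B : 0 <= u -> 0 <= v -> cmeas B -> measurable (incr u v B).
Proof.
move=> u0 v0 mB; apply: (@coord_random_preimage _ _ _ _ (fun w => X v w - X u w)) => //.
by apply: coord_randomB; exact: levy_coord_random.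
Qed.

(** Stationarity compares with X(v - u) - X(0), and X(0) vanishes only almost surely; the events
    differ inside that null set. *)
Lemma prob_incr u v B : 0 <= u <= v -> cmeas B ->
  P (incr u v B) = P (X (v - u) @^-1` B).
Proof.
move=> /andP[u0 uv] mB; have vu0 : 0 <= v - u by rewrite subr_ge0.
have := levy_stationary levyX u0 vu0 (coord_measurable_borel mB).
rewrite (addrC u) subrK => ->.
have mX : measurable (X (v - u) @^-1` B).
  exact: (coord_random_preimage (levy_coord_random vu0)).
have mX0 : measurable (incr 0 (v - u) B) by exact: measurable_incr.
have [N [mN N0 sN]] := levy_start levyX.
have sub (E F : set T) : measurable E -> measurable F ->
    (forall w, X 0 w = 0 -> E w -> F w) -> (P E <= P F)%E.
  move=> mE mF EF; apply: (@le_trans _ _ (P (F `|` N))).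
    apply: le_measure; rewrite ?inE//; first exact: measurableU.
    move=> w Ew; have [X0|X0] := pselect (X 0 w = 0); first by left; exact: EF.
    by right; exact: sN.
  apply: le_trans (measureU2 _ mF mN) _.
  by move: N0 => /= ->; rewrite adde0.
apply/eqP; rewrite eq_le !sub// => w X0; rewrite /incr/= X0 subr0//.
Qed.

(* [past u A]: A is independent of every finite family of increments after
   time u; A need not belong to the sigma-algebra of the process. *)
Definition past u A := measurable A /\
  forall (n : nat) (t : nat -> R) (B : nat -> set 'rV[R]_d),
    u <= t 0%N -> (forall k, t k <= t k.+1) -> (forall k, cmeas (B k)) ->
    P (A `&` \bigcap_(k in `I_n) incr (t k) (t k.+1) (B k))
    = (P A * \prod_(k < n) P (incr (t k) (t k.+1) (B k)))%E.

Lemma past_setT : past 0 setT.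
Proof.
split=> // n t B t0 tm mB; rewrite setTI (levy_independent levyX)//.
  by rewrite (probability_setT P : P [set: T] = 1%E) mul1e.
by move=> k; exact: coord_measurable_borel.
Qed.

Lemma past_mono u v A : u <= v -> past u A -> past v A.
Proof.
move=> uv [mA h]; split=> // n t B vt; apply: h; exact: le_trans uv vt.
Qed.

Lemma past_incr u v A B : 0 <= u -> u <= v -> past u A -> cmeas B ->
  past v (A `&` incr u v B) /\ P (A `&` incr u v B) = (P A * P (incr u v B))%E.
Proof.
move=> u0 uv [mA h] mB; have v0 := le_trans u0 uv.
have PA : P (A `&` incr u v B) = (P A * P (incr u v B))%E.
  have := h 1%N (fun k => if k == 0%N then u else v) (fun=> B) (lexx _).
  rewrite big_ord_recl big_ord0 mule1/= => <- //.
    by congr (P _); congr (_ `&` _); apply/seteqP; split => [w hw [|//] _//|w /(_ 0%N isT)].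
  by case.
split=> //; split; first by apply: measurableI => //; exact: measurable_incr.
move=> n t C vt tm mC.
(* [past] speaks of consecutive intervals; the gap between [v] and [t 0] is filled with the trivial
   event. *)
pose t' k := if k is k'.+1 then (if k' is k''.+1 then t k'' else v) else u.
pose B' k := if k is k'.+1 then (if k' is k''.+1 then C k'' else setT) else B.
have := h n.+2 t' B' (lexx _); rewrite !big_ord_recl/=.
have -> : P (incr v (t 0%N) setT) = 1%E.
  by rewrite (_ : incr _ _ _ = setT); [exact: (probability_setT P)|apply/seteqP; split].
rewrite mul1e muleA PA => <-.
- congr (P _); rewrite -setIA; congr (_ `&` _); apply/seteqP; split=> w.
    by move=> [hw hC] [|[|k]] //= kn; exact: hC.
  move=> hw; split; first exact: (hw 0%N).
  by move=> k kn; exact: (hw k.+2).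
- by case=> [|[|k]]/=.
- by case=> [|[|k]]/=.
Qed.

End IndependentIncrements.

Lemma sum_uniq_le (R : numDomainType) (q : nat -> R) (H : nat) (s : seq nat) :
  (forall i, 0 <= q i) -> uniq s -> all (fun i => i < H)%N s ->
  \sum_(i <- s) q i <= \sum_(i < H) q i.
Proof.
move=> q0 us /allP sH; rewrite -(big_mkord xpredT q) /index_iota subn0.
have sub : {subset s <= iota 0 H} by move=> i /sH; rewrite mem_iota.
have pq : perm_eq s [seq i <- iota 0 H | i \in s].
  apply: uniq_perm => //; first by rewrite filter_uniq// iota_uniq.
  move=> i; rewrite mem_filter; case: (boolP (i \in s)) => //= /sub ->.
  by [].
rewrite (perm_big _ pq) big_filter [leRHS](bigID (mem s))/= lerDl.
by apply: sumr_ge0.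
Qed.

Section ChainWeight.
Context {disp : measure_display} {T : measurableType disp} {R : realType}.
Variables (P : probability T R) (d : nat) (X : R -> T -> 'rV[R]_d).
Hypothesis levyX : levy_process P X.

Local Notation cmeas := ((@coord_gen R d).-sigma.-measurable).
Local Notation incr := (incr X).
Local Notation past := (past P X).

Variables (h : R) (near bad : set 'rV[R]_d).
Hypotheses (h0 : 0 <= h) (mnear : cmeas near) (mbad : cmeas bad).

Definition tick (j : nat) : R := j%:R * h.

Definition hit i j : set T :=
  incr (tick i) (tick j) near `&` incr (tick j) (tick j.+1) bad.

(* Summing over all increasing chains of hits, weighted by theta to the length:
   k hits at pairwise near times contribute at least (1 + theta)^k. *)
Fixpoint chain_weight (theta : R) (j : nat) (l : seq nat) (w : T) : R :=
  if l is j' :: l' then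
    chain_weight theta j l' w + theta * \1_(hit j j') w * chain_weight theta j' l' w
  else 1.

Lemma tick_ge0 j : 0 <= tick j.
Proof. by rewrite mulr_ge0. Qed.

Lemma tick_le i j : (i <= j)%N -> tick i <= tick j.
Proof. by move=> ij; rewrite ler_wpM2r// ler_nat. Qed.

Lemma measurable_hit i j : measurable (hit i j).
Proof.
by apply: measurableI; apply: (measurable_incr levyX) => //; exact: tick_ge0.
Qed.

Section Weight.
Variable theta : R.
Hypothesis theta0 : 0 <= theta.

Lemma chain_weight_ge1 j l w : 1 <= chain_weight theta j l w.
Proof.
elim: l j => [|j' l IH] j //=; apply: ler_wpDr => //.
by rewrite !mulr_ge0// ?indicE// (le_trans ler01)// IH.
Qed.

Lemma measurable_chain_weight j l : measurable_fun [set: T] (chain_weight theta j l).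
Proof.
elim: l j => [|j' l IH] j /=; first exact: measurable_cst.
apply: measurable_funD => //; apply: measurable_funM => //.
apply: measurable_funM => //; apply: measurable_indic; exact: measurable_hit.
Qed.

(** By pairwise nearness every subset of Z is again a chain of hits, so the weight dominates the sum
    of theta^|S| over all subsets S of Z. *)
Lemma chain_weight_hits j l Z w : subseq Z l ->
  pairwise (fun i k => w \in incr (tick i) (tick k) near) (j :: Z) ->
  {in Z, forall i, w \in incr (tick i) (tick i.+1) bad} ->
  (1 + theta) ^+ size Z <= chain_weight theta j l w.
Proof.
elim: l j Z => [|j' l IH] j [|z Z].
- by rewrite expr0.
- by [].
- by move=> _ _ _; exact: chain_weight_ge1.
case: (eqVneq z j') => [->|zj']; last first.
  rewrite /subseq (negbTE zj') -/subseq => sub pw hb; rewrite [leRHS]/=.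
  apply: ler_wpDr; last exact: (IH j (z :: Z)).
  rewrite !mulr_ge0// ?indicE// (le_trans ler01)// chain_weight_ge1//.
rewrite /= eqxx => sub /andP[/andP[nz nZ] /andP[zZ pw]] hb.
have hb' : {in Z, forall i, w \in incr (tick i) (tick i.+1) bad}.
  by move=> i iZ; apply: hb; rewrite inE iZ orbT.
rewrite exprS mulrDl mul1r; apply: lerD.
  by apply: IH => //=; rewrite nZ.
rewrite -mulrA ler_wpM2l// indicE.
have -> : (w \in hit j j') by rewrite in_setI nz/= hb// inE eqxx.
by rewrite mul1r; apply: IH => //=; rewrite zZ.
Qed.

Variables (Q nearQ : nat -> set 'rV[R]_d) (q : nat -> R) (p : R) (H : nat).
Hypotheses (mQ : forall z, cmeas (Q z)) (mnearQ : forall z, cmeas (nearQ z)).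
Hypotheses (Qtriv : trivIset setT Q) (Qcover : \bigcup_z Q z = setT).
Hypothesis near_split : forall z x y, Q z x -> near (x + y) -> nearQ z y.
Hypotheses (q0 : forall i, 0 <= q i) (p0 : 0 <= p).
Hypothesis qP : forall z i j, (i < j)%N ->
  (P (incr (tick i.+1) (tick j) (nearQ z)) <= (q (j - i.+1))%:E)%E.
Hypothesis pP : forall j, (P (incr (tick j) (tick j.+1) bad) <= p%:E)%E.
Hypothesis small : 2 * theta * p * \sum_(i < H) q i <= 1.

Local Notation reach j l := (\sum_(j' <- l) q (j' - j.+1)).

Lemma reach_small j l : path ltn j l -> all (fun i => i - j.+1 < H)%N l ->
  2 * theta * p * reach j l <= 1.
Proof.
move=> pl lH; apply: le_trans small; apply: ler_wpM2l.
  by rewrite !mulr_ge0.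
rewrite -(big_map (fun i => i - j.+1)%N xpredT q); apply: sum_uniq_le => //.
  rewrite map_inj_in_uniq; first exact: (sorted_uniq ltn_trans ltnn (path_sorted pl)).
  have := order_path_min ltn_trans pl => /allP jl.
  by move=> a b /jl ja /jl jb; lia.
by rewrite all_map.
Qed.

(** The induction carries an event [A] of the past and a condition [C] on the increment right after
    j, since that increment is the one a hit has just declared bad. A successor j' costs theta, a
    return probability [q], counted from time j+1, and the probability [p] of a bad increment. *)
Lemma chain_weight_integral l : forall j A C, path ltn j l ->
  all (fun i => i - j.+1 < H)%N l -> past (tick j) A -> cmeas C ->
  (\int[P]_(w in A `&` incr (tick j) (tick j.+1) C) (chain_weight theta j l w)%:E
   <= (1 + 2 * theta * p * reach j l)%:E * P (A `&` incr (tick j) (tick j.+1) C))%E.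
Proof.
elim: l => [|j' l IH] j A C pl lH pA mC.
  rewrite big_nil mulr0 addr0 mul1e /=.
  have [mA _] := pA; have mI : measurable (A `&` incr (tick j) (tick j.+1) C).
    by apply: measurableI => //; apply: (measurable_incr levyX) => //; exact: tick_ge0.
  by have := integral_cst P mI 1%E; rewrite mul1e /cst => ->.
have [mA _] := pA.
have minc i k B : cmeas B -> measurable (incr (tick i) (tick k) B).
  by move=> mB; apply: (measurable_incr levyX) => //; exact: tick_ge0.
set G := A `&` _; have mG : measurable G by apply: measurableI => //; exact: minc.
move: pl lH => /= /andP[jj' pl] /andP[jH lH].
have pl' : path ltn j l by case: (l) pl => //= a l' /andP[b ->]; rewrite (ltn_trans jj').
have lH' : all (fun i => i - j'.+1 < H)%N l.
  by apply/allP => i /(allP lH); apply: leq_ltn_trans; rewrite leq_sub2l// ltnW.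
have m1 := measurable_chain_weight j l; have m2 := measurable_chain_weight j' l.
have ge0 k w : 0 <= chain_weight theta k l w.
  exact: le_trans ler01 (chain_weight_ge1 _ _ _).
under eq_integral do rewrite EFinD.
rewrite ge0_integralD//; first last.
- apply/measurable_EFinP; apply: measurable_funTS; apply: measurable_funM => //.
  by apply: measurable_funM => //; apply: measurable_indic; exact: measurable_hit.
- by move=> w _; rewrite lee_fin !mulr_ge0// indicE.
- by apply/measurable_EFinP; exact: measurable_funTS.
- by move=> w _; rewrite lee_fin.
rewrite ge0_integral_scale_indic//; last exact: measurable_hit.
rewrite big_cons mulrDr addrCA addrC EFinD muleDl//; last exact: fin_num_measure.
apply: leeD; first exact: IH.
(* The increment over [tick j, tick j.+1] is constrained by the event and enters
   the nearness condition; freezing it in a cell makes the two independent. *)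
pose Gz z := A `&` incr (tick j) (tick j.+1) (C `&` Q z).
have pGz z : past (tick j.+1) (Gz z).
  by apply: (proj1 (past_incr levyX (tick_ge0 _) (tick_le (leqnSn _)) pA _)); exact: measurableI.
pose Az z := Gz z `&` incr (tick j.+1) (tick j') (nearQ z).
have [pAz PAz] : (forall z, past (tick j') (Az z)) /\
    (forall z, P (Az z) = P (Gz z) * P (incr (tick j.+1) (tick j') (nearQ z)))%E.
  by split=> z; have [] := past_incr levyX (tick_ge0 j.+1) (tick_le jj') (pGz z) (mnearQ z).
have mGz z : measurable (Gz z) by have [] := pGz z.
have sub_cell : G `&` hit j j' `<=` \bigcup_z (Az z `&` incr (tick j') (tick j'.+1) bad).
  move=> w [[Aw Cw] [nw bw]].
  have : setT (X (tick j.+1) w - X (tick j) w) by [].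
  rewrite -Qcover => -[z _ Qz]; exists z => //; split=> //; split; first by split.
  by apply: near_split Qz _; rewrite addrC addrA subrK.
have trivGz : trivIset setT Gz.
  by move=> a b _ _ [w [[_ [_ Qa]] [_ [_ Qb]]]]; apply: Qtriv => //; exists (X (tick j.+1) w - X (tick j) w).
have UGz : \bigcup_z Gz z = G.
  apply/seteqP; split=> [w [z _ [Aw [Cw _]]]|w [Aw Cw]]; first by split.
  have : setT (X (tick j.+1) w - X (tick j) w) by [].
  by rewrite -Qcover => -[z _ Qz]; exists z.
have mAb z : measurable (Az z `&` incr (tick j') (tick j'.+1) bad).
  by apply: measurableI; [have [] := pAz z|exact: minc].
have trivAb : trivIset setT (fun z => Az z `&` incr (tick j') (tick j'.+1) bad).
  move=> a b _ _ [w [[[Ga _] _] [[Gb _] _]]]; apply: trivGz => //; by exists w.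
apply: (@le_trans _ _ (theta%:E * \sum_(0 <= z <oo) (2 * p * q (j' - j.+1))%:E * P (Gz z)))%E; last first.
  rewrite nneseriesZl//.
  rewrite muleA -EFinM (_ : theta * _ = 2 * theta * p * q (j' - j.+1)); last by ring.
  rewrite -[in leRHS]UGz measure_bigcup//.
  by under [in leRHS]eq_eseriesl do rewrite in_setT.
apply: lee_wpmul2l; first by rewrite lee_fin.
apply: (@le_trans _ _ (\int[P]_(w in \bigcup_z (Az z `&` incr (tick j') (tick j'.+1) bad))
    (chain_weight theta j' l w)%:E)%E).
  apply: ge0_subset_integral => //.
  - by apply: measurableI => //; exact: measurable_hit.
  - exact: bigcupT_measurable.
  - by apply/measurable_EFinP; exact: measurable_funTS.
  - by move=> w _; rewrite lee_fin.
rewrite ge0_integral_bigcup//; first last.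
- by move=> w _; rewrite lee_fin.
- by apply/measurable_EFinP; exact: measurable_funTS.
apply: lee_nneseries => [z _ _|z _].
  by apply: integral_ge0 => w _; rewrite lee_fin.
apply: le_trans (IH j' (Az z) bad pl lH' (pAz z) mbad) _.
have [_ ->] := past_incr levyX (tick_ge0 j') (tick_le (leqnSn j')) (pAz z) mbad.
rewrite PAz.
(* The smallness hypothesis bounds the mean of the remaining weight by 2; this is the factor 2 in
   the statement. *)
have rs : 1 + 2 * theta * p * reach j' l <= 2.
  by have := reach_small pl lH'; lra.
have r0 : 0 <= 1 + 2 * theta * p * reach j' l.
  by rewrite addr_ge0// !mulr_ge0// sumr_ge0.
apply: (@le_trans _ _ (2%:E * (P (Gz z) * (q (j' - j.+1))%:E * p%:E))%E).
  apply: lee_pmul; rewrite ?lee_fin ?mule_ge0 ?measure_ge0//.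
  apply: lee_pmul => //; rewrite ?mule_ge0 ?measure_ge0//.
  by apply: lee_wpmul2l => //; exact: qP.
rewrite le_eqVlt; apply/orP; left; apply/eqP.
have Pf : P (Gz z) \is a fin_num by exact: fin_num_measure.
rewrite -(fineK Pf) -!EFinM; congr EFin; ring.
Qed.

(** Markov's inequality for [chain_weight], whose mean is at most 2 by [reach_small]. *)
Lemma chain_weight_tail j l (L : nat) : path ltn j l ->
  all (fun i => i - j.+1 < H)%N l ->
  (P [set w | ((1 + theta) ^+ L <= chain_weight theta j l w)%R]
   <= (2 / (1 + theta) ^+ L)%:E)%E.
Proof.
move=> pl lH.
have t0 : 0 < 1 + theta by rewrite ltr_pwDl.
have c0 : 0 < (1 + theta) ^+ L by rewrite exprn_gt0.
have mcw := measurable_chain_weight j l.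
have mB : measurable [set w | (1 + theta) ^+ L <= chain_weight theta j l w].
  rewrite -[X in measurable X]setTI; exact: measurable_fun_le.
have := chain_weight_integral pl lH (past_mono (tick_ge0 j) (past_setT levyX)) (@measurableT _ (g_sigma_algebraType (@coord_gen R d))).
have -> : setT `&` incr (tick j) (tick j.+1) setT = setT.
  by rewrite setTI; apply/seteqP; split.
rewrite (probability_setT P : P setT = 1%E) mule1 => hI.
rewrite mulrC EFinM lee_pdivlMl//.
have := integral_cst P mB ((1 + theta) ^+ L)%:E; rewrite /cst => <-.
apply: (@le_trans _ _ (\int[P]_(w in setT) (chain_weight theta j l w)%:E)%E); last first.
  by apply: le_trans hI _; rewrite lee_fin; have := reach_small pl lH; lra.
apply: (@le_trans _ _ (\int[P]_(w in [set w | ((1 + theta) ^+ L <= chain_weight theta j l w)%R])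
   (chain_weight theta j l w)%:E)%E).
  apply: ge0_le_integral => //.
  - by move=> w _; rewrite lee_fin ltW.
  - by apply/measurable_EFinP; exact: measurable_funTS.
apply: ge0_subset_integral => //; first exact/measurable_EFinP.
by move=> w _; rewrite lee_fin (le_trans ler01)// chain_weight_ge1.
Qed.

End Weight.
End ChainWeight.

(** * Estimates for the process *)

Section Euclid.
Variables (R : realType) (d : nat).
Implicit Types (x y z : 'rV[R]_d).

Lemma dotvC x y : dotv x y = dotv y x.
Proof. by apply: eq_bigr => i _; rewrite mulrC. Qed.

Lemma dotvv_ge0 x : 0 <= dotv x x.
Proof. by apply: sumr_ge0 => i _; rewrite -expr2 sqr_ge0. Qed.

Lemma euclid_norm_ge0 x : 0 <= euclid_norm x.
Proof. exact: sqrtr_ge0. Qed.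

Lemma sqr_euclid_norm x : euclid_norm x ^+ 2 = dotv x x.
Proof. by rewrite sqr_sqrtr// dotvv_ge0. Qed.

Lemma dotvZ (a : R) x y : dotv x (a *: y) = a * dotv x y.
Proof. by rewrite /dotv mulr_sumr; apply: eq_bigr => i _; rewrite mxE mulrCA. Qed.

Lemma euclid_normN x : euclid_norm (- x) = euclid_norm x.
Proof.
by congr Num.sqrt; apply: eq_bigr => i _; rewrite !mxE mulrNN.
Qed.

Lemma euclid_norm_eq0 x : euclid_norm x = 0 -> forall i, x 0 i = 0.
Proof.
move=> x0 i; have := sqr_euclid_norm x; rewrite x0 expr0n/= => /esym/eqP.
rewrite psumr_eq0; last by move=> j _; rewrite -expr2 sqr_ge0.
by move=> /allP/(_ i); rewrite mem_index_enum => /(_ isT); rewrite -expr2 sqrf_eq0 => /eqP.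
Qed.

Lemma dotv_le x y : dotv x y <= euclid_norm x * euclid_norm y.
Proof.
have [x0|x0] := eqVneq (euclid_norm x) 0.
  by rewrite x0 mul0r /dotv big1// => i _; rewrite (euclid_norm_eq0 x0) mul0r.
have [y0|y0] := eqVneq (euclid_norm y) 0.
  by rewrite y0 mulr0 /dotv big1// => i _; rewrite (euclid_norm_eq0 y0) mulr0.
have xp : 0 < euclid_norm x by rewrite lt_neqAle eq_sym x0 euclid_norm_ge0.
have yp : 0 < euclid_norm y by rewrite lt_neqAle eq_sym y0 euclid_norm_ge0.
set a := euclid_norm x in xp *; set b := euclid_norm y in yp *.
have := dotvv_ge0 (b *: x + (- a) *: y).
rewrite dotvD !dotvZ !(dotvC _ x) !(dotvC _ y) !dotvD !dotvZ -!sqr_euclid_norm (dotvC y x) -/a -/b.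
by have := mulr_gt0 xp yp; nra.
Qed.

Lemma euclid_normD x y : euclid_norm (x + y) <= euclid_norm x + euclid_norm y.
Proof.
rewrite -(@ler_sqr _ (euclid_norm (x + y))) ?nnegrE ?addr_ge0 ?euclid_norm_ge0//.
rewrite sqr_euclid_norm dotvD !(dotvC (x + y)) !dotvD (dotvC y x) sqrrD !sqr_euclid_norm.
by have := dotv_le x y; rewrite -mulr_natl; lra.
Qed.

Lemma euclid_dist_metric : metric_axioms (@euclid_dist R d).
Proof.
split=> [x|x y|x y z]; rewrite /euclid_dist.
- by rewrite subrr /euclid_norm /dotv big1 ?sqrtr0// => i _; rewrite mxE mul0r.
- by rewrite -euclid_normN opprB.
- by rewrite -[X in euclid_norm X](subrKA y) euclid_normD.
Qed.

Lemma euclid_le_coord x (r : R) : (0 < d)%N -> (forall i, `|x 0 i| <= r / d%:R) ->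
  euclid_norm x <= r.
Proof.
move=> d0 xr.
have dR : 1 <= d%:R :> R by rewrite ler1n.
have rd0 : 0 <= r / d%:R by exact: le_trans (xr (Ordinal d0)).
have r0 : 0 <= r by rewrite -(divfK (lt0r_neq0 (lt_le_trans ltr01 dR)) r) mulr_ge0// (le_trans ler01).
rewrite -(ger0_norm r0) -sqrtr_sqr ler_wsqrtr//.
apply: (@le_trans _ _ (\sum_(i < d) (r / d%:R) ^+ 2)).
  by apply: ler_sum => i _; rewrite -expr2 -(real_normK (num_real (x 0 i))) ler_sqr ?nnegrE.
rewrite sumr_const card_ord -[leLHS]mulr_natl expr_div_n.
rewrite mulrA ler_pdivrMr ?exprn_gt0// ?(lt_le_trans ltr01)//.
by have := sqr_ge0 r; nra.
Qed.

Lemma euclid_norm_delta (s : R) (c : 'I_d) : 0 <= s ->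
  euclid_norm (s *: delta_mx 0 c : 'rV[R]_d) = s.
Proof.
move=> s0; rewrite /euclid_norm /dotv (bigD1 c)//= big1 ?addr0.
  by rewrite !mxE !eqxx mulr1 -expr2 sqrtr_sqr ger0_norm.
by move=> i ic; rewrite !mxE eqxx (negbTE ic) mulr0 mul0r.
Qed.

End Euclid.

Lemma real_dist_metric (R : realType) : metric_axioms (@real_dist R).
Proof.
split=> [x|x y|x y z]; rewrite /real_dist.
- by rewrite subrr normr0.
- by rewrite distrC.
- exact: ler_distD.
Qed.

(** A common form of the two cases of (B3). Since tau >= 1, exponents can be weakened freely, so
    every eps > 0 is allowed, even beyond 2 - alpha. *)
Definition growth (R : realType) (d : nat) (psi : 'rV[R]_d -> R) (alpha eps K tau : R) :=
  [/\ 1 <= K, 1 <= tau & forall xi, tau <= euclid_norm xi ->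
    K^-1 * euclid_norm xi `^ (alpha - eps) <= psi xi <= K * euclid_norm xi `^ (alpha + eps)].

Lemma condition_B3_growth (R : realType) (d : nat) (psi : 'rV[R]_d -> R) (alpha : R) :
  0 < alpha <= 2 -> condition_B3 psi alpha ->
  forall eps, 0 < eps -> exists K tau, growth psi alpha eps K tau.
Proof.
move=> /andP[a0 a2] [h1 h2] eps e0.
have mono (xi : 'rV[R]_d) a b : 1 <= euclid_norm xi -> a <= b ->
    euclid_norm xi `^ a <= euclid_norm xi `^ b.
  by move=> x1 ab; exact: ler_powR.
have [a2'|a2'] := eqVneq alpha 2.
  have z : 0 < Num.min eps 1 < 2 by rewrite lt_min e0 ltr01/= gt_min ltr1n orbT.
  have [K [tau [K1 t0 hK]]] := h2 a2' _ z.
  exists K, (Num.max tau 1); split=> //; first by rewrite le_max lexx orbT.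
  move=> xi; rewrite ge_max => /andP[/hK [lo up] x1].
  have K0 : 0 <= K^-1 by rewrite invr_ge0 (le_trans ler01).
  have K0' : 0 <= K by rewrite (le_trans ler01).
  apply/andP; split.
    apply: le_trans lo; rewrite ler_wpM2l// mono// a2' lerB// ge_min lexx//.
  by apply: le_trans up _; rewrite ler_wpM2l// mono// a2' lerDl ltW.
have a2n : alpha < 2 by rewrite lt_neqAle a2'.
have z : 0 < Num.min eps ((2 - alpha) / 2) < 2 - alpha.
  rewrite lt_min e0 divr_gt0 ?subr_gt0//= gt_min ltr_pdivrMr// ltr_pMr ?subr_gt0//.
  by rewrite ltr1n orbT.
have a02 : 0 < alpha < 2 by rewrite a0.
have [K [tau [K1 t0 hK]]] := h1 a02 _ z.
exists K, (Num.max tau 1); split=> //; first by rewrite le_max lexx orbT.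
move=> xi; rewrite ge_max => /andP[/hK [lo up] x1].
have K0 : 0 <= K^-1 by rewrite invr_ge0 (le_trans ler01).
have K0' : 0 <= K by rewrite (le_trans ler01).
apply/andP; split.
  by apply: le_trans lo; rewrite ler_wpM2l// mono// lerB// ge_min lexx.
by apply: le_trans up _; rewrite ler_wpM2l// mono// lerD2l ge_min lexx.
Qed.

Lemma condition_B4_B3 (R : realType) (d : nat) (psi : 'rV[R]_d -> R) (alpha : R) :
  condition_B4 psi alpha -> condition_B3 psi alpha.
Proof.
move=> [h1 h2]; split=> [a zeta z|a zeta z].
  by have [K [tau [? ? ? _]]] := h1 a _ z; exists K, tau.
by have [K [tau [? ? ? _]]] := h2 a _ z; exists K, tau.
Qed.

(** * Power sums over lattice points *)

Section LatticeSums.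
Variable R : realType.
Implicit Types (k x y : R) (n i j : nat).

(** The tangent at 1 of a concave power, obtained from Young's inequality with exponents 1/t and
    1/(1 - t). *)
Lemma powR_le_tangent t y : 0 < t < 1 -> 0 <= y -> y `^ t <= t * y + (1 - t).
Proof.
move=> /andP[t0 t1] y0.
have u0 : 0 < 1 - t by rewrite subr_gt0.
have := @conjugate_powR R (y `^ t) 1 t^-1 (1 - t)^-1 (powR_ge0 _ _) ler01.
rewrite !invr_gt0 => /(_ t0 u0); rewrite !invrK => /(_ _)/le_trans.
rewrite mulr1 addrC subrK => h; apply: h (erefl _) _.
by rewrite -powRrM divff ?gt_eqF// powRr1// powR1 mul1r (mulrC t) lerD2l.
Qed.

(** The maximum gives diagonal terms the value 1, where the bare power would be 0. *)
Definition decay k x : R := (Num.max 1 `|x|) `^ (- k).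

Lemma decay_ge0 k x : 0 <= decay k x.
Proof. exact: powR_ge0. Qed.

(** A discrete integral comparison: by the tangent inequality (n+1)^(1-k) - n^(1-k) >= (1-k)
    (n+1)^(-k), and passing from n+1 to n costs the factor 2. *)
Lemma sum_decay k n : 0 < k < 1 ->
  \sum_(s < n) decay k s%:R <= 2 / (1 - k) * n%:R `^ (1 - k).
Proof.
move=> /andP[k0 k1]; have u0 : 0 < 1 - k by rewrite subr_gt0.
have C0 : 0 < 2 / (1 - k) by rewrite divr_gt0.
elim: n => [|n IH]; first by rewrite big_ord0 mulr_ge0 ?powR_ge0// ltW.
rewrite big_ord_recr/=; apply: le_trans (lerD IH (lexx _)) _.
have [->|n0] := eqVneq n 0%N.
  rewrite powR0 ?gt_eqF// mulr0 add0r powR1 mulr1 /decay normr0.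
  rewrite max_l ?ler01// powR1 ler_pdivlMr//; lra.
have n1 : 1 <= n%:R :> R by rewrite ler1n lt0n.
have np : 0 < n.+1%:R :> R by [].
have dn : decay k n%:R = n%:R `^ (- k).
  by rewrite /decay ger0_norm// max_r.
have tan := @powR_le_tangent (1 - k) (n%:R / n.+1%:R) _ _.
have {}tan : n%:R `^ (1 - k) <=
    n.+1%:R `^ (1 - k) * ((1 - k) * (n%:R / n.+1%:R) + k).
  have -> : n%:R `^ (1 - k) = n.+1%:R `^ (1 - k) * (n%:R / n.+1%:R) `^ (1 - k).
    rewrite -powRM ?divr_ge0//; congr (_ `^ _).
    by rewrite mulrC divfK// gt_eqF.
  rewrite ler_wpM2l ?powR_ge0//; apply: le_trans (tan _ _) _.
  - by apply/andP; split; lra.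
  - by rewrite divr_ge0.
  - by rewrite lerD2l; lra.
have step : 2^-1 * n%:R `^ (- k) <= n.+1%:R `^ (1 - k) / n.+1%:R.
  have -> : n.+1%:R `^ (1 - k) / n.+1%:R = n.+1%:R `^ (- k).
    rewrite powRD ?gt_eqF ?implybT// powRr1// mulrAC divff ?mul1r// gt_eqF//.
  apply: (@le_trans _ _ ((2 * n%:R) `^ (- k))); last first.
    rewrite !powRN lef_pV2 ?posrE ?powR_gt0// ?mulr_gt0// ?(lt_le_trans ltr01)//.
    apply: (ge0_ler_powR (ltW k0)); rewrite ?nnegrE ?mulr_ge0//.
    by rewrite -natr1; lra.
  rewrite powRM// ler_wpM2r ?powR_ge0//.
  rewrite powRN lef_pV2 ?posrE ?powR_gt0//.
  by rewrite -[leRHS]powRr1//; apply: ler_pow2; exact: ltW.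
have e : n.+1%:R `^ (1 - k) * ((1 - k) * (n%:R / n.+1%:R) + k) =
  n.+1%:R `^ (1 - k) - (1 - k) * (n.+1%:R `^ (1 - k) / n.+1%:R).
  have -> : n%:R = n.+1%:R - 1 :> R by rewrite -natr1 addrK.
  by field; rewrite gt_eqF.
have c2 z : (1 - k) * (2 / (1 - k) * z) = 2 * z by field; rewrite gt_eqF.
rewrite dn -(ler_pM2l u0) mulrDr !c2.
have := ler_wpM2l (ltW u0) step.
move: tan; rewrite e; move: (_ / n.+1%:R) => B; move: (n.+1%:R `^ _) (n%:R `^ (1 - k)) (n%:R `^ (- k)).
by move=> A C D; lra.
Qed.

Lemma sum_decay_row k n i : 0 < k < 1 -> (i < n)%N ->
  \sum_(j < n) decay k (i%:R - j%:R) <= 4 / (1 - k) * n%:R `^ (1 - k).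
Proof.
move=> hk ilt; rewrite (bigID (fun j : 'I_n => (j <= i)%N))/=.
have -> : 4 / (1 - k) * n%:R `^ (1 - k) =
  2 / (1 - k) * n%:R `^ (1 - k) + 2 / (1 - k) * n%:R `^ (1 - k) :> R.
  by rewrite -!mulrA; lra.
have d0 s : 0 <= decay k s%:R by exact: decay_ge0.
apply: lerD; apply: le_trans (sum_decay _ hk).
- rewrite -(big_mkord (fun j => j <= i)%N (fun j => decay k (i%:R - j%:R))) -big_filter.
  rewrite big_seq_cond (eq_bigr (fun j => decay k (i - j)%:R)); last first.
    by move=> j; rewrite mem_filter => /andP[/andP[ji _] _]; rewrite natrB.
  rewrite -big_seq_cond -(big_map (fun j => i - j)%N xpredT (fun s => decay k s%:R)).
  apply: (sum_uniq_le (q := fun s => decay k s%:R)) => //.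
    rewrite map_inj_in_uniq ?filter_uniq ?iota_uniq//.
    by move=> a b; rewrite !mem_filter => /andP[ai _] /andP[bi _]; lia.
  by apply/allP => s /mapP[j _ ->]; rewrite (leq_ltn_trans (leq_subr _ _)).
- rewrite -(big_mkord (fun j => ~~ (j <= i)%N) (fun j => decay k (i%:R - j%:R))) -big_filter.
  rewrite big_seq_cond (eq_bigr (fun j => decay k (j - i)%:R)); last first.
    move=> j; rewrite mem_filter -ltnNge => /andP[/andP[ji _] _].
    by rewrite natrB ?(ltnW ji)// /decay distrC.
  rewrite -big_seq_cond -(big_map (fun j => j - i)%N xpredT (fun s => decay k s%:R)).
  apply: (sum_uniq_le (q := fun s => decay k s%:R)) => //.
    rewrite map_inj_in_uniq ?filter_uniq ?iota_uniq//.
    by move=> a b; rewrite !mem_filter -!ltnNge => /andP[ai _] /andP[bi _]; lia.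
  apply/allP => s /mapP[j]; rewrite mem_filter mem_index_iota => /andP[_ /andP[_ jn]] ->.
  by rewrite (leq_ltn_trans (leq_subr _ _)).
Qed.

Lemma sum_lattice k n d : 0 < k < 1 ->
  \sum_(f : {ffun 'I_d -> 'I_n}) \sum_(g : {ffun 'I_d -> 'I_n})
    \prod_(c < d) decay k ((f c)%:R - (g c)%:R)
  <= (n ^ d)%:R * (4 / (1 - k) * n%:R `^ (1 - k)) ^+ d.
Proof.
move=> hk.
apply: (@le_trans _ _ (\sum_(f : {ffun 'I_d -> 'I_n}) (4 / (1 - k) * n%:R `^ (1 - k)) ^+ d)).
  apply: ler_sum => f _.
  (* The summand is a product over coordinates, so the sum over [g] is a product of d
     one-dimensional sums. *)
  rewrite -(bigA_distr_bigA (fun (c : 'I_d) (j : 'I_n) => decay k ((f c)%:R - j%:R))).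
  rewrite -[X in _ ^+ X]card_ord -prodr_const; apply: ler_prod => c _.
  rewrite sumr_ge0 => [|j _]; last exact: decay_ge0.
  by apply: sum_decay_row.
by rewrite sumr_const card_ffun !card_ord -[leLHS]mulr_natl.
Qed.

(** With y = exp(-x) the sum is at most y / (1 - y), and y (1 + x) <= 1 rearranges to y / (1 - y) <=
    1 / x. *)
Lemma sum_expR_le x H : 0 < x -> \sum_(i < H) expR (- (i.+1%:R * x)) <= x^-1.
Proof.
move=> x0; pose y := expR (- x).
have y0 : 0 < y by exact: expR_gt0.
have y1 : y * (1 + x) <= 1.
  rewrite /y expRN mulrC ler_pdivrMr ?expR_gt0// mul1r; exact: expR_ge1Dx.
have e i : expR (- (i.+1%:R * x)) = y ^+ i.+1.
  by rewrite /y -expRM_natl mulrN.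
under eq_bigr do rewrite e.
have tel : (1 - y) * \sum_(i < H) y ^+ i.+1 = y - y ^+ H.+1.
  elim: (H) => [|m IH]; first by rewrite big_ord0 mulr0 expr1 subrr.
  by rewrite big_ord_recr/= mulrDr IH !exprS; ring.
rewrite -[leRHS]mul1r ler_pdivlMr//.
have S0 : 0 <= \sum_(i < H) y ^+ i.+1 by apply: sumr_ge0 => i _; rewrite exprn_ge0// ltW.
have yH : 0 <= y ^+ H.+1 by rewrite exprn_ge0// ltW.
have : y * x <= 1 - y by lra.
move=> yx; rewrite -(ler_pM2r y0) mul1r.
apply: (@le_trans _ _ ((1 - y) * \sum_(i < H) y ^+ i.+1)); last by rewrite tel; lra.
by nra.
Qed.

End LatticeSums.

Lemma prob_cover_le (disp : measure_display) (T : measurableType disp)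
    (R : realType) (P : probability T R) (I : finType) (A : I -> set T)
    (B : set T) (c : R) : (forall i, measurable (A i)) -> measurable B ->
  (forall w, B w -> exists i, A i w) -> (forall i, (P (A i) <= c%:E)%E) ->
  (P B <= (#|I|%:R * c)%:E)%E.
Proof.
move=> mA mB BA PA; pose U := fun s : seq I => \big[setU/set0]_(i <- s) A i.
have mU s : measurable (U s) by apply: bigsetU_measurable.
apply: (@le_trans _ _ (P (U (enum I)))).
  apply: le_measure; rewrite ?inE// => w /BA[i Ai].
  by rewrite /U -bigcup_seq; exists i => //=; rewrite mem_enum.
rewrite cardE; elim: (enum I) => [|i s IH].
  by rewrite /U big_nil measure0 mul0r.
rewrite {1}/U big_cons; apply: le_trans (measureU2 _ (mA i) (mU s)) _.
by rewrite /= -natr1 mulrDl mul1r addrC EFinD; exact: leeD.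
Qed.

(** * Tail and occupation estimates from the growth of the exponent *)

Section LevyEstimates.
Context {disp : measure_display} {T : measurableType disp} {R : realType}.
Variables (P : probability T R) (d : nat) (X : R -> T -> 'rV[R]_d).
Variables (psi : 'rV[R]_d -> R) (alpha eps K tau : R).
Hypothesis levyX : levy_process P X.
Hypothesis psiX : char_exponent P X (fun xi => (psi xi)%:C%C).
Hypothesis d0 : (0 < d)%N.
Hypothesis psi_growth : growth psi alpha eps K tau.

Lemma levy_char xi t : 0 <= t ->
  \int[P]_w cos (dotv xi (X t w)) = expR (- (t * psi xi)) /\
  \int[P]_w sin (dotv xi (X t w)) = 0.
Proof.
move=> /(psiX xi); rewrite /char_fun /cexp -rmorphM -rmorphN /= => -[-> ->].
by rewrite ?oppr0 cos0 sin0 mulr1 mulr0.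
Qed.

Lemma psi_ge0 xi : 0 <= psi xi.
Proof.
have [h _] := levy_char xi ler01.
rewrite -oppr_le0 -[leRHS](@ln1 R) -(expRK (- psi xi)) ler_ln ?posrE ?expR_gt0//.
rewrite -[psi xi]mul1r -h.
have icos := integrable_cos P (levy_coord_random levyX ler01) xi.
have i1 : P.-integrable [set: T] (EFin \o (fun=> 1 : R)).
  by apply: (@bounded_integrable _ _ _ _ _ 1) => // w; rewrite normr1.
rewrite [leRHS](_ : _ = \int[P]_w (1 : R)); last first.
  by rewrite Rintegral_cst// mul1r; apply/esym; exact: (congr1 fine (probability_setT P)).
by apply: le_Rintegral => // w _; exact: cos_le1.
Qed.

Lemma levy_tail : exists C lam0 : R, [/\ 0 < C, 0 < lam0 &
  forall t lam, 0 <= t -> 0 < lam <= lam0 ->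
    (P [set w | (lam < euclid_norm (X t w))%R] <=
      (C * t * lam `^ (- (alpha + eps)))%:E)%E].
Proof.
have [K1 t1 gr] := psi_growth.
have dR : 0 < d%:R :> R by rewrite ltr0n.
have t0 : 0 < tau := lt_le_trans ltr01 t1.
have K0 : 0 < K := lt_le_trans ltr01 K1.
pose b := alpha + eps.
(* For frequencies in [u, 2u] the power of exponent [b] is largest at 2u if b >= 0 and at u
   otherwise. *)
pose M := Num.max ((16 * d%:R) `^ b) ((8 * d%:R) `^ b).
have M0 : 0 < M by rewrite lt_max powR_gt0// mulr_gt0.
exists (d%:R * (2 * K * M)), (8 * d%:R / tau); split.
- by rewrite !mulr_gt0.
- by rewrite divr_gt0// mulr_gt0.
move=> t lam t_ge0 /andP[l0 ltau].
have mX := levy_coord_random levyX t_ge0.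
(* Chosen so that 8 / u = lam / d: a norm above [lam] forces some coordinate above lam / d. The
   bound on [lam] keeps [u] above [tau]. *)
pose u := 8 * d%:R / lam.
have u0 : 0 < u by rewrite divr_gt0// mulr_gt0.
have utau : tau <= u.
  by rewrite /u ler_pdivlMr// mulrC -ler_pdivlMr.
have ul : 8 / u = lam / d%:R.
  by rewrite /u; field; rewrite !gt_eqF.
have lamV x : 0 <= x -> (x / lam) `^ b = x `^ b * lam `^ (- b).
  by move=> x0; rewrite powRM ?invr_ge0 ?(ltW l0)// -(powR_inv1 (ltW l0)) -powRrM mulN1r.
pose A (c : 'I_d) := [set w | 8 / u <= `|X t w 0 c|].
have mA c : measurable (A c).
  rewrite -[X in measurable X]setTI; apply: measurable_fun_le => //.
  exact: (measurableT_comp (@normr_measurable R setT)).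
have PA c : (P (A c) <= (2 * K * M * t * lam `^ (- b))%:E)%E.
  apply: le_trans (tail_bound mX (fun xi => proj1 (levy_char xi t_ge0)) (u := u)
    (D := K * M * t * lam `^ (- b)) _ _) _ => //; last first.
    by rewrite lee_fin -!mulrA.
  move=> s /andP[us su].
  have s0 : 0 < s := lt_le_trans u0 us.
  apply: (@le_trans _ _ (t * psi (s *: delta_mx 0 c))).
    by have := expR_ge1Dx (- (t * psi (s *: delta_mx 0 c))); lra.
  rewrite mulrAC (mulrC _ t) ler_wpM2l//.
  have := gr (s *: delta_mx 0 c); rewrite euclid_norm_delta ?(ltW s0)//.
  move=> /(_ (le_trans utau us))/andP[_ /le_trans]; apply.
  rewrite -mulrA ler_wpM2l ?(ltW K0)// /M.
  have [b0|b0] := leP 0 b.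
    apply: (@le_trans _ _ ((16 * d%:R / lam) `^ b)).
      apply: (ge0_ler_powR b0); rewrite ?nnegrE ?divr_ge0 ?mulr_ge0 ?(ltW l0) ?(ltW s0)//.
      by apply: le_trans su _; rewrite /u; lra.
    rewrite lamV ?mulr_ge0//.
    by rewrite ler_wpM2r ?powR_ge0// le_max lexx.
  apply: (@le_trans _ _ ((8 * d%:R / lam) `^ b)).
    have powN x : x `^ b = (x `^ (- b))^-1 by rewrite -powRN opprK.
    rewrite (powN s) (powN (8 * _ / _)) lef_pV2 ?posrE ?powR_gt0//.
    apply: (ge0_ler_powR (_ : 0 <= - b)); rewrite ?nnegrE ?(ltW u0) ?(ltW s0)//.
    by rewrite oppr_ge0 ltW.
  rewrite lamV ?mulr_ge0//.
  by rewrite ler_wpM2r ?powR_ge0// le_max lexx orbT.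
have mB : measurable [set w | lam < euclid_norm (X t w)].
  exact: (coord_random_preimage mX (@measurable_euclid_gt R d lam)).
rewrite (_ : d%:R * (2 * K * M) * t * lam `^ (- (alpha + eps)) =
    #|'I_d|%:R * (2 * K * M * t * lam `^ (- b))); last first.
  by rewrite card_ord /b; ring.
apply: (prob_cover_le mA) => // w /= lw; apply: contrapT => nA.
have : euclid_norm (X t w) <= lam.
  apply: euclid_le_coord => // c; rewrite leNgt; apply/negP => hc.
  by apply: nA; exists c; rewrite /A/= ul ltW.
by rewrite leNgt lw.
Qed.

(** A discretised potential kernel. At high frequency the geometric sum is at most 1 / (h psi(xi)),
    of order |xi|^(-(alpha - eps)) / h; below tau the trivial bound H <= N / h is enough. *)
Lemma kernel_sum_le (N : nat) (h : R) (H : nat) (xi : 'rV[R]_d) :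
  0 < eps < alpha -> 0 < h -> H%:R * h <= N%:R ->
  (forall c, exists z : int, xi 0 c = z%:~R) ->
  \sum_(i < H) expR (- (i.+1%:R * h * psi xi)) <=
  (K + N%:R * tau `^ (alpha - eps)) / h *
    \prod_(c < d) decay ((alpha - eps) / d%:R) (xi 0 c).
Proof.
move=> /andP[e0 ea] h0 HN xiz; have [K1 t1 gr] := psi_growth.
have dR : 0 < d%:R :> R by rewrite ltr0n.
have K0 : 0 < K := lt_le_trans ltr01 K1.
pose a := alpha - eps; have a0 : 0 < a by rewrite subr_gt0.
have k0 : 0 <= a / d%:R by rewrite divr_ge0 ?ltW.
have Nt : 0 <= N%:R * tau `^ a by rewrite mulr_ge0 ?powR_ge0.
(* A radial power is shared among the coordinates, d factors of exponent a / d each, so that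
   [sum_lattice] applies. *)
have prodge (M : R) : 1 <= M -> (forall c, Num.max 1 `|xi 0 c| <= M) ->
    M `^ (- a) <= \prod_(c < d) decay (a / d%:R) (xi 0 c).
  move=> M1 hM; have M0 := lt_le_trans ltr01 M1.
  have -> : M `^ (- a) = \prod_(c < d) M `^ (- (a / d%:R)).
    by rewrite prodr_const card_ord -powR_mulrn ?powR_ge0// -powRrM mulNr divfK ?gt_eqF.
  apply: ler_prod => c _; rewrite powR_ge0/= /decay.
  have m0 : 0 < Num.max 1 `|xi 0 c| by rewrite lt_max ltr01.
  rewrite !powRN lef_pV2 ?posrE ?powR_gt0//.
  by apply: (ge0_ler_powR k0); rewrite ?nnegrE ?(ltW m0) ?(ltW M0)//.
have pr0 : 0 <= \prod_(c < d) decay (a / d%:R) (xi 0 c).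
  by apply: prodr_ge0 => c _; exact: decay_ge0.
rewrite -/a; set p := \prod_(c < d) _ in pr0 prodge *.
have [xt|xt] := leP tau (euclid_norm xi).
- have /andP[lo _] := gr _ xt; have x1 := le_trans t1 xt.
  have x0 : 0 < euclid_norm xi := lt_le_trans ltr01 x1.
  have psi0 : 0 < psi xi.
    by apply: lt_le_trans lo; rewrite mulr_gt0 ?invr_gt0 ?powR_gt0.
  apply: (@le_trans _ _ ((h * psi xi)^-1)).
    under eq_bigr do rewrite -mulrA.
    by apply: sum_expR_le; rewrite mulr_gt0.
  apply: (@le_trans _ _ (K / h * euclid_norm xi `^ (- a))).
    rewrite invfM (mulrC K) -mulrA ler_wpM2l ?invr_ge0 ?(ltW h0)//.
    rewrite powRN -[K]invrK -invfM lef_pV2 ?posrE ?mulr_gt0 ?invr_gt0 ?powR_gt0//.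
  apply: ler_pM; rewrite ?powR_ge0 ?divr_ge0 ?(ltW K0) ?(ltW h0)//.
    by rewrite ler_wpM2r ?invr_ge0 ?(ltW h0)// lerDl.
  by apply: prodge => // c; rewrite ge_max x1 coord_le_euclid.
- apply: (@le_trans _ _ H%:R).
    rewrite -[leRHS]mulr1 -[X in X%:R]card_ord mulr_natl -sumr_const ler_sum// => i _.
    rewrite -(expR0 R) ler_expR oppr_le0 !mulr_ge0 ?psi_ge0//; exact: ltW.
  apply: (@le_trans _ _ (N%:R / h)); first by rewrite ler_pdivlMr.
  have tp : tau `^ (- a) <= p.
    by apply: prodge => // c; rewrite ge_max t1 (le_trans (coord_le_euclid _ _)) ?ltW.
  apply: (@le_trans _ _ (N%:R * tau `^ a / h * tau `^ (- a))).
    rewrite le_eqVlt; apply/orP; left; apply/eqP; rewrite powRN; field.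
    by rewrite !gt_eqF// powR_gt0// (lt_le_trans ltr01).
  apply: ler_pM; rewrite ?powR_ge0 ?divr_ge0 ?(ltW h0)//.
  by rewrite ler_wpM2r ?invr_ge0 ?(ltW h0)// lerDr ltW.
Qed.

(** [small_ball_bound] with n of order 1 / (d rho), summed over time: n^(-2d) n^d (n^(1 - a/d))^d =
    n^(-a), where a = alpha - eps. Here a / d < 1 even if alpha = d, so the lattice sum is a power,
    without a logarithm. *)
Lemma levy_occupation (N : nat) : 0 < eps < alpha -> alpha <= d%:R ->
  exists C : R, 0 < C /\ forall rho h H, 0 < rho <= d%:R^-1 -> 0 < h ->
    H%:R * h <= N%:R ->
    exists q : nat -> R, [/\ forall i, 0 <= q i,
      forall i y, (P [set w | (euclid_norm (X (i%:R * h) w + y) <= rho)%R] <= (q i)%:E)%E &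
      \sum_(i < H) q i.+1 <= C * rho `^ (alpha - eps) / h].
Proof.
move=> ea ad; have /andP[e0 ea'] := ea; have [K1 t1 gr] := psi_growth.
have dR : 0 < d%:R :> R by rewrite ltr0n.
have K0 : 0 < K := lt_le_trans ltr01 K1.
pose a := alpha - eps; have a0 : 0 < a by rewrite subr_gt0.
have k01 : 0 < a / d%:R < 1.
  by rewrite divr_gt0//= ltr_pdivrMr// mul1r /a; lra.
pose C1 := K + N%:R * tau `^ a.
have C10 : 0 < C1 by rewrite ltr_pwDl// mulr_ge0 ?powR_ge0.
pose C2 := 4 / (1 - a / d%:R).
have C20 : 0 < C2 by rewrite divr_gt0// subr_gt0; case/andP: k01.
have C20d : 0 < C2 ^+ d by rewrite exprn_gt0.
pose C3 := 4 * C1 * C2 ^+ d.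
have C30 : 0 < C3 by rewrite !mulr_gt0.
exists (C3 * (2 * d%:R) `^ a); split; first by rewrite mulr_gt0// powR_gt0// mulr_gt0.
move=> rho h H /andP[r0 rd] h0 HN.
have dr0 : 0 < d%:R * rho by rewrite mulr_gt0.
have dr1 : 1 <= (d%:R * rho)^-1.
  by rewrite invf_ge1// mulrC -ler_pdivlMr// mul1r.
pose n := Num.trunc (d%:R * rho)^-1.
have n0 : (0 < n)%N by rewrite truncn_gt0.
have nR : 0 < n%:R :> R by rewrite ltr0n.
have n1 : 1 <= n%:R :> R by rewrite ler1n.
have nle : n%:R <= (d%:R * rho)^-1 by rewrite truncn_le invr_ge0 ltW.
have nge : (d%:R * rho)^-1 <= 2 * n%:R.
  apply: (@le_trans _ _ n.+1%:R); first exact/ltW/truncnS_gt.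
  by rewrite -natr1; lra.
have rn : rho <= (d * n)%:R^-1.
  rewrite natrM -[leLHS]invrK lef_pV2 ?posrE ?mulr_gt0 ?invr_gt0//.
  rewrite -ler_pdivlMl//; apply: le_trans nle _.
  by rewrite invfM mulrC.
pose q i := 4 * (n ^ (2 * d))%:R^-1 *
   \sum_(k : {ffun 'I_d -> 'I_n}) \sum_(l : {ffun 'I_d -> 'I_n})
        expR (- (i%:R * h * psi (grid_point k - grid_point l))).
have n2d : 0 < (n ^ (2 * d))%:R :> R by rewrite ltr0n expn_gt0 n0.
exists q; split.
- move=> i; rewrite !mulr_ge0 ?invr_ge0//; apply: sumr_ge0 => k _.
  by apply: sumr_ge0 => l _; exact: expR_ge0.
- move=> i y; have ih0 : 0 <= i%:R * h by rewrite mulr_ge0// ltW.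
  have mX := levy_coord_random levyX ih0.
  apply: (@le_trans _ _ (P [set w | (euclid_norm (X (i%:R * h) w + y) <= (d * n)%:R^-1)%R])).
    apply: le_measure; rewrite ?inE.
    + exact: (coord_random_preimage mX (measurable_euclid_ball y _)).
    + exact: (coord_random_preimage mX (measurable_euclid_ball y _)).
    + by move=> w /= hw; apply: le_trans hw rn.
  apply: le_trans (small_ball_bound mX (fun xi => proj1 (levy_char xi ih0))
    (fun xi => proj2 (levy_char xi ih0)) y d0 n0) _.
  rewrite lee_fin le_eqVlt; apply/orP; left; apply/eqP; rewrite /q; congr (_ * _).
  by apply: eq_bigr => k _; apply: eq_bigr => l _; rewrite ger0_norm// expR_ge0.
rewrite /q -mulr_sumr exchange_big/=; under eq_bigr do rewrite exchange_big/=.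
apply: (@le_trans _ _ (4 * (n ^ (2 * d))%:R^-1 * (C1 / h *
   ((n ^ d)%:R * (C2 * n%:R `^ (1 - a / d%:R)) ^+ d)))).
  rewrite ler_wpM2l ?mulr_ge0 ?invr_ge0//.
  apply: (@le_trans _ _ (C1 / h * \sum_(k : {ffun 'I_d -> 'I_n}) \sum_(l : {ffun 'I_d -> 'I_n})
    \prod_(c < d) decay (a / d%:R) ((k c)%:R - (l c)%:R))); last first.
    by rewrite ler_wpM2l ?divr_ge0 ?(ltW C10) ?(ltW h0)//; exact: sum_lattice.
  rewrite mulr_sumr; apply: ler_sum => k _; rewrite mulr_sumr; apply: ler_sum => l _.
  apply: le_trans (kernel_sum_le ea h0 HN _) _.
    move=> c; exists ((k c)%:Z - (l c)%:Z); rewrite !mxE rmorphB/=.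
    by [].
  rewrite -/a -/C1 le_eqVlt; apply/orP; left; apply/eqP; congr (_ * _).
  by apply: eq_bigr => c _; rewrite !mxE.
have E : (n%:R `^ (1 - a / d%:R)) ^+ d = n%:R ^+ d * n%:R `^ (- a) :> R.
  rewrite -powR_mulrn ?powR_ge0// -powRrM mulrBl mul1r divfK ?gt_eqF//.
  by rewrite powRD ?(gt_eqF nR) ?implybT// powR_mulrn.
have nn : 0 < n%:R ^+ d :> R by rewrite exprn_gt0.
apply: (@le_trans _ _ (C3 * n%:R `^ (- a) / h)).
  rewrite le_eqVlt; apply/orP; left; apply/eqP.
  rewrite exprMn E mulnC expnM !natrX expr2 /C3; field.
  by rewrite !gt_eqF.
rewrite ler_wpM2r ?invr_ge0 ?(ltW h0)// -(mulrA C3) ler_wpM2l ?(ltW C30)//.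
have r2 : 0 < 2 * d%:R * rho by rewrite !mulr_gt0.
rewrite -powRM ?mulr_ge0 ?(ltW r0)// powRN.
rewrite -[leRHS]invrK lef_pV2 ?posrE ?invr_gt0 ?powR_gt0//.
rewrite -powRN -mulN1r powRrM powR_inv1 ?(ltW r2)//.
apply: (ge0_ler_powR (ltW a0)); rewrite ?nnegrE ?invr_ge0 ?(ltW r2)//.
rewrite (_ : (2 * d%:R * rho)^-1 = (d%:R * rho)^-1 / 2); last first.
  by field; rewrite !gt_eqF.
by rewrite ler_pdivrMr// [leRHS]mulrC.
Qed.

End LevyEstimates.

(** Balls around a lattice of mesh rho / d, made disjoint in order. An index that encodes no lattice
    point gets the centre 0, which making disjoint renders harmless. *)
Lemma euclid_cells (R : realType) (d : nat) (rho : R) : (0 < d)%N -> 0 < rho ->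
  exists (Q : nat -> set 'rV[R]_d) (c : nat -> 'rV[R]_d),
  [/\ forall z, (@coord_gen R d).-sigma.-measurable (Q z), trivIset setT Q,
      \bigcup_z Q z = setT & forall z x, Q z x -> euclid_norm (x - c z) <= rho].
Proof.
move=> d0 r0; have dR : 0 < d%:R :> R by rewrite ltr0n.
pose pt (f : {ffun 'I_d -> int}) : 'rV[R]_d := \row_i ((f i)%:~R * (rho / d%:R)).
pose c z := oapp pt 0 (unpickle z).
pose F z := [set x : 'rV[R]_d | euclid_norm (x + (- c z)) <= rho].
have mF z : (@coord_gen R d).-sigma.-measurable (F z) by exact: measurable_euclid_ball.
exists (seqDU F), c; split.
- move=> z; apply: measurableD => //; exact: bigsetU_measurable.
- exact: trivIset_seqDU.
- rewrite -seqDU_bigcup_eq; apply/seteqP; split=> // x _.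
  pose f : {ffun 'I_d -> int} := [ffun i => Num.floor (x 0 i / (rho / d%:R))].
  exists (pickle f) => //; rewrite /F/= /c pickleK/=.
  apply: euclid_le_coord => // i; rewrite !mxE ffunE.
  have rd : 0 < rho / d%:R by rewrite divr_gt0.
  set y := x 0 i / (rho / d%:R).
  have -> : x 0 i = y * (rho / d%:R) by rewrite /y divfK// gt_eqF.
  rewrite -mulrBl normrM (ger0_norm (ltW rd)) -[leRHS]mul1r ler_wpM2r ?(ltW rd)//.
  have /andP[a b] := floor_itv y.
  by rewrite ger0_norm; lra.
- by move=> z x [Fx _].
Qed.

Section FewHits.
Context {disp : measure_display} {T : measurableType disp} {R : realType}.
Variables (d : nat) (X : R -> T -> 'rV[R]_d) (h : R) (near bad : set 'rV[R]_d).
Variables (theta : R) (L M H : nat) (w : T).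
Hypothesis theta0 : 0 <= theta.
Hypothesis light : forall j, (j <= M)%N ->
  chain_weight X h near bad theta j (iota j.+1 H) w < (1 + theta) ^+ L.

(** The first element of Z is the starting point of the chain and the others are its hits; L hits
    would contradict lightness, so Z has at most L elements. *)
Lemma few_hits (Z : seq nat) : sorted ltn Z ->
  {in Z, forall j, (j <= M)%N} -> {in Z &, forall i j, (j - i <= H)%N} ->
  {in Z &, forall i j, w \in incr X (tick h i) (tick h j) near} ->
  {in Z, forall j, w \in incr X (tick h j) (tick h j.+1) bad} ->
  (size Z <= L)%N.
Proof.
case: Z => [//|z Z] sZ ZM ZH nZ bZ; rewrite ltnNge; apply/negP => LZ.
have zM : (z <= M)%N by apply: ZM; rewrite inE eqxx.
have sub : {subset Z <= z :: Z} by move=> i iZ; rewrite inE iZ orbT.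
have := light zM; apply/negP; rewrite -leNgt.
apply: le_trans (_ : (1 + theta) ^+ size Z <= _).
  by rewrite ler_weXn2l// lerDl.
apply: chain_weight_hits => //.
- apply/subseq_uniqP; first exact: iota_uniq.
  apply: (irr_sorted_eq ltn_trans ltnn).
  + exact: path_sorted sZ.
  + by apply: sorted_filter; [exact: ltn_trans|exact: iota_ltn_sorted].
  + move=> i; rewrite mem_filter mem_iota; case: (boolP (i \in Z)) => //= iZ.
    have /allP/(_ _ iZ) zi := order_path_min ltn_trans sZ.
    have : (i - z <= H)%N by apply: ZH; [rewrite inE eqxx|exact: sub].
    by rewrite leq_subLR => iH; rewrite zi/= addSn ltnS.
- apply/(pairwiseP 0%N) => i j; rewrite !inE => iZ jZ _.
  by apply/set_mem; apply: nZ; exact: mem_nth.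
- by move=> i iZ; apply: bZ; exact: sub.
Qed.

End FewHits.

Lemma borel_cantelli_pow2 (disp : measure_display) (T : measurableType disp)
    (R : realType) (P : probability T R) (E : nat -> set T) (C c : R) (n0 : nat) :
  0 <= C -> 0 < c -> (forall n, measurable (E n)) ->
  (forall n, (n0 <= n)%N -> (P (E n) <= (C * 2 `^ (- (c * n%:R)))%:E)%E) ->
  {ae P, forall w, exists n1, forall n, (n1 <= n)%N -> ~ E n w}.
Proof.
move=> C0 c0 mE PE; have [K K0 hK] := pow2_summable c0.
pose F n := if (n0 <= n)%N then E n else set0.
have mF n : measurable (F n) by rewrite /F; case: ifP.
have PF n : (P (F n) <= (C * 2 `^ (- (c * n%:R)))%:E)%E.
  rewrite /F; case: ifP => [/PE//|_]; rewrite measure0 lee_fin mulr_ge0// powR_ge0.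
exists (lim_sup_set F); split.
- by apply: bigcap_measurableType => n _; apply: bigcup_measurable => k _.
- apply: lim_sup_set_cvg0 => //.
  apply: (@le_lt_trans _ _ (\sum_(0 <= n <oo) (C * 2 `^ (- (c * n%:R)))%:E)%E).
    by apply: lee_nneseries => [n _ _|n _]; [exact: measure_ge0|exact: PF].
  under eq_eseriesr do rewrite EFinM.
  rewrite nneseriesZl//.
  apply: (@le_lt_trans _ _ (C%:E * K%:E)%E); last by rewrite -EFinM ltry.
  by apply: lee_wpmul2l => //; rewrite lee_fin.
- move=> w /= nw n _; apply: contrapT => nF; apply: nw.
  exists (maxn n0 n) => m; rewrite geq_max => /andP[n0m nm] Em.
  by apply: nF; exists m => //; rewrite /F n0m.
Qed.

Lemma bernoulli_expn (R : realDomainType) (x : R) (k : nat) : 0 <= x ->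
  1 + k%:R * x <= (1 + x) ^+ k.
Proof.
move=> x0; elim: k => [|k IH]; first by rewrite mul0r addr0 expr0.
rewrite exprS -natr1; have k0 : 0 <= k%:R * x by rewrite mulr_ge0.
by nra.
Qed.

(** * Probability of many hits *)

Section LevyCounts.
Context {disp : measure_display} {T : measurableType disp} {R : realType}.
Variables (P : probability T R) (d : nat) (X : R -> T -> 'rV[R]_d).
Variables (psi : 'rV[R]_d -> R) (alpha : R).
Hypothesis levyX : levy_process P X.
Hypothesis psiX : char_exponent P X (fun xi => (psi xi)%:C%C).
Hypotheses (d0 : (0 < d)%N) (alpha0 : 0 < alpha) (alpha_d : alpha <= d%:R).
Hypothesis psi_growth : forall eps, 0 < eps -> exists K tau, growth psi alpha eps K tau.

Local Notation cmeas := ((@coord_gen R d).-sigma.-measurable).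

Definition mesh (m : nat) : R := ((2 ^ m)%:R)^-1.

Lemma mesh_gt0 m : 0 < mesh m.
Proof. by rewrite invr_gt0 ltr0n expn_gt0. Qed.

Lemma meshE m : mesh m = 2 `^ (- m%:R).
Proof. by rewrite powRN pow2_nat. Qed.

Definition norm_gt (r : R) : set 'rV[R]_d := [set x | r < euclid_norm x].
Definition norm_le (r : R) : set 'rV[R]_d := [set x | euclid_norm x <= r].

Lemma measurable_norm_le r : cmeas (norm_le r).
Proof.
rewrite (_ : norm_le r = [set x | euclid_norm (x + 0) <= r]).
  exact: measurable_euclid_ball.
by apply/seteqP; split => x /=; rewrite addr0.
Qed.

Lemma prob_incr_tick h i j B : 0 <= h -> (i <= j)%N -> cmeas B ->
  P (incr X (tick h i) (tick h j) B) = P (X ((j - i)%:R * h) @^-1` B).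
Proof.
move=> h0 ij mB; rewrite (prob_incr levyX) ?tick_ge0 ?tick_le//.
by rewrite /tick -mulrBl natrB.
Qed.

Lemma prob_incr_tick_le1 h i j B : 0 <= h -> cmeas B ->
  (P (incr X (tick h i) (tick h j) B) <= 1)%E.
Proof.
move=> h0 mB; apply: probability_le1.
by apply: (measurable_incr levyX) => //; exact: tick_ge0.
Qed.

Lemma path_iota j H : path ltn j (iota j.+1 H).
Proof. by have := iota_ltn_sorted j H.+1. Qed.

Lemma all_iota_lt j H : all (fun i => i - j.+1 < H)%N (iota j.+1 H).
Proof. by apply/allP => i; rewrite mem_iota => /andP[a b]; lia. Qed.

Definition light_bound (theta : R) (L : nat) : \bar R := (2 / (1 + theta) ^+ L)%:E.

Definition heavy (h : R) (near bad : set 'rV[R]_d) (theta : R) (L j H : nat) : set T :=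
  [set w | (1 + theta) ^+ L <= chain_weight X h near bad theta j (iota j.+1 H) w].

(** Bounds the expected number of successors: the losses zeta / alpha in the tail and zeta (alpha +
    1 / alpha) in the occupation add up. *)
Definition count_weight (C zeta : R) (n : nat) : R :=
  C * 2 `^ (zeta * (alpha + 2 / alpha) * n%:R).

(* The upper bound on psi gives P(jump at level n + l) <= C 2^-l up to
   2^(O(zeta) n), the lower one bounds the expected number of level n + l times
   spent in a ball of radius 2^(-n / alpha) by C 2^l up to the same factor. *)
Lemma heavy_prob (N : nat) (zeta : R) : 0 < zeta -> zeta < alpha -> zeta < alpha^-1 ->
  exists (C : R) n0, 1 <= C /\ forall n, (n0 <= n)%N ->
    let theta := (2 * count_weight C zeta n)^-1 in
    (forall l j L, (0 < l)%N ->
      (P (heavy (mesh (n + l)) setT (norm_gt (scale alpha n)) theta L j (2 ^ l))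
       <= light_bound theta L)%E) /\
    (forall l j L,
      (P (heavy (mesh (n + l)) (norm_le (2 `^ ((zeta - alpha^-1) * n%:R)))
          (if l == 0%N then setT else norm_gt (scale alpha n)) theta L j
          (N * 2 ^ (n + l)).+1)
       <= light_bound theta L)%E).
Proof.
move=> z0 za zai.
have dR : 0 < d%:R :> R by rewrite ltr0n.
have ai0 : 0 < alpha^-1 by rewrite invr_gt0.
have [K [tau gr]] := psi_growth z0.
have [C1 [lam0 [C10 lam00 tail]]] := levy_tail levyX psiX d0 gr.
have zza : 0 < zeta < alpha by rewrite z0.
have [C3 [C30 occ]] := levy_occupation levyX psiX d0 gr N zza alpha_d.
have [n1 hn1] := pow2_small ai0 lam00.
have zai0 : 0 < alpha^-1 - zeta by rewrite subr_gt0.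
have d20 : 0 < (2 * d%:R)^-1 :> R by rewrite invr_gt0 mulr_gt0.
have [n2 hn2] := pow2_small zai0 d20.
pose a := alpha - zeta; have a0 : 0 < a by rewrite subr_gt0.
pose D : R := C3 * 2 `^ a; have D0 : 0 < D by rewrite mulr_gt0// pow2_gt0.
(* [C1] serves the first claim; 1 + D serves the second at l = 0, and 1 + C1 D at l > 0. *)
pose C := 1 + C1 + D + C1 * D.
have CD0 : 0 < C1 * D by rewrite mulr_gt0.
exists C, (maxn n1 n2); split; first by rewrite /C; lra.
move=> n; rewrite geq_max => /andP[/hn1 sn /hn2 rn] theta.
pose W := count_weight C zeta n.
have E1 : 1 <= (2 : R) `^ (zeta * (alpha + 2 / alpha) * n%:R).
  rewrite -[leLHS](powRr0 2); apply: ler_pow2.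
  by rewrite !mulr_ge0 ?addr_ge0 ?divr_ge0 ?(ltW z0) ?(ltW alpha0)//.
have C0 : 0 < C by rewrite /C; lra.
have W0 : 0 < W by rewrite mulr_gt0// pow2_gt0.
have th0 : 0 <= theta by rewrite invr_ge0 mulr_ge0// ltW.
have small p S : p * S <= W -> 2 * theta * p * S <= 1.
  move=> pS; rewrite -mulrA /theta -/W (_ : 2 * _ = W^-1); last by field; rewrite gt_eqF.
  by rewrite mulrC ler_pdivrMr// mul1r.
set s := scale alpha n in sn *.
have s0 : 0 < s by exact: pow2_gt0.
have mb : cmeas (norm_gt s) by exact: measurable_euclid_gt.
pose p m := C1 * mesh m * s `^ (- (alpha + zeta)).
have p0 m : 0 <= p m.
  by rewrite !mulr_ge0 ?powR_ge0 ?(ltW C10)// ltW// mesh_gt0.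
have pP m j : (P (incr X (tick (mesh m) j) (tick (mesh m) j.+1) (norm_gt s)) <= (p m)%:E)%E.
  rewrite prob_incr_tick// ?(ltW (mesh_gt0 m))// subSnn mul1r.
  by apply: tail; [exact: ltW (mesh_gt0 m)|rewrite s0 sn].
have sE : s `^ (- (alpha + zeta)) = 2 `^ ((1 + zeta / alpha) * n%:R).
  rewrite /s /scale -powRrM; congr (_ `^ _); field; rewrite gt_eqF//.
have pE l : p (n + l)%N = C1 * 2 `^ (- l%:R + zeta / alpha * n%:R).
  rewrite /p sE meshE -mulrA -pow2D natrD; congr (_ * 2 `^ _); ring.
have exp_le : (2 : R) `^ (zeta / alpha * n%:R) <= 2 `^ (zeta * (alpha + 2 / alpha) * n%:R).
  apply: ler_pow2; rewrite ler_wpM2r// ler_wpM2l ?(ltW z0)//.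
  by have := ltW alpha0; lra.
have mT : cmeas setT by exact: measurableT.
split.
- move=> l j L l0.
  (* No nearness is asked, so a single cell is enough: cell 0 is the whole space and all others are
     empty. *)
  apply: (@chain_weight_tail _ _ _ P d X levyX (mesh (n + l)) setT (norm_gt s)
    (ltW (mesh_gt0 _)) mT mb theta th0
    (fun z => if z == 0%N then setT else set0) (fun=> setT) (fun=> 1) (p (n + l)%N) (2 ^ l)) => //.
  + by move=> z; case: ifP.
  + by move=> i k _ _ [x [/=]]; case: eqP => [->|//] _; case: eqP => [->|].
  + by apply/seteqP; split => // x _; exists 0%N.
  + by move=> z i k ik; apply: prob_incr_tick_le1 => //; exact: ltW (mesh_gt0 _).
  + apply: small; rewrite sumr_const card_ord (_ : 1 *+ (2 ^ l) = (2 : R) `^ l%:R); last by rewrite pow2_nat.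
    rewrite pE -(mulrA C1) -pow2D.
    rewrite addrAC addNr add0r; apply: le_trans (ler_wpM2l (ltW C10) exp_le) _.
    by rewrite /W /count_weight ler_wpM2r ?powR_ge0// /C; lra.
  + exact: path_iota.
  + exact: all_iota_lt.
move=> l j L; set rho := 2 `^ _.
have r0 : 0 < rho by exact: pow2_gt0.
(* Freezing the first increment in a cell of radius [rho] doubles the radius of the target ball. *)
have r2d : 0 < 2 * rho <= d%:R^-1.
  rewrite mulr_gt0//= mulrC -ler_pdivlMr// -invfM mulrC /rho.
  by rewrite (_ : (zeta - _) * _ = - ((alpha^-1 - zeta) * n%:R))//; ring.
have hN : (N * 2 ^ (n + l))%:R * mesh (n + l) <= N%:R.
  by rewrite natrM /mesh mulfK// pnatr_eq0 -lt0n expn_gt0.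
have [q [q0 qP qS]] := occ _ _ _ r2d (mesh_gt0 (n + l)) hN.
have [Q [c [mQ tQ cQ dQ]]] := euclid_cells d0 r0.
(* For adjacent times no free increment is left and the return probability is bounded by 1; capping
   [p'] at 1 keeps this term bounded. *)
pose q' i := if i == 0%N then 1 else q i.
pose p' := if l == 0%N then 1 else Num.min 1 (p (n + l)%N).
have p'0 : 0 <= p' by rewrite /p'; case: ifP => // _; rewrite le_min ler01 p0.
have p'1 : p' <= 1 by rewrite /p'; case: ifP => // _; rewrite ge_min lexx.
have rhoE : C3 * (2 * rho) `^ a / mesh (n + l) <=
    D * 2 `^ (l%:R + zeta * (alpha + 1 / alpha) * n%:R).
  rewrite powRM ?(ltW r0)// (_ : C3 * (2 `^ a * rho `^ a) / mesh (n + l) = D * (rho `^ a / mesh (n + l))).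
    2: by rewrite /D !mulrA.
  rewrite ler_wpM2l ?(ltW D0)// /rho -powRrM meshE -powRN opprK -pow2D.
  apply: ler_pow2; rewrite natrD /a.
  have -> : (zeta - alpha^-1) * n%:R * (alpha - zeta) + (n%:R + l%:R) =
    l%:R + zeta * (alpha + 1 / alpha) * n%:R - zeta ^+ 2 * n%:R.
    by field; rewrite gt_eqF.
  by rewrite gerBl mulr_ge0// sqr_ge0.
have exp_le' : (2 : R) `^ (zeta * (alpha + 1 / alpha) * n%:R) <=
    2 `^ (zeta * (alpha + 2 / alpha) * n%:R).
  by apply: ler_pow2; rewrite ler_wpM2r// ler_wpM2l ?(ltW z0)// lerD2l ler_wpM2r ?(ltW ai0)// ler1n.
have S1 : \sum_(i < (N * 2 ^ (n + l)).+1) q' i <= 1 + D * 2 `^ (l%:R + zeta * (alpha + 1 / alpha) * n%:R).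
  rewrite big_ord_recl/= lerD2l; apply: le_trans rhoE.
  by apply: le_trans qS.
have S0 : 0 <= \sum_(i < (N * 2 ^ (n + l)).+1) q' i.
  by apply: sumr_ge0 => i _; rewrite /q'; case: ifP.
have tickle i k : (i <= k)%N -> tick (mesh (n + l)) i <= tick (mesh (n + l)) k.
  by move=> ik; apply: tick_le => //; exact: ltW (mesh_gt0 _).
have mif : cmeas (if l == 0%N then setT else norm_gt s) by case: ifP.
apply: (@chain_weight_tail _ _ _ P d X levyX (mesh (n + l)) (norm_le rho)
    (if l == 0%N then setT else norm_gt s)
    (ltW (mesh_gt0 _)) (measurable_norm_le rho) mif theta th0
    Q (fun z => [set y | euclid_norm (y + c z) <= 2 * rho]) q' p' (N * 2 ^ (n + l)).+1) => //.
- by move=> z; exact: measurable_euclid_ball.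
- move=> z x y /dQ hx /= hxy.
  have -> : y + c z = (x + y) - (x - c z).
    by rewrite opprB (addrC x) addrACA subrr addr0.
  apply: le_trans (euclid_normD _ _) _; rewrite euclid_normN.
  by have : euclid_norm (x + y) <= rho := hxy; lra.
- by move=> i; rewrite /q'; case: ifP.
- move=> z i k ik.
  have mz : cmeas [set y | euclid_norm (y + c z) <= 2 * rho].
    exact: measurable_euclid_ball.
  rewrite /q'; case: ifP => _.
    by apply: prob_incr_tick_le1 => //; exact: ltW (mesh_gt0 _).
  rewrite prob_incr_tick// ?(ltW (mesh_gt0 _))//.
  exact: qP.
- move=> i; rewrite /p'; case: ifP => _.
    by apply: prob_incr_tick_le1 => //; exact: ltW (mesh_gt0 _).
  rewrite EFin_min le_min pP andbT.
  by apply: prob_incr_tick_le1 => //; exact: ltW (mesh_gt0 _).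
- apply: small; rewrite /p' /W /count_weight.
  apply: (@le_trans _ _ (p' * (1 + D * 2 `^ (l%:R + zeta * (alpha + 1 / alpha) * n%:R)))).
    by rewrite ler_wpM2l.
  rewrite mulrDr mulr1.
  have : p' * (D * 2 `^ (l%:R + zeta * (alpha + 1 / alpha) * n%:R)) <=
      (D + C1 * D) * 2 `^ (zeta * (alpha + 2 / alpha) * n%:R).
    rewrite /p'; case: ifPn => [/eqP->|l0].
      rewrite mul1r add0r; apply: le_trans (ler_wpM2l (ltW D0) exp_le') _.
      by rewrite ler_wpM2r ?powR_ge0// lerDl ltW.
    apply: (@le_trans _ _ (p (n + l)%N * (D * 2 `^ (l%:R + zeta * (alpha + 1 / alpha) * n%:R)))).
      apply: ler_wpM2r; first by rewrite mulr_ge0 ?powR_ge0 ?(ltW D0).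
      by rewrite ge_min lexx orbT.
    rewrite pE mulrACA -pow2D.
    rewrite (_ : - l%:R + _ + _ = zeta * (alpha + 2 / alpha) * n%:R); last by field; rewrite gt_eqF.
    by rewrite ler_wpM2r ?powR_ge0// lerDr ltW.
  rewrite /C; set V := 2 `^ _ in E1 *.
  have := mulr_ge0 (ltW C10) (le_trans ler01 E1).
  by rewrite !mulrDl mul1r; lra.
- exact: path_iota.
- exact: all_iota_lt.
Qed.

End LevyCounts.

(** The number of events in the union bound: levels l <= 2n, starting points of levels up to 3n, and
    two kinds of chain. *)
Lemma box_card_le (N n : nat) :
  ((2 * n).+1 * (N * 2 ^ (3 * n)).+1 * 2 <= 4 * N.+1 * 2 ^ (4 * n))%N.
Proof.
have n2 : (n < 2 ^ n)%N by exact: ltn_expl.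
have e3 : (0 < 2 ^ (3 * n))%N by rewrite expn_gt0.
rewrite (_ : 4 * n = n + 3 * n)%N; last by lia.
rewrite expnD; move: (2 ^ n)%N (2 ^ (3 * n))%N n2 e3 => x y nx y0.
have h1 : ((2 * n).+1 <= 2 * x)%N by lia.
have h2 : ((N * y).+1 <= N.+1 * y)%N by lia.
by have := leq_mul h1 h2; lia.
Qed.

(** * Almost sure regularity by Borel-Cantelli *)

Section AlmostSure.
Context {disp : measure_display} {T : measurableType disp} {R : realType}.
Variables (P : probability T R) (d : nat) (X : R -> T -> 'rV[R]_d).
Variables (psi : 'rV[R]_d -> R) (alpha : R).
Hypothesis levyX : levy_process P X.
Hypothesis psiX : char_exponent P X (fun xi => (psi xi)%:C%C).
Hypotheses (d0 : (0 < d)%N) (alpha0 : 0 < alpha) (alpha_d : alpha <= d%:R).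
Hypothesis psi_growth : forall eps, 0 < eps -> exists K tau, growth psi alpha eps K tau.
Variable N : nat.

Local Notation cmeas := ((@coord_gen R d).-sigma.-measurable).
Local Notation dist := (@euclid_dist R d).

Lemma measurable_heavy h near bad theta L j H : 0 <= h -> cmeas near -> cmeas bad ->
  measurable (heavy X h near bad theta L j H).
Proof.
move=> h0 mn mb; rewrite -[X in measurable X]setTI; apply: measurable_fun_le => //.
exact: (measurable_chain_weight levyX).
Qed.

(** [dyadic] and [tick] at [mesh] are convertible, so only the symmetry of the distance
    intervenes. *)
Lemma jump_incr w s m j : jump dist (X ^~ w) s m j =
  (w \in incr X (tick (mesh m) j) (tick (mesh m) j.+1) (norm_gt s)).
Proof.
have [_ dC _] := euclid_dist_metric R d.
rewrite /jump dC /euclid_dist; apply/idP/idP => [h|/set_mem h]; last exact: h.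
by apply/mem_set.
Qed.

Lemma near_incr w r m i j :
  (dist (at_dyadic (X ^~ w) m i) (at_dyadic (X ^~ w) m j) <= r) =
  (w \in incr X (tick (mesh m) i) (tick (mesh m) j) (norm_le r)).
Proof.
have [_ dC _] := euclid_dist_metric R d.
rewrite dC /euclid_dist; apply/idP/idP => [h|/set_mem h]; last exact: h.
by apply/mem_set.
Qed.

(** By Bernoulli, trunc(2W) + 1 factors 1 + 1/(2W) already multiply to at least 2, so this length
    yields 2^(6n), more than the 2^(4n) of [box_card_le]. *)
Definition chain_length (W : R) (n : nat) := ((Num.trunc (2 * W)).+1 * (6 * n))%N.

Lemma light_bound_pow2 (W : R) (n : nat) : 0 < W ->
  (light_bound (2 * W)^-1 (chain_length W n) <= (2 * 2 `^ (- (6 * n)%:R))%:E)%E.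
Proof.
move=> W0; rewrite /light_bound lee_fin ler_wpM2l// powRN.
have W2 : 0 < 2 * W by rewrite mulr_gt0.
have th0 : 0 <= (2 * W)^-1 by rewrite invr_ge0 ltW.
rewrite lef_pV2 ?posrE ?powR_gt0 ?exprn_gt0 ?ltr_pwDl//.
rewrite powR_mulrn// /chain_length (exprM (1 + _)); apply: lerXn2r; rewrite ?nnegrE ?exprn_ge0 ?addr_ge0//.
apply: le_trans (bernoulli_expn _ th0).
suff : 1 <= (Num.trunc (2 * W)).+1%:R / (2 * W) by lra.
by rewrite ler_pdivlMr// mul1r ltW// truncnS_gt.
Qed.

Lemma almost_sure_counts (eta : R) : 0 < eta -> exists2 zeta : R, 0 < zeta &
  {ae P, forall w, exists n0, forall n, (n0 <= n)%N ->
    (forall l k, (0 < l <= 2 * n)%N -> (k < N * 2 ^ n)%N ->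
      (size (jumps dist (X ^~ w) (scale alpha n) n l k))%:R <= (2 : R) `^ (eta * n%:R)) /\
    (forall l (Z : seq nat), (l <= 2 * n)%N -> sorted ltn Z ->
      {in Z, forall j, (j <= N * 2 ^ (n + l))%N} ->
      ((0 < l)%N -> {in Z, forall j, jump dist (X ^~ w) (scale alpha n) (n + l) j}) ->
      {in Z &, forall i j, dist (at_dyadic (X ^~ w) (n + l) i) (at_dyadic (X ^~ w) (n + l) j)
         <= 2 `^ ((zeta - alpha^-1) * n%:R)} ->
      (size Z)%:R <= (2 : R) `^ (eta * n%:R))}.
Proof.
move=> eta0; have ai0 : 0 < alpha^-1 by rewrite invr_gt0.
pose b := alpha + 2 / alpha; have b0 : 0 < b by rewrite addr_gt0// divr_gt0.
(* The last bound gives zeta b <= eta / 2, so that the chain length, at most 18 C n 2^(zeta b n),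
   stays below 2^(eta n); the other two are required by [heavy_prob]. *)
pose zeta := Num.min (alpha / 2) (Num.min (alpha^-1 / 2) (eta / (2 * b))).
have z0 : 0 < zeta by rewrite !lt_min !divr_gt0// mulr_gt0.
have za : zeta < alpha by rewrite !gt_min ltr_pdivrMr// ltr_pMr// ltr1n.
have zai : zeta < alpha^-1.
  by rewrite !gt_min; apply/orP; right; rewrite ltr_pdivrMr// ltr_pMr// ltr1n.
have zb : zeta * b <= eta / 2.
  apply: (@le_trans _ _ (eta / (2 * b) * b)).
    by rewrite ler_wpM2r ?(ltW b0)// !ge_min lexx !orbT.
  by rewrite le_eqVlt; apply/orP; left; apply/eqP; field; rewrite gt_eqF.
exists zeta => //.
have [C [n1 [C1 hv]]] := heavy_prob levyX psiX d0 alpha0 alpha_d psi_growth N z0 za zai.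
have C0 : 0 < C := lt_le_trans ltr01 C1.
pose W n := count_weight alpha C zeta n.
have W0 n : 0 < W n by rewrite mulr_gt0// pow2_gt0.
pose theta n := (2 * W n)^-1.
have th0 n : 0 <= theta n by rewrite invr_ge0 mulr_ge0// ltW.
pose L n := chain_length (W n) n.
(* One index set for all levels: starting points run up to the bound of the finest level, since
   [heavy_prob] holds for any start. The boolean separates the chains for (L) from those for (U). *)
pose I n : finType := ('I_(2 * n).+1 * 'I_(N * 2 ^ (3 * n)).+1 * bool)%type.
pose bad (n l : nat) : set 'rV[R]_d := if l == 0%N then setT else norm_gt (scale alpha n).
pose near (n : nat) : set 'rV[R]_d := norm_le (2 `^ ((zeta - alpha^-1) * n%:R)).
pose A n (i : I n) : set T := if i.2
  then heavy X (mesh (n + i.1.1)) (near n) (bad n i.1.1) (theta n) (L n) i.1.2 (N * 2 ^ (n + i.1.1)).+1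
  else if i.1.1 == 0%N :> nat then set0
  else heavy X (mesh (n + i.1.1)) setT (norm_gt (scale alpha n)) (theta n) (L n) i.1.2 (2 ^ i.1.1).
have mT : cmeas setT by exact: measurableT.
have mb n l : cmeas (bad n l).
  by rewrite /bad; case: ifP => // _; exact: measurable_euclid_gt.
have mn n : cmeas (near n) by exact: measurable_norm_le.
have mA n i : measurable (A n i).
  rewrite /A; case: ifP => _; first exact: (measurable_heavy _ _ _ _ (ltW (mesh_gt0 _))).
  case: ifP => _ //; apply: measurable_heavy => //; first exact: ltW (mesh_gt0 _).
  exact: measurable_euclid_gt.
pose E n := \bigcup_(i in [set: I n]) A n i.
have mE n : measurable (E n) by apply: fin_bigcup_measurable.
have PE n : (n1 <= n)%N -> (P (E n) <= ((8 * N.+1%:R) * 2 `^ (- (2 * n%:R)))%:E)%E.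
  move=> n1n; have [hU hL] := hv n n1n.
  have PA i : (P (A n i) <= (2 * 2 `^ (- (6 * n)%:R))%:E)%E.
    rewrite /A; case: ifP => _.
      by apply: le_trans (hL _ _ _) _; exact: light_bound_pow2.
    case: ifPn => [_|i0]; first by rewrite measure0 lee_fin mulr_ge0// powR_ge0.
    by apply: le_trans (hU _ _ _ _) _; [rewrite lt0n|exact: light_bound_pow2].
  apply: le_trans (prob_cover_le (mA n) (mE n) _ PA) _.
    by move=> w [i _ Ai]; exists i.
  rewrite lee_fin !card_prod !card_ord card_bool.
  have cardle := box_card_le N n.
  apply: le_trans (ler_wpM2r _ (_ : _ <= (4 * N.+1 * 2 ^ (4 * n))%:R)) _.
  - by rewrite mulr_ge0// powR_ge0.
  - by rewrite ler_nat.
  rewrite natrM -pow2_nat le_eqVlt; apply/orP; left; apply/eqP.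
  rewrite (_ : - (2 * n%:R) = (4 * n)%:R - (6 * n)%:R); last by rewrite !natrM; ring.
  by rewrite pow2D natrM; ring.
have eta20 : 0 < eta / 2 by rewrite divr_gt0.
have [n2 hn2] := pow2_linear (18 * C) eta20.
have L_le n : (n2 <= n)%N -> (L n)%:R <= (2 : R) `^ (eta * n%:R).
  move=> /hn2 h.
  have e2 : (2 : R) `^ (zeta * b * n%:R) <= 2 `^ (eta / 2 * n%:R).
    by apply: ler_pow2; rewrite ler_wpM2r.
  have W1 : 1 <= W n.
    rewrite /W /count_weight -/b -[leLHS]mul1r; apply: ler_pM => //.
    rewrite -[leLHS](powRr0 2); apply: ler_pow2.
    by rewrite !mulr_ge0 ?(ltW z0) ?(ltW b0).
  have tr : (Num.trunc (2 * W n)).+1%:R <= 3 * W n.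
    have : (Num.trunc (2 * W n))%:R <= 2 * W n by rewrite truncn_le mulr_ge0// ltW.
    by rewrite -natr1; lra.
  rewrite /L /chain_length !natrM; apply: le_trans (ler_wpM2r _ tr) _; first by rewrite mulr_ge0.
  rewrite (_ : eta * n%:R = eta / 2 * n%:R + eta / 2 * n%:R); last by field.
  rewrite pow2D /W /count_weight -/b.
  rewrite (_ : 3 * _ * _ = 18 * C * n%:R * 2 `^ (zeta * b * n%:R)); last by ring.
  by apply: ler_pM; rewrite ?mulr_ge0 ?powR_ge0// ltW.
have c20 : 0 < 2 :> R by [].
have := borel_cantelli_pow2 (C := 8 * N.+1%:R) _ c20 mE PE.
move=> /(_ (mulr_ge0 (ler0n _ _) (ler0n _ _))).
apply: filterS => w [n3 hn3].
exists (maxn n2 n3) => n; rewrite geq_max => /andP[/L_le Ln /hn3 nE].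
have light (i : I n) : ~ A n i w by move=> Ai; apply: nE; exists i.
have lt3 l j : (l <= 2 * n)%N -> (j <= N * 2 ^ (n + l))%N -> (j < (N * 2 ^ (3 * n)).+1)%N.
  move=> ln jN; rewrite ltnS (leq_trans jN)// leq_mul2l leq_exp2l//.
  by rewrite (_ : 3 * n = n + 2 * n)%N ?leq_add2l ?ln ?orbT// -mulSn.
split.
- move=> l k /andP[l0 ln] kN; apply: le_trans Ln; rewrite ler_nat.
  have rng j : j \in jumps dist (X ^~ w) (scale alpha n) n l k ->
      (k * 2 ^ l <= j < k.+1 * 2 ^ l)%N.
    by rewrite mem_filter mem_iota (addnC (k * _)%N) -mulSn => /andP[_].
  apply: (@few_hits _ _ _ d X (mesh (n + l)) setT (norm_gt (scale alpha n))
    (theta n) _ (N * 2 ^ (n + l))%N (2 ^ l)%N w (th0 n)).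
  + move=> j jN; rewrite ltNge; apply/negP => hj.
    have lO : (l < (2 * n).+1)%N by rewrite ltnS.
    apply: (light (Ordinal lO, Ordinal (lt3 _ _ ln jN), false)).
    by rewrite /A/= gtn_eqF.
  + by apply: sorted_filter; [exact: ltn_trans|exact: iota_ltn_sorted].
  + move=> j /rng /andP[_ jk]; apply: leq_trans (ltnW jk) _.
    by rewrite expnD mulnA leq_mul2r kN orbT.
  + move=> i j /rng /andP[ki _] /rng /andP[_ jk].
    by rewrite leq_subLR (leq_trans (ltnW jk))// mulSn addnC leq_add2r.
  + by move=> i j _ _; apply/mem_set.
  + by move=> j; rewrite mem_filter -jump_incr => /andP[].
- move=> l Z ln sZ ZN bZ nZ; apply: le_trans Ln; rewrite ler_nat.
  apply: (@few_hits _ _ _ d X (mesh (n + l)) (near n) (bad n l)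
    (theta n) _ (N * 2 ^ (n + l))%N (N * 2 ^ (n + l)).+1 w (th0 n)) => //.
  + move=> j jN; rewrite ltNge; apply/negP => hj.
    have lO : (l < (2 * n).+1)%N by rewrite ltnS.
    exact: (light (Ordinal lO, Ordinal (lt3 _ _ ln jN), true)).
  + move=> i j iZ /ZN jN; apply: leq_trans (leq_subr _ _) _; exact: leqW.
  + by move=> i j iZ jZ; rewrite -near_incr; exact: nZ.
  + move=> j jZ; rewrite /bad; case: ifPn => [_|l0]; first exact/mem_set.
    by rewrite -jump_incr; apply: bZ => //; rewrite lt0n.
Qed.

Definition jump_threshold (m : nat) : R := 2 `^ (- ((3 * alpha)^-1 * m%:R)).

Lemma almost_sure_one_jump : {ae P, forall w, exists m0, forall m, (m0 <= m)%N ->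
  one_jump dist (X ^~ w) N jump_threshold m}.
Proof.
(* With this loss one large increment has probability of order 2^(-7m/12), two adjacent ones
   2^(-7m/6), and the sum over N 2^m intervals is of order 2^(-m/6). *)
have e0 : 0 < alpha / 4 by rewrite divr_gt0.
have [K [tau gr]] := psi_growth e0.
have [C [lam0 [C0 lam00 tail]]] := levy_tail levyX psiX d0 gr.
have c3 : 0 < (3 * alpha)^-1 by rewrite invr_gt0 mulr_gt0.
have [n1 hn1] := pow2_small c3 lam00.
pose A m (k : 'I_(N * 2 ^ m)) :=
  incr X (tick (mesh m.+1) k.*2) (tick (mesh m.+1) k.*2.+1) (norm_gt (jump_threshold m)) `&`
  incr X (tick (mesh m.+1) k.*2.+1) (tick (mesh m.+1) k.*2.+2) (norm_gt (jump_threshold m)).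
have h0 m : 0 <= mesh m :> R by exact: ltW (mesh_gt0 _).
have mB m : cmeas (norm_gt (jump_threshold m)) by exact: measurable_euclid_gt.
have mA m k : measurable (@A m k).
  by apply: measurableI; apply: (measurable_incr levyX) => //; exact: tick_ge0.
pose E m := \bigcup_(k in [set: 'I_(N * 2 ^ m)]) @A m k.
have mE m : measurable (E m) by apply: fin_bigcup_measurable.
have PE m : (n1 <= m)%N -> (P (E m) <= (N%:R * C ^+ 2 * 2 `^ (- (6^-1 * m%:R)))%:E)%E.
  move=> n1m; pose r : R := C * 2 `^ (- (7 / 12 * m%:R)).
  have r0 : 0 <= r by rewrite mulr_ge0 ?powR_ge0// ltW.
  have Pi k : (P (incr X (tick (mesh m.+1) k) (tick (mesh m.+1) k.+1)
      (norm_gt (jump_threshold m))) <= r%:E)%E.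
    rewrite (prob_incr_tick levyX _ _ (mB m)) ?h0// subSnn mul1r.
    have thr : 0 < jump_threshold m <= lam0 by rewrite /jump_threshold pow2_gt0 hn1.
    apply: (@le_trans _ _ (C * mesh m.+1 * jump_threshold m `^ (- (alpha + alpha / 4)))%:E).
      exact: tail (h0 _) thr.
    rewrite lee_fin meshE /jump_threshold -powRrM -mulrA -pow2D ler_wpM2l ?(ltW C0)//.
    apply: ler_pow2; rewrite -natr1.
    have -> : - (m%:R + 1) + - ((3 * alpha)^-1 * m%:R) * - (alpha + alpha / 4) =
      - (7 / 12 * m%:R) - 1 :> R by field; rewrite gt_eqF.
    by rewrite gerBl.
  have PA k : (P (@A m k) <= (r ^+ 2)%:E)%E.
    have pm := past_mono (tick_ge0 (h0 m.+1) k.*2) (past_setT levyX).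
    have t1 := tick_le (h0 m.+1) (leqnSn k.*2).
    have t2 := tick_le (h0 m.+1) (leqnSn k.*2.+1).
    have [p1 P1] := past_incr levyX (tick_ge0 (h0 m.+1) k.*2) t1 pm (mB m).
    have [_ P2] := past_incr levyX (tick_ge0 (h0 m.+1) k.*2.+1) t2 p1 (mB m).
    rewrite !setTI in P1 P2; rewrite /A P2 expr2 EFinM.
    by apply: lee_pmul => //; exact: Pi.
  apply: le_trans (prob_cover_le (@mA m) (mE m) _ PA) _.
    by move=> w [k _ Ak]; exists k.
  rewrite lee_fin card_ord natrM -pow2_nat /r exprMn expr2 (expr2 (_ `^ _)) -pow2D.
  rewrite le_eqVlt; apply/orP; left; apply/eqP.
  rewrite (_ : - (6^-1 * m%:R) = m%:R + (- (7 / 12 * m%:R) - 7 / 12 * m%:R)); last by field.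
  by rewrite !pow2D; ring.
have c6 : 0 < 6^-1 :> R by rewrite invr_gt0.
have := borel_cantelli_pow2 (C := N%:R * C ^+ 2) _ c6 mE PE.
move=> /(_ (mulr_ge0 (ler0n _ _) (sqr_ge0 _))).
apply: filterS => w [m0 hm0]; exists m0 => m /hm0 nE k kN.
apply: contrapT => /not_orP[h1 h2]; apply: nE; exists (Ordinal kN) => //.
have [_ dC _] := euclid_dist_metric R d.
have big i : ~ dist (at_dyadic (X ^~ w) m.+1 i) (at_dyadic (X ^~ w) m.+1 i.+1) <= jump_threshold m ->
    incr X (tick (mesh m.+1) i) (tick (mesh m.+1) i.+1) (norm_gt (jump_threshold m)) w.
  by move=> /negP; rewrite -ltNge dC.
by split; exact: big.
Qed.

End AlmostSure.

(** * Dimensions of images under a regular path *)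

Lemma cadlag_right_continuous (R : realType) (d : nat) (f : R -> 'rV[R]_d) :
  (0 < d)%N -> cadlag f -> right_continuous_path (@euclid_dist R d) f.
Proof.
move=> d0 [rc _] t e t0 e0.
have ed0 : 0 < e / d%:R by rewrite divr_gt0// ltr0n.
have coord i : \forall u \near t^'+, `|f t 0 i - f u 0 i| <= e / d%:R.
  have : f u 0 i @[u --> t^'+] --> f t 0 i.
    exact: (cvg_comp _ _ (rc t t0) (@coord_continuous R 1 d 0 i (f t))).
  by move=> /cvgrPdist_le; apply.
have : \forall u \near t^'+, forall i, `|f t 0 i - f u 0 i| <= e / d%:R.
  exact: filter_forall.
rewrite near_withinE => /nbhs_ballP[delta /= delta0 hd].
exists delta => // s /andP[ts st]; rewrite /euclid_dist.
apply: euclid_le_coord => // i; rewrite !mxE; apply: (hd s) => //.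
by rewrite /ball/= ltr_norml; apply/andP; split; lra.
Qed.

(** Shrinking the relation shrinks the sets to be covered; this restricts the transfer to times in
    E. *)
Lemma scale_transfer_sub (R : realType) (V1 V2 : Type) (dist1 : V1 -> V1 -> R)
    (dist2 : V2 -> V2 -> R) (r r' : V1 -> V2 -> Prop) (u v : R) :
  (forall x y, r' x y -> r x y) -> scale_transfer dist1 dist2 r u v ->
  scale_transfer dist1 dist2 r' u v.
Proof.
move=> rr' h eta /h[n0 hn0]; exists n0 => n /hn0 hn U /hn[k [W [kW UW dW]]].
exists k, W; split=> // y [x Ux rxy]; apply: UW; exists x => //.
exact: rr'.
Qed.

Section RegularPath.
Variables (R : realType) (d : nat) (f : R -> 'rV[R]_d) (alpha : R).
Hypothesis alpha0 : 0 < alpha.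
Hypothesis reg : forall N, path_regular (@euclid_dist R d) f N alpha.
Variable E : set R.
Hypothesis E0 : E `<=` [set t | 0 <= t].

(** Membership in E belongs to the relation, so that the inverse sends f(E) back to E and not to all
    times with a value in f(E). *)
Let visit N t y := E t /\ visits f N t y.

Let visit_sub N t y : visit N t y -> visits f N t y.
Proof. by case. Qed.

Let in_horizon t : E t -> exists N, 0 <= t < N%:R.
Proof.
by move=> /E0/= t0; exists (Num.trunc t).+1; rewrite t0/= truncnS_gt.
Qed.

Let image_visit : f @` E = \bigcup_N rel_image (visit N) E.
Proof.
apply/seteqP; split=> [_ [t Et <-]|y [N _ [t Et [_ [_ ->]]]]]; last by exists t.
have [N tN] := in_horizon Et; exists N => //; exists t => //.
Qed.

Let preimage_visit : E = \bigcup_N rel_image (fun y t => visit N t y) (f @` E).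
Proof.
apply/seteqP; split=> [t Et|t [N _ [y _ [Et _]]] //].
have [N tN] := in_horizon Et; exists N => //; exists (f t); first by exists t.
by [].
Qed.

Let ai0 : 0 < alpha^-1. Proof. by rewrite invr_gt0. Qed.

Lemma regular_path_hausdorff_dim :
  (hausdorff_dim (@euclid_dist R d) (f @` E) = alpha%:E * hausdorff_dim (@real_dist R) E)%E.
Proof.
have up := hausdorff_dim_transfer ltr01 ai0 (fun N => scale_transfer_sub
  (@visit_sub N) (visits_transfer (euclid_dist_metric R d) alpha0 (reg N))) image_visit.
have lo := hausdorff_dim_transfer ai0 ltr01 (fun N => scale_transfer_sub
  (fun y t => @visit_sub N t y) (visits_transfer_inv (euclid_dist_metric R d) alpha0 (reg N))) preimage_visit.
apply/eqP; rewrite eq_le; apply/andP; split.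
  by move: up; rewrite div1r invrK.
by rewrite -lee_pdivlMl//; move: lo; rewrite divr1.
Qed.

Lemma regular_path_packing_dim :
  (packing_dim (@euclid_dist R d) (f @` E) = alpha%:E * packing_dim (@real_dist R) E)%E.
Proof.
have mR := real_dist_metric R; have md := euclid_dist_metric R d.
have up := packing_dim_transfer mR md ltr01 ai0 (fun N => scale_transfer_sub
  (@visit_sub N) (visits_transfer md alpha0 (reg N))) image_visit 0 0.
have lo := packing_dim_transfer md mR ai0 ltr01 (fun N => scale_transfer_sub
  (fun y t => @visit_sub N t y) (visits_transfer_inv md alpha0 (reg N))) preimage_visit 0 0.
apply/eqP; rewrite eq_le; apply/andP; split.
  by move: up; rewrite div1r invrK.
by rewrite -lee_pdivlMl//; move: lo; rewrite divr1.
Qed.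

End RegularPath.

Theorem theorem4p4 (R : realType) (disp : measure_display)
    (T : measurableType disp) (P : probability T R) (d : nat)
    (X : R -> T -> 'rV[R]_d) (psi : 'rV[R]_d -> R) (alpha : R)
    (levyX : levy_process P X) (symX : symmetric_process P X)
    (psiX : char_exponent P X (fun xi => (psi xi)%:C%C))
    (alpha_gt0 : 0 < alpha) (alpha_le2 : alpha <= 2)
    (cond : (alpha < d%:R /\ condition_B3 psi alpha) \/
            (alpha = d%:R /\ condition_B4 psi alpha)) :
  {ae P, forall w, forall E : set R, measurable E -> E `<=` [set t | 0 <= t] ->
    (hausdorff_dim (@euclid_dist R d) (X ^~ w @` E)
       = alpha%:E * hausdorff_dim (@real_dist R) E)%E /\
    (packing_dim (@euclid_dist R d) (X ^~ w @` E)
       = alpha%:E * packing_dim (@real_dist R) E)%E}.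
Proof.
have alpha_d : alpha <= d%:R by case: cond => [[/ltW]|[->]].
have B3 : condition_B3 psi alpha by case: cond => [[_]//|[_ /condition_B4_B3]].
have d0 : (0 < d)%N by rewrite -(ltr0n R) (lt_le_trans alpha_gt0).
have gr : forall eps, 0 < eps -> exists K tau, growth psi alpha eps K tau.
  by apply: condition_B3_growth => //; rewrite alpha_gt0.
have jumps_ae N := almost_sure_one_jump levyX psiX d0 alpha_gt0 gr N.
(* Countably many eta and horizons keep the exceptional set null; [zeta] is chosen for each pair
   independently of the sample point. *)
pose eta k : R := k.+1%:R^-1.
have eta0 k : 0 < eta k by rewrite invr_gt0.
have /choice[zeta hzeta] : forall p : nat * nat, exists zeta : R, 0 < zeta /\
  {ae P, forall w, exists n0, forall n, (n0 <= n)%N ->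
    (forall l k, (0 < l <= 2 * n)%N -> (k < p.1 * 2 ^ n)%N ->
      (size (jumps (@euclid_dist R d) (X ^~ w) (scale alpha n) n l k))%:R
        <= (2 : R) `^ (eta p.2 * n%:R)) /\
    (forall l (Z : seq nat), (l <= 2 * n)%N -> sorted ltn Z ->
      {in Z, forall j, (j <= p.1 * 2 ^ (n + l))%N} ->
      ((0 < l)%N -> {in Z, forall j,
        jump (@euclid_dist R d) (X ^~ w) (scale alpha n) (n + l) j}) ->
      {in Z &, forall i j, euclid_dist (at_dyadic (X ^~ w) (n + l) i)
          (at_dyadic (X ^~ w) (n + l) j) <= 2 `^ ((zeta - alpha^-1) * n%:R)} ->
      (size Z)%:R <= (2 : R) `^ (eta p.2 * n%:R))}.
  move=> [N k].
  have [z z0 hz] := almost_sure_counts levyX psiX d0 alpha_gt0 alpha_d gr N (eta0 k).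
  by exists z.
have regular : {ae P, forall w, forall N, path_regular (@euclid_dist R d) (X ^~ w) N alpha}.
  apply: ae_foralln => N.
  have counts_ae := ae_foralln (fun k => proj2 (hzeta (N, k))).
  apply: filterS3 (levy_cadlag levyX) (jumps_ae N) counts_ae => w cad oj cnt.
  split=> //; first exact: cadlag_right_continuous.
  move=> e e0; pose k := Num.trunc e^-1.
  have ke : eta k <= e.
    by rewrite -[leRHS]invrK lef_pV2 ?posrE ?invr_gt0// ltW// truncnS_gt.
  exists (zeta (N, k)); first exact: (proj1 (hzeta _)).
  have [n0 hn0] := cnt k; exists n0 => n /hn0[hb hc].
  have le_e : (2 : R) `^ (eta k * n%:R) <= 2 `^ (e * n%:R).
    by apply: ler_pow2; rewrite ler_wpM2r.
  split=> [l j l0 jN|l Z ln sZ ZN bZ nZ].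
    exact: le_trans (hb _ _ l0 jN) le_e.
  exact: le_trans (hc _ _ ln sZ ZN bZ nZ) le_e.
(* The exceptional set is fixed before E is introduced; the rest is deterministic, which gives all E
   simultaneously. *)
apply: filterS regular => w reg E _ E0; split.
  exact: regular_path_hausdorff_dim.
exact: regular_path_packing_dim.
Qed.
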